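(* For $n\geq 2$, let $X\subset \mathbb{P}^{n+1}$ be a smooth hypersurface of degree $d\geq 3$ over $\mathbb{C}$. Then for any integer $k\geq 1$ we have $$H^0\bigl(X,\mathrm{Sym}^k (T_X\otimes \mathcal{O}_{X}(d-3))\bigr)=0.$$
   Context: $T_X$ is the tangent bundle of $X$, and $\mathcal{O}_X(m)$ is the restriction to $X$ of $\mathcal{O}_{\mathbb{P}^{n+1}}(m)$. *)

(* Defs.v *)
From HB Require Import structures.
From mathcomp Require Import all_boot all_order all_algebra perm.
From mathcomp Require Import mathcomp_extra boolp classical_sets functions.
From mathcomp Require Import cardinality fsbigop reals.
From mathcomp Require Import mpoly complex.

Set Implicit Arguments.
Unset Strict Implicit.
Unset Printing Implicit Defensive.

Import GRing.Theory.
Local Open Scope ring_scope.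
Local Open Scope classical_set_scope.
Local Open Scope quotient_scope.

Section FreeModule.
Variables (R : comPzRingType) (G : choiceType).

Definition fin_supp : {pred G -> R^o} :=
  fun f => `[< finite_set [set g | f g != 0] >].

Lemma fin_supp_submod : submod_closed fin_supp.
Proof.
split=> [|a f g /asboolP fF /asboolP gF]; apply/asboolP.
  rewrite (_ : [set _ | _] = set0) //; apply/seteqP; split=> // x /=.
  by rewrite eqxx.
apply: (@sub_finite_set _ _ ([set x | f x != 0] `|` [set x | g x != 0])).
  move=> x /= h; have [f0|fn0] := eqVneq (f x) 0; last by left.
  right; apply: contra_neq h => g0.
  have -> : (a *: f + g) x = a * f x + g x by [].
  by rewrite f0 g0 mulr0 addr0.
by rewrite finite_setU.
Qed.

HB.instance Definition _ :=
  GRing.isSubmodClosed.Build R (G -> R^o) fin_supp fin_supp_submod.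

Record freemod := FreeMod {
  coef :> G -> R^o;
  coefP : coef \in fin_supp }.

HB.instance Definition _ := [isSub for coef].
HB.instance Definition _ := [Choice of freemod by <:].
HB.instance Definition _ := [SubChoice_isSubLmodule of freemod by <:].

Lemma gen_fin_supp (g : G) : (fun h => (h == g)%:R) \in fin_supp.
Proof.
apply/asboolP; apply: (@sub_finite_set _ _ [set g]) => // h /=.
by have [->|_] := eqVneq h g; rewrite ?eqxx.
Qed.

Definition gen (g : G) : freemod := FreeMod (gen_fin_supp g).

Lemma freemodP (x y : freemod) : coef x =1 coef y -> x = y.
Proof. by move=> e; apply/val_inj/funext. Qed.

Lemma coefD (x y : freemod) g : (x + y) g = x g + y g. Proof. by []. Qed.
Lemma coefZ a (x : freemod) g : (a *: x) g = a * x g. Proof. by []. Qed.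
Lemma coef0 g : (0 : freemod) g = 0. Proof. by []. Qed.

Lemma coef_finite (x : freemod) : finite_set [set g | x g != 0].
Proof. by apply/asboolP; exact: coefP. Qed.

End FreeModule.

Section FreeLift.
Variables (R R' : comPzRingType) (rho : {rmorphism R -> R'}).
Variables (G : choiceType) (M : lmodType R') (phi : G -> M).

Definition freelift (x : freemod R G) : M :=
  \sum_(g \in [set: G]) (rho (x g) *: phi g).

Lemma freelift_widen (x : freemod R G) (A : set G) : finite_set A ->
  [set g | x g != 0] `<=` A ->
  freelift x = \sum_(g \in A) (rho (x g) *: phi g).
Proof.
move=> Af xA; apply/esym/fsbig_widen => // g [_ /= gA].
have [->|/xA//] := eqVneq (x g) 0; by rewrite /preimage /= rmorph0 scale0r.
Qed.

Lemma freelift_semilinear a (x y : freemod R G) :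
  freelift (a *: x + y) = rho a *: freelift x + freelift y.
Proof.
pose A := [set g | x g != 0] `|` [set g | y g != 0].
have Af : finite_set A by rewrite finite_setU; split; exact: coef_finite.
rewrite !(@freelift_widen _ A) //;
  [ |by move=> g; right|by move=> g; left|]; last first.
  move=> g h; have [x0|] := eqVneq (x g) 0; last by left.
  right; apply: contra_neq h => y0.
  have -> : coef (a *: x + y) g = a * x g + y g by [].
  by rewrite x0 y0 mulr0 addr0.
rewrite !fsbig_finite // scaler_sumr -big_split; apply: eq_bigr => g _.
by rewrite coefD coefZ rmorphD rmorphM scalerDl scalerA.
Qed.

Lemma freelift_gen g : freelift (gen R g) = phi g.
Proof.
rewrite (@freelift_widen _ [set g]) //; last first.
  by move=> h /=; have [->|_] := eqVneq h g; rewrite ?eqxx.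
by rewrite fsbig_set1 /= eqxx rmorph1 scale1r.
Qed.

End FreeLift.

Lemma freemod_ind (R : comPzRingType) (G : choiceType)
    (P : freemod R G -> Prop) :
  P 0 -> (forall a g x, P x -> P (a *: gen R g + x)) -> forall x, P x.
Proof.
move=> P0 PS x; pose s := finmap.enum_fset (fset_set [set g | x g != 0]).
rewrite (_ : x = \sum_(g <- s) (x g : R) *: gen R g).
  by elim/big_rec: _ => // g y _; exact: PS.
apply: freemodP => h.
have -> : coef (\sum_(g <- s) (x g : R) *: gen R g) h = \sum_(g <- s) x g * (h == g)%:R.
  by elim/big_rec2: _ => [|g z y _ <-] //.
have [hs|hs] := boolP (h \in s).
  rewrite (big_rem h) //= eqxx mulr1 big_seq big1 ?addr0 // => g.
  rewrite mem_rem_uniq ?finmap.fset_uniq // inE => /andP[/negPf gh _].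
  by rewrite eq_sym gh mulr0.
rewrite big_seq big1 => [|g gs]; last first.
  by case: eqP hs => [->|_ _]; rewrite ?gs ?mulr0.
apply/eqP; apply: contraNT hs => xh.
by rewrite in_fset_set ?inE //; exact: coef_finite.
Qed.

Section Quotient.
Variables (R : comPzRingType) (M : lmodType R) (S : set M).

Inductive span : set M :=
| span_gen x : S x -> span x
| span0 : span 0
| spanD x y : span x -> span y -> span (x + y)
| spanZ a x : span x -> span (a *: x).

Definition span_pred : {pred M} := fun x => `[< span x >].

Lemma span_zmod_closed : zmod_closed span_pred.
Proof.
split=> [|x y /asboolP xS /asboolP yS]; apply/asboolP; first exact: span0.
by rewrite -scaleN1r; apply: spanD => //; exact: spanZ.
Qed.

HB.instance Definition _ :=
  GRing.isZmodClosed.Build M span_pred span_zmod_closed.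

Definition quotmod := {ideal_quot (span_pred : zmodClosed M)}.
HB.instance Definition _ := GRing.Zmodule.on quotmod.

Definition proj (x : M) : quotmod := \pi x.

Lemma projD x y : proj (x + y) = proj x + proj y.
Proof. by rewrite /proj !piE. Qed.

Lemma proj_eq x y : proj x = proj y <-> span (x - y).
Proof.
rewrite /proj; split=> [/eqP|h].
  by rewrite -Quotient.idealrBE => /asboolP.
by apply/eqP; rewrite -Quotient.idealrBE; apply/asboolP.
Qed.

Lemma proj_repr (q : quotmod) : proj (repr q) = q.
Proof. exact: reprK. Qed.

Definition quot_scale a (q : quotmod) : quotmod := proj (a *: repr q).

Lemma quot_scaleE a x : quot_scale a (proj x) = proj (a *: x).
Proof.
apply/proj_eq; rewrite -scalerBr; apply: spanZ.
by apply/proj_eq; rewrite proj_repr.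
Qed.

Fact quot_scaleA a b q : quot_scale a (quot_scale b q) = quot_scale (a * b) q.
Proof. by rewrite -[q]proj_repr !quot_scaleE scalerA. Qed.

Fact quot_scale1 : left_id 1 quot_scale.
Proof. by move=> q; rewrite -[q]proj_repr !quot_scaleE scale1r. Qed.

Fact quot_scaleDr : right_distributive quot_scale +%R.
Proof.
move=> a p q; rewrite -[p]proj_repr -[q]proj_repr.
by rewrite -projD !quot_scaleE scalerDr projD.
Qed.

Fact quot_scaleDl q : {morph quot_scale^~ q : a b / a + b}.
Proof. by move=> a b; rewrite -[q]proj_repr !quot_scaleE scalerDl projD. Qed.

HB.instance Definition _ := GRing.Zmodule_isLmodule.Build R quotmod
  quot_scaleA quot_scale1 quot_scaleDr quot_scaleDl.

Lemma projZ a x : proj (a *: x) = a *: proj x.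
Proof. by rewrite [RHS]quot_scaleE. Qed.

Lemma proj0 : proj 0 = 0.
Proof. by apply: (addrI (proj 0)); rewrite -projD !addr0. Qed.

Lemma projB x y : proj (x - y) = proj x - proj y.
Proof. by apply/eqP; rewrite eq_sym subr_eq -projD subrK. Qed.

Lemma proj_rel x : S x -> proj x = 0.
Proof.
move=> Sx; rewrite -proj0; apply/proj_eq; rewrite subr0; exact: span_gen.
Qed.

End Quotient.

Definition semilinear_map (R R' : comPzRingType) (rho : {rmorphism R -> R'})
    (M : lmodType R) (N : lmodType R') (f : M -> N) :=
  forall a x y, f (a *: x + y) = rho a *: f x + f y.

Section Semilinear.
Variables (R R' : comPzRingType) (rho : {rmorphism R -> R'}).
Variables (M : lmodType R) (N : lmodType R') (f : M -> N).
Hypothesis fP : semilinear_map rho f.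

Lemma semilin0 : f 0 = 0.
Proof.
have := fP 1 0 0; rewrite scale1r addr0 rmorph1 scale1r => /eqP.
by rewrite eq_sym -subr_eq0 addrK => /eqP.
Qed.

Lemma semilinD x y : f (x + y) = f x + f y.
Proof. by have := fP 1 x y; rewrite rmorph1 !scale1r. Qed.

Lemma semilinZ a x : f (a *: x) = rho a *: f x.
Proof. by have := fP a x 0; rewrite !addr0 semilin0 addr0. Qed.

Lemma semilinN x : f (- x) = - f x.
Proof. by rewrite -scaleN1r semilinZ rmorphN1 scaleN1r. Qed.

Lemma semilinB x y : f (x - y) = f x - f y.
Proof. by rewrite semilinD semilinN. Qed.

Definition quotlift (S : set M) (q : quotmod S) : N := f (repr q).

Variable S : set M.
Hypothesis fS : forall x, S x -> f x = 0.

Lemma quotliftE x : quotlift (proj S x) = f x.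
Proof.
have fspan z : span S z -> f z = 0.
  elim=> [y /fS//||y1 y2 _ h1 _ h2|a y _ h].
  - exact: semilin0.
  - by rewrite semilinD h1 h2 addr0.
  - by rewrite semilinZ h scaler0.
apply/eqP; rewrite /quotlift -subr_eq0 -semilinB; apply/eqP/fspan.
by apply/proj_eq; rewrite proj_repr.
Qed.

Lemma quotlift_semilinear : semilinear_map rho (@quotlift S).
Proof.
move=> a p q; rewrite -[p]proj_repr -[q]proj_repr -projZ -projD.
by rewrite !quotliftE fP.
Qed.

End Semilinear.
Arguments quotlift {R R' M N} f {S} q.

Section Tensor.
Variables (R : comPzRingType) (M N : lmodType R).
Local Notation "<< m , n >>" := (gen R (m, n)).

Inductive tensor_rel : set (freemod R (M * N)%type) :=
| tensor_Dl m m' n : tensor_rel (<<m + m', n>> - <<m, n>> - <<m', n>>)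
| tensor_Dr m n n' : tensor_rel (<<m, n + n'>> - <<m, n>> - <<m, n'>>)
| tensor_Zl a m n : tensor_rel (<<a *: m, n>> - a *: <<m, n>>)
| tensor_Zr a m n : tensor_rel (<<m, a *: n>> - a *: <<m, n>>).

Definition tensor := quotmod tensor_rel.
HB.instance Definition _ := GRing.Lmodule.on tensor.

Definition tens (m : M) (n : N) : tensor := proj tensor_rel <<m, n>>.

Lemma tensDl m m' n : tens (m + m') n = tens m n + tens m' n.
Proof.
apply/eqP; rewrite -projD -subr_eq0; apply/eqP.
by rewrite -projB opprD addrA; apply: proj_rel; exact: tensor_Dl.
Qed.

Lemma tensDr m n n' : tens m (n + n') = tens m n + tens m n'.
Proof.
apply/eqP; rewrite -projD -subr_eq0; apply/eqP.
by rewrite -projB opprD addrA; apply: proj_rel; exact: tensor_Dr.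
Qed.

Lemma tensZl a m n : tens (a *: m) n = a *: tens m n.
Proof.
apply/eqP; rewrite -projZ -subr_eq0 -projB; apply/eqP.
by apply: proj_rel; exact: tensor_Zl.
Qed.

Lemma tensZr a m n : tens m (a *: n) = a *: tens m n.
Proof.
apply/eqP; rewrite -projZ -subr_eq0 -projB; apply/eqP.
by apply: proj_rel; exact: tensor_Zr.
Qed.

Lemma tensor_ind (P : tensor -> Prop) :
  P 0 -> (forall a m n q, P q -> P (a *: tens m n + q)) -> forall q, P q.
Proof.
move=> P0 PS q; rewrite -[q]proj_repr; elim/freemod_ind: (repr q).
  by rewrite proj0.
by move=> a [m n] x; rewrite projD projZ; exact: PS.
Qed.

End Tensor.

Section TensorMap.
Variables (R R' : comPzRingType) (rho : {rmorphism R -> R'}).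
Variables (M N : lmodType R) (M' N' : lmodType R').
Variables (f : M -> M') (g : N -> N').

Definition tensor_map : tensor M N -> tensor M' N' :=
  quotlift (freelift rho (fun p => tens (f p.1) (g p.2))).

Hypothesis fP : semilinear_map rho f.
Hypothesis gP : semilinear_map rho g.

Let killed x : tensor_rel x ->
  freelift rho (fun p => tens (f p.1) (g p.2)) x = 0.
Proof.
have L := freelift_semilinear rho (fun p => tens (f p.1) (g p.2)).
case=> [m m' n|m n n'|a m n|a m n];
  rewrite !(semilinB L) ?(semilinZ L) !freelift_gen /=.
- by rewrite (semilinD fP) tensDl addrAC addrK subrr.
- by rewrite (semilinD gP) tensDr addrAC addrK subrr.
- by rewrite (semilinZ fP) tensZl subrr.
- by rewrite (semilinZ gP) tensZr subrr.
Qed.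

Lemma tensor_mapE m n : tensor_map (tens m n) = tens (f m) (g n).
Proof.
rewrite /tensor_map /tens (quotliftE (freelift_semilinear _ _) killed).
by rewrite freelift_gen.
Qed.

Lemma tensor_map_semilinear : semilinear_map rho tensor_map.
Proof. exact: (quotlift_semilinear (freelift_semilinear _ _) killed). Qed.

End TensorMap.

Section SymPower.
Variables (R : comPzRingType) (M : lmodType R) (k : nat).

Definition subst_at (t : {ffun 'I_k -> M}) (i : 'I_k) (x : M) :
  {ffun 'I_k -> M} := [ffun j => if j == i then x else t j].

Inductive sym_rel : set (freemod R {ffun 'I_k -> M}) :=
| sym_D t i x y : sym_rel (gen R (subst_at t i (x + y))
    - gen R (subst_at t i x) - gen R (subst_at t i y))
| sym_Z t i a x : sym_rel (gen R (subst_at t i (a *: x))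
    - a *: gen R (subst_at t i x))
| sym_perm (t : {ffun 'I_k -> M}) (s : 'S_k) :
    sym_rel (gen R [ffun j => t (s j)] - gen R t).

Definition sympow := quotmod sym_rel.
HB.instance Definition _ := GRing.Lmodule.on sympow.

Definition symprod (t : {ffun 'I_k -> M}) : sympow := proj sym_rel (gen R t).

Lemma symprodD t i x y : symprod (subst_at t i (x + y)) =
  symprod (subst_at t i x) + symprod (subst_at t i y).
Proof.
apply/eqP; rewrite -projD -subr_eq0; apply/eqP.
by rewrite -projB opprD addrA; apply: proj_rel; exact: sym_D.
Qed.

Lemma symprodZ t i a x :
  symprod (subst_at t i (a *: x)) = a *: symprod (subst_at t i x).
Proof.
apply/eqP; rewrite -projZ -subr_eq0 -projB; apply/eqP.
by apply: proj_rel; exact: sym_Z.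
Qed.

Lemma symprod_perm (t : {ffun 'I_k -> M}) (s : 'S_k) : symprod [ffun j => t (s j)] = symprod t.
Proof.
apply/eqP; rewrite -subr_eq0 -projB; apply/eqP.
by apply: proj_rel; exact: sym_perm.
Qed.

Lemma sympow_ind (P : sympow -> Prop) :
  P 0 -> (forall a t q, P q -> P (a *: symprod t + q)) -> forall q, P q.
Proof.
move=> P0 PS q; rewrite -[q]proj_repr; elim/freemod_ind: (repr q).
  by rewrite proj0.
by move=> a t x; rewrite projD projZ; exact: PS.
Qed.

End SymPower.

Section SymPowerMap.
Variables (R R' : comPzRingType) (rho : {rmorphism R -> R'}).
Variables (M : lmodType R) (M' : lmodType R') (k : nat) (f : M -> M').

Let image (t : {ffun 'I_k -> M}) : {ffun 'I_k -> M'} := [ffun i => f (t i)].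

Definition sympow_map : sympow M k -> sympow M' k :=
  quotlift (freelift rho (fun t => symprod (image t))).

Hypothesis fP : semilinear_map rho f.

Let image_subst t i x : image (subst_at t i x) = subst_at (image t) i (f x).
Proof. by apply/ffunP => j; rewrite !ffunE; case: eqP. Qed.

Let killed x : sym_rel x -> freelift rho (fun t => symprod (image t)) x = 0.
Proof.
have L := freelift_semilinear rho (fun t => symprod (image t)).
case=> [t i y z|t i a y|t s];
  rewrite !(semilinB L) ?(semilinZ L) !freelift_gen ?image_subst /=.
- by rewrite (semilinD fP) symprodD addrAC addrK subrr.
- by rewrite (semilinZ fP) symprodZ subrr.
- rewrite -(symprod_perm (image t) s); apply/eqP; rewrite subr_eq0; apply/eqP.
  by congr symprod; apply/ffunP => j; rewrite !ffunE.
Qed.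

Lemma sympow_mapE (t : {ffun 'I_k -> M}) :
  sympow_map (symprod t) = symprod [ffun i => f (t i)].
Proof.
rewrite /sympow_map /symprod (quotliftE (freelift_semilinear _ _) killed).
by rewrite freelift_gen.
Qed.

Lemma sympow_map_semilinear : semilinear_map rho sympow_map.
Proof. exact: (quotlift_semilinear (freelift_semilinear _ _) killed). Qed.

End SymPowerMap.

(* A point of P^(N-1) is given by homogeneous coordinates, i.e. a nonzero vector
   of C^N.  A subset of P^(N-1) is represented by its cone in C^N \ {0}, a regular
   function by a function on the cone which is homogeneous of degree 0, and a
   section of O(m) by one which is homogeneous of degree m. *)

Section Hypersurface.
Variables (C : closedFieldType) (N : nat).
Local Notation V := 'rV[C]_N.

Definition ev (P : {mpoly C[N]}) (v : V) : C := P.@[fun i => v ord0 i].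

Definition hypersurface (F : {mpoly C[N]}) : set V :=
  [set v | v != 0 /\ ev F v = 0].

(* The Jacobian criterion, for the subscheme of P^(N-1) defined by F; for
   N > 1 it implies that F is squarefree, hence that this subscheme is reduced. *)
Definition smooth_hypersurface (F : {mpoly C[N]}) : Prop :=
  forall v, hypersurface F v -> exists i, ev F^`M(i) v != 0.

Variable F : {mpoly C[N]}.
Local Notation X := (hypersurface F).

Definition zariski_open (U : set V) : Prop :=
  exists S : set {mpoly C[N]}, (forall P, S P -> exists e, P \is e.-homog) /\
    U = [set v | X v /\ exists2 P, S P & ev P v != 0].

Record zopen := ZOpen { zset :> set V; zsetP : zariski_open zset }.

Lemma ev1 v : ev 1 v = 1. Proof. exact: meval1. Qed.
Lemma evM P Q v : ev (P * Q) v = ev P v * ev Q v. Proof. exact: mevalM. Qed.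
Lemma evD P Q v : ev (P + Q) v = ev P v + ev Q v. Proof. exact: mevalD. Qed.
Lemma evN P v : ev (- P) v = - ev P v. Proof. exact: mevalN. Qed.
Lemma evC c v : ev c%:MP v = c. Proof. exact: mevalC. Qed.

Lemma zariski_openT : zariski_open X.
Proof.
exists [set 1]; split=> [P ->|]; first by exists 0%N; exact: dhomog1.
apply/seteqP; split=> [v Xv|v []//]; split=> //.
by exists 1 => //; rewrite ev1 oner_neq0.
Qed.

Definition zopenT : zopen := ZOpen zariski_openT.

Lemma zariski_openI (U W : set V) :
  zariski_open U -> zariski_open W -> zariski_open (U `&` W).
Proof.
move=> [S [Sh ->]] [T [Th ->]].
exists [set R | exists P Q, [/\ S P, T Q & R = P * Q]]; split.
  move=> _ [P [Q [/Sh[e Pe] /Th[e' Qe'] ->]]].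
  by exists (e + e')%N; exact: dhomogM.
apply/seteqP; split=> v.
  move=> [[Xv [P SP Pv]] [_ [Q TQ Qv]]]; split=> //.
  by exists (P * Q); [exists P, Q|rewrite evM mulf_neq0].
move=> [Xv [_ [P [Q [SP TQ ->]]]]]; rewrite evM mulf_eq0 negb_or => /andP[Pv Qv].
by split; split=> //; [exists P|exists Q].
Qed.

Definition zopenI (U W : zopen) : zopen :=
  ZOpen (zariski_openI (zsetP U) (zsetP W)).

(* Locally a quotient of homogeneous polynomials of degrees e + m and e: f is a
   section over U of the restriction to X of O(m), a regular function if m = 0. *)
Definition regular (m : nat) (U : set V) (f : {v | U v} -> C) : Prop :=
  forall u : {v | U v}, exists W : zopen, zset W (sval u) /\
    exists e P Q, [/\ P \is (e + m).-homog, Q \is e.-homog &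
      forall w : {v | U v}, zset W (sval w) ->
        ev Q (sval w) != 0 /\ f w = ev P (sval w) / ev Q (sval w)].

Lemma regularB m U (f g : {v | U v} -> C) :
  regular m f -> regular m g -> regular m (f - g).
Proof.
move=> fr gr u; have [W [Wu [e [P [Q [Ph Qh h]]]]]] := fr u.
have [W' [W'u [e' [P' [Q' [Ph' Qh' h']]]]]] := gr u.
exists (zopenI W W'); split=> //; exists (e + e')%N.
exists (P * Q' - P' * Q), (Q * Q'); split; last first.
- move=> w [/h[Q0 fE] /h'[Q'0 gE]]; rewrite evD evN !evM mulf_neq0 //.
  split=> //; rewrite -[LHS]/(f w - g w) fE gE -mulNr addf_div // mulNr.
  by [].
- exact: dhomogM.
- apply: rpredB; first by rewrite addnAC; exact: dhomogM.
  by rewrite [(e + e')%N]addnC addnAC; exact: dhomogM.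
Qed.

Lemma regularM m m' U (f g : {v | U v} -> C) :
  regular m f -> regular m' g -> regular (m + m') (f * g).
Proof.
move=> fr gr u; have [W [Wu [e [P [Q [Ph Qh h]]]]]] := fr u.
have [W' [W'u [e' [P' [Q' [Ph' Qh' h']]]]]] := gr u.
exists (zopenI W W'); split=> //; exists (e + e')%N, (P * P'), (Q * Q').
split; last first.
- move=> w [/h[Q0 fE] /h'[Q'0 gE]]; rewrite !evM mulf_neq0 //.
  by split=> //; rewrite -[LHS]/(f w * g w) fE gE mulf_div.
- exact: dhomogM.
- by rewrite addnACA; exact: dhomogM.
Qed.

Lemma regular_cst (c : C) (U : zopen) :
  regular 0 (fun _ : {v | zset U v} => c).
Proof.
move=> u; exists U; split; first exact: svalP.
exists 0%N, c%:MP, 1; split=> [||w _]; last 1 first.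
- by rewrite ev1 evC oner_neq0 divr1.
- by rewrite -[c%:MP]mulr1 mul_mpolyC; apply: rpredZ; exact: dhomog1.
- exact: dhomog1.
Qed.

Lemma regular0 m (U : zopen) : regular m (0 : {v | zset U v} -> C).
Proof.
move=> u; exists U; split; first exact: svalP.
exists 0%N, 0, 1; split=> [||w _]; last 1 first.
- by rewrite ev1 oner_neq0 divr1 -(mpolyC0 N C) evC.
- exact: dhomog0.
- exact: dhomog1.
Qed.

Section StructureSheaf.
Variable U : zopen.

Definition regular_fun : {pred ({v | zset U v} -> C)} :=
  fun f => `[< regular 0 f >].

Lemma regular_fun_subring : subring_closed regular_fun.
Proof.
split=> [|f g /asboolP fr /asboolP gr|f g /asboolP fr /asboolP gr]; apply/asboolP.
- exact: regular_cst.
- exact: regularB.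
- exact: regularM fr gr.
Qed.

HB.instance Definition _ := GRing.isSubringClosed.Build
  ({v | zset U v} -> C) regular_fun regular_fun_subring.

Record regfun := RegFun {
  rval :> {v | zset U v} -> C;
  rvalP : rval \in regular_fun }.

HB.instance Definition _ := [isSub for rval].
HB.instance Definition _ := [Choice of regfun by <:].
HB.instance Definition _ := 
  GRing.SubChoice_isSubComPzRing.Build _ _ regfun regular_fun_subring.

Lemma regular_cst_in c : (fun=> c) \in regular_fun.
Proof. by apply/asboolP; exact: regular_cst. Qed.

Definition regcst (c : C) : regfun := RegFun (regular_cst_in c).

Variable m : nat.

Definition regular_sec : {pred ({v | zset U v} -> C)} :=
  fun f => `[< regular m f >].

Lemma regular_sec_zmod : zmod_closed regular_sec.
Proof.
split=> [|f g /asboolP fr /asboolP gr]; apply/asboolP; first exact: regular0.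
exact: regularB.
Qed.

HB.instance Definition _ := GRing.isZmodClosed.Build
  ({v | zset U v} -> C) regular_sec regular_sec_zmod.

Record twist := Twist {
  tval :> {v | zset U v} -> C;
  tvalP : tval \in regular_sec }.

HB.instance Definition _ := [isSub for tval].
HB.instance Definition _ := [Choice of twist by <:].
HB.instance Definition _ := [SubChoice_isSubZmodule of twist by <:].

Lemma twist_scale_in (a : regfun) (s : twist) : rval a * tval s \in regular_sec.
Proof.
apply/asboolP; rewrite -[m]add0n; apply: regularM; apply/asboolP.
  exact: rvalP.
exact: tvalP.
Qed.

Definition twist_scale (a : regfun) (s : twist) : twist :=
  Twist (twist_scale_in a s).

Fact twist_scaleA a b s :
  twist_scale a (twist_scale b s) = twist_scale (a * b) s.
Proof. by apply: val_inj; exact: mulrA. Qed.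

Fact twist_scale1 : left_id 1 twist_scale.
Proof. by move=> s; apply: val_inj; exact: mul1r. Qed.

Fact twist_scaleDr : right_distributive twist_scale +%R.
Proof. by move=> a s t; apply: val_inj; exact: mulrDr. Qed.

Fact twist_scaleDl s : {morph twist_scale^~ s : a b / a + b}.
Proof. by move=> a b; apply: val_inj; exact: mulrDl. Qed.

HB.instance Definition _ := GRing.Zmodule_isLmodule.Build regfun twist
  twist_scaleA twist_scale1 twist_scaleDr twist_scaleDl.

End StructureSheaf.

Section Restriction.
Variables (U W : zopen) (WU : zset W `<=` zset U).

Definition incl (w : {v | zset W v}) : {v | zset U v} :=
  exist _ (sval w) (WU (svalP w)).

Lemma regular_incl m (f : {v | zset U v} -> C) :
  regular m f -> regular m (f \o incl).
Proof.
move=> fr w; have [Z [Zw [e [P [Q [Ph Qh h]]]]]] := fr (incl w).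
exists Z; split=> //; exists e, P, Q; split=> // u Zu; exact: h (incl u) Zu.
Qed.

Lemma regfun_res_in (f : regfun U) : rval f \o incl \in @regular_fun W.
Proof. by apply/asboolP/regular_incl/asboolP; exact: rvalP. Qed.

Definition regfun_res (f : regfun U) : regfun W := RegFun (regfun_res_in f).

Fact regfun_res_additive : zmod_morphism regfun_res.
Proof. by move=> f g; apply: val_inj. Qed.

Fact regfun_res_multiplicative : monoid_morphism regfun_res.
Proof. by split=> [|f g]; apply: val_inj. Qed.

HB.instance Definition _ := GRing.isZmodMorphism.Build
  (regfun U) (regfun W) regfun_res regfun_res_additive.
HB.instance Definition _ := GRing.isMonoidMorphism.Build
  (regfun U) (regfun W) regfun_res regfun_res_multiplicative.

Lemma twist_res_in m (s : twist U m) : tval s \o incl \in @regular_sec W m.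
Proof. by apply/asboolP/regular_incl/asboolP; exact: tvalP. Qed.

Definition twist_res m (s : twist U m) : twist W m := Twist (twist_res_in s).

End Restriction.

Lemma incl_id U (UU : zset U `<=` zset U) u : incl UU u = u.
Proof. by case: u => u Uu; apply: eq_exist. Qed.

Lemma incl_comp U W Z (WU : zset W `<=` zset U) (ZW : zset Z `<=` zset W)
  (ZU : zset Z `<=` zset U) z : incl WU (incl ZW z) = incl ZU z.
Proof. by apply: eq_exist. Qed.

Lemma regfun_res_id U (UU : zset U `<=` zset U) f : regfun_res UU f = f.
Proof. by apply/val_inj/funext => u /=; rewrite incl_id. Qed.

Lemma regfun_res_comp U W Z (WU : zset W `<=` zset U)
    (ZW : zset Z `<=` zset W) (ZU : zset Z `<=` zset U) f :
  regfun_res ZW (regfun_res WU f) = regfun_res ZU f.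
Proof. by apply/val_inj/funext => z /=; rewrite (incl_comp _ _ ZU). Qed.

Section Derivations.
Variable U : zopen.

(* T_X(U) is the module of C-derivations of the sheaf O_X restricted to U: as
   derivations of the ring O_X(U) do not restrict to smaller open subsets in
   general, an element is a compatible family of derivations of the O_X(W). *)
Record derivation := Derivation {
  der :> forall W : zopen, zset W `<=` zset U -> regfun W -> regfun W;
  derD : forall W (WU : zset W `<=` zset U) f g,
    der WU (f + g) = der WU f + der WU g;
  derM : forall W (WU : zset W `<=` zset U) f g,
    der WU (f * g) = f * der WU g + g * der WU f;
  der_cst : forall W (WU : zset W `<=` zset U) c, der WU (regcst W c) = 0;
  der_res : forall W Z (WU : zset W `<=` zset U) (ZU : zset Z `<=` zset U)
    (ZW : zset Z `<=` zset W) f,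
    der ZU (regfun_res ZW f) = regfun_res ZW (der WU f) }.

HB.instance Definition _ := gen_eqMixin derivation.
HB.instance Definition _ := gen_choiceMixin derivation.

Lemma derivationP (D E : derivation) :
  (forall W (WU : zset W `<=` zset U) f, D W WU f = E W WU f) -> D = E.
Proof.
case: D E => [D D1 D2 D3 D4] [E E1 E2 E3 E4] /= DE.
have {DE} DE : D = E.
  apply: functional_extensionality_dep => W.
  apply: functional_extensionality_dep => WU; exact/funext/DE.
by subst E; congr Derivation; exact: Prop_irrelevance.
Qed.

Program Definition der_zero : derivation := @Derivation (fun _ _ _ => 0) _ _ _ _.
Next Obligation. by rewrite addr0. Qed.
Next Obligation. by rewrite !mulr0 addr0. Qed.
Next Obligation. by rewrite rmorph0. Qed.

Program Definition der_add (D E : derivation) : derivation :=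
  @Derivation (fun W WU f => D W WU f + E W WU f) _ _ _ _.
Next Obligation. by rewrite !derD addrACA. Qed.
Next Obligation. by rewrite !derM !mulrDr addrACA. Qed.
Next Obligation. by rewrite !der_cst addr0. Qed.
Next Obligation. by rewrite rmorphD (der_res D WU) (der_res E WU). Qed.

Program Definition der_opp (D : derivation) : derivation :=
  @Derivation (fun W WU f => - D W WU f) _ _ _ _.
Next Obligation. by rewrite derD opprD. Qed.
Next Obligation. by rewrite derM opprD !mulrN. Qed.
Next Obligation. by rewrite der_cst oppr0. Qed.
Next Obligation. by rewrite rmorphN (der_res D WU). Qed.

Program Definition der_scale (a : regfun U) (D : derivation) : derivation :=
  @Derivation (fun W WU f => regfun_res WU a * D W WU f) _ _ _ _.
Next Obligation. by rewrite derD mulrDr. Qed.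
Next Obligation. by rewrite derM mulrDr mulrCA [X in _ + X]mulrCA. Qed.
Next Obligation. by rewrite der_cst mulr0. Qed.
Next Obligation.
by rewrite (der_res D WU) rmorphM /= (regfun_res_comp WU ZW ZU).
Qed.

Fact der_addA : associative der_add.
Proof. by move=> D E G; apply: derivationP => W WU f /=; rewrite addrA. Qed.
Fact der_addC : commutative der_add.
Proof. by move=> D E; apply: derivationP => W WU f /=; rewrite addrC. Qed.
Fact der_add0 : left_id der_zero der_add.
Proof. by move=> D; apply: derivationP => W WU f /=; rewrite add0r. Qed.
Fact der_addN : left_inverse der_zero der_opp der_add.
Proof. by move=> D; apply: derivationP => W WU f /=; rewrite addNr. Qed.

HB.instance Definition _ :=
  GRing.isZmodule.Build derivation der_addA der_addC der_add0 der_addN.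

Fact der_scaleA a b D : der_scale a (der_scale b D) = der_scale (a * b) D.
Proof. by apply: derivationP => W WU f /=; rewrite rmorphM mulrA. Qed.
Fact der_scale1 : left_id 1 der_scale.
Proof. by move=> D; apply: derivationP => W WU f /=; rewrite rmorph1 mul1r. Qed.
Fact der_scaleDr : right_distributive der_scale +%R.
Proof. by move=> a D E; apply: derivationP => W WU f /=; rewrite mulrDr. Qed.
Fact der_scaleDl D : {morph der_scale^~ D : a b / a + b}.
Proof.
by move=> a b; apply: derivationP => W WU f /=; rewrite rmorphD mulrDl.
Qed.

HB.instance Definition _ := GRing.Zmodule_isLmodule.Build (regfun U) derivation
  der_scaleA der_scale1 der_scaleDr der_scaleDl.

End Derivations.

Program Definition derivation_res (U W : zopen) (WU : zset W `<=` zset U)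
    (D : derivation U) : derivation W :=
  @Derivation W (fun Z ZW f => D Z (subset_trans ZW WU) f) _ _ _ _.
Next Obligation. exact: derD. Qed.
Next Obligation. exact: derM. Qed.
Next Obligation. exact: der_cst. Qed.
Next Obligation. exact: der_res. Qed.

Record presheaf := Presheaf {
  sec :> forall U : zopen, lmodType (regfun U);
  res : forall U W : zopen, zset W `<=` zset U -> sec U -> sec W;
  res_semilinear : forall U W (WU : zset W `<=` zset U),
    semilinear_map (regfun_res WU) (res WU);
  res_id : forall U (UU : zset U `<=` zset U) s, res UU s = s;
  res_comp : forall U W Z (WU : zset W `<=` zset U)
    (ZW : zset Z `<=` zset W) (ZU : zset Z `<=` zset U) s,
    res ZW (res WU s) = res ZU s }.

Arguments res A {U W} WU s : rename.

Program Definition tangent : presheaf :=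
  @Presheaf derivation derivation_res _ _ _.
Next Obligation.
move=> a D E; apply: derivationP => Z ZW f /=.
by rewrite (regfun_res_comp _ _ (subset_trans ZW WU)).
Qed.
Next Obligation.
apply: derivationP => Z ZU f /=; congr (der _ _ _); exact: Prop_irrelevance.
Qed.
Next Obligation.
apply: derivationP => Y YZ f /=; congr (der _ _ _); exact: Prop_irrelevance.
Qed.

Program Definition OX (m : nat) : presheaf :=
  @Presheaf (fun U => twist U m) (fun U W WU => @twist_res U W WU m) _ _ _.
Next Obligation. by move=> a s t; apply: val_inj. Qed.
Next Obligation. by apply/val_inj/funext => u /=; rewrite incl_id. Qed.
Next Obligation.
by apply/val_inj/funext => z /=; rewrite (incl_comp _ _ ZU).
Qed.

(* These presheaves are not sheafified: tensor products and symmetric powers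
   commute with direct limits, so the sheaf associated to Sym^k of the presheaf
   A (x) B is Sym^k of the sheaf A (x) B.  Only the final sheafification matters,
   and it is part of the definition of H0 below. *)
Section TensorSym.
Variables A B : presheaf.

Program Definition tensor_presheaf : presheaf :=
  @Presheaf (fun U => tensor (A U) (B U))
    (fun U W WU => tensor_map (regfun_res WU) (res A WU) (res B WU)) _ _ _.
Next Obligation. by apply: tensor_map_semilinear; exact: res_semilinear. Qed.
Next Obligation.
have L := tensor_map_semilinear (@res_semilinear A _ _ UU)
  (@res_semilinear B _ _ UU).
elim/tensor_ind: s => [|a m n q IH]; first by rewrite (semilin0 L).
rewrite L IH /= regfun_res_id tensor_mapE ?res_id //; exact: res_semilinear.
Qed.
Next Obligation.
have L1 := tensor_map_semilinear (@res_semilinear A _ _ WU)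
  (@res_semilinear B _ _ WU).
have L2 := tensor_map_semilinear (@res_semilinear A _ _ ZW)
  (@res_semilinear B _ _ ZW).
have L3 := tensor_map_semilinear (@res_semilinear A _ _ ZU)
  (@res_semilinear B _ _ ZU).
elim/tensor_ind: s => [|a m n q IH].
  by rewrite (semilin0 L1) (semilin0 L2) (semilin0 L3).
rewrite L1 L2 L3 IH /= (regfun_res_comp WU ZW ZU) !tensor_mapE;
  try exact: res_semilinear.
by rewrite (res_comp WU ZW ZU) (res_comp WU ZW ZU).
Qed.

Program Definition sympow_presheaf (k : nat) : presheaf :=
  @Presheaf (fun U => sympow (A U) k)
    (fun U W WU => @sympow_map _ _ (regfun_res WU) _ _ k (res A WU)) _ _ _.
Next Obligation. by apply: sympow_map_semilinear; exact: res_semilinear. Qed.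
Next Obligation.
have L := @sympow_map_semilinear _ _ _ _ _ k _ (@res_semilinear A _ _ UU).
elim/sympow_ind: s => [|a t q IH]; first by rewrite (semilin0 L).
rewrite L IH /= regfun_res_id sympow_mapE; last exact: res_semilinear.
by congr (_ *: symprod _ + _); apply/ffunP => i; rewrite ffunE res_id.
Qed.
Next Obligation.
have L1 := @sympow_map_semilinear _ _ _ _ _ k _ (@res_semilinear A _ _ WU).
have L2 := @sympow_map_semilinear _ _ _ _ _ k _ (@res_semilinear A _ _ ZW).
have L3 := @sympow_map_semilinear _ _ _ _ _ k _ (@res_semilinear A _ _ ZU).
elim/sympow_ind: s => [|a t q IH].
  by rewrite (semilin0 L1) (semilin0 L2) (semilin0 L3).
rewrite L1 L2 L3 IH /= (regfun_res_comp WU ZW ZU) !sympow_mapE;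
  try exact: res_semilinear.
congr (_ *: symprod _ + _); apply/ffunP => i.
by rewrite !ffunE (res_comp WU ZW ZU).
Qed.

End TensorSym.

Section GlobalSections.
Variable A : presheaf.

Record local_section := LocalSection {
  dom : zopen;
  local_val : A dom }.

(* The germ of s at v is the set of all t which agree with s near v; it is
   independent of the choice of the homogeneous coordinates v. *)
Definition germ (v : V) (s : local_section) : set local_section :=
  [set t | exists (W : zopen) (Ws : zset W `<=` zset (dom s))
      (Wt : zset W `<=` zset (dom t)),
    zset W v /\ res A Ws (local_val s) = res A Wt (local_val t)].

(* Global sections over X of the sheaf associated to A: families of germs which
   are locally the germs of a section of A. *)
Definition H0 : set ({v | X v} -> set local_section) :=
  [set sigma | forall x : {v | X v}, exists s : local_section, zset (dom s) (sval x) /\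
    forall y : {v | X v}, zset (dom s) (sval y) -> sigma y = germ (sval y) s].

Definition zero_section (x : {v | X v}) : set local_section :=
  germ (sval x) (@LocalSection zopenT 0).

Lemma zero_section_H0 : H0 zero_section.
Proof.
by move=> x; exists (@LocalSection zopenT 0); split=> //; exact: svalP.
Qed.

End GlobalSections.

End Hypersurface.

Arguments H0 {C N F} A.
Arguments zero_section {C N F} A x.

(* Main.v *)
Require Import Defs.
From HB Require Import structures.
From mathcomp Require Import all_boot all_order all_algebra perm.
From mathcomp Require Import mathcomp_extra boolp classical_sets functions.
From mathcomp Require Import cardinality fsbigop reals.
From mathcomp Require Import mpoly complex.
From mathcomp Require Import ring.

Set Implicit Arguments.
Unset Strict Implicit.
Unset Printing Implicit Defensive.

Import Order.TTheory GRing.Theory Num.Theory.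
Local Open Scope ring_scope.

(* Write N = n + 2, p = n - 1, and let T_x, for x in the cone of X, be the kernel of dF(x).
   A derivation D at x and w = (w_1, ..., w_p) in T_x give the scalar
   det(x, D x, e, w) / dF(x)e, where D x is a lift of D to T_x; it does not depend on e.
   A section of Sym^k (T_X (d - 3)) becomes a function phi(x, w), homogeneous of degree 0
   in x and regular on X for w fixed; it vanishes when some w_i is x and is unchanged when
   multiples of x are added to the w_i.
   - For w fixed, phi(., w) is integral over C, and by connectedness (Krull, finiteness of
     the Gauss map, irreducibility of X x X) phi(x, w) = phi(x', w) whenever w is tangent
     at x and at x' and the differentials of F at x and x' are not proportional.
   - Let x, w be such that phi(x, w) <> 0, and let u in T_x be a zero of F with dF(u)x <> 0.
     The rows of w may be moved along x to be tangent at u, and replacing w_1 by u gives 0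
     by comparison with the base point u.  Hence the derivative of F|T_x along x, times a
     nonzero first integral of that derivation, vanishes on the zeros of F|T_x; as F|T_x
     has no multiple factor, dF(z)x = 0 for all z in T_x.
   - Then F is a cone with vertex x over T_x.  By irreducibility this holds at all points of
     X, and a second-order expansion at x gives F = 0 on T_x, so X is singular.
   So phi = 0, and evaluation at frames w detects the coefficients of a section in a
   local basis of derivations. *)

(** The twist d - 3 makes phi of degree 0 in x: among the rows of the determinant only x and the
    lift of D x have degree 1, and dF(x)e has degree d - 1. In other words, T_X(d - 3) is the
    exterior power of order p of Omega_X(1), and p constant vectors w are paired with it. For fixed
    w, the conditions F = 0 and dF(x)w_i = 0 cut out a projective set of positive dimension, whose
    connectedness is not proved directly. Instead the values at x and x' are compared over triples
    (x, x', w) with w tangent at both points; a family of these is parametrised by the irreducible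
    product of X, X and a vector space. Integrality provides a polynomial chi over C[w] with root
    phi, whose derivative at phi is not identically zero. At every triple, phi(x, w) - phi(x', w)
    times the divided difference of chi is 0; so one of the two factors is 0 throughout, and the
    second is not, as one sees for x' near x. Without a topology, points near x are supplied by
    Krull's theorem: when the equations are fewer than the variables, infinitely many solutions
    satisfy any nonvanishing condition that holds at x. *)

Section Morphisms.
Variables (R : comNzRingType).

Lemma mpoly_morph_ext n (S : nzRingType) (f g : {rmorphism {mpoly R[n]} -> S}) :
  (forall c, f c%:MP = g c%:MP) -> (forall i, f 'X_i = g 'X_i) -> f =1 g.
Proof.
move=> fgC fgX p; rewrite (mpolyE p) !rmorph_sum /=; apply: eq_bigr => m _.
rewrite -mul_mpolyC !rmorphM fgC; congr (_ * _).
rewrite mpolyXE_id !rmorph_prod /=; apply: eq_bigr => i _.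
by rewrite !rmorphXn fgX.
Qed.

Lemma poly_morph_ext (S : nzRingType) (f g : {rmorphism {poly R} -> S}) :
  (forall c, f c%:P = g c%:P) -> f 'X = g 'X -> f =1 g.
Proof.
move=> fgC fgX; elim/poly_ind => [|p c IH]; first by rewrite !rmorph0.
by rewrite !rmorphD !rmorphM IH fgC fgX.
Qed.

Lemma mpoly_ind_ring n (P : {mpoly R[n]} -> Prop) :
  (forall c, P c%:MP) -> (forall i, P 'X_i) ->
  (forall p q, P p -> P q -> P (p + q)) ->
  (forall p q, P p -> P q -> P (p * q)) -> forall p, P p.
Proof.
move=> PC PX PD PM p; rewrite (mpolyE p).
elim/big_rec: _ => [|m q _ Pq]; first by rewrite -(mpolyC0 n R); exact: PC.
apply: (PD _ _) => //; rewrite -mul_mpolyC; apply: (PM _ _) => //.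
rewrite mpolyXE_id; elim/big_rec: _ => [|i q' _ Pq'].
  by rewrite -(mpolyC1 n R); exact: PC.
apply: (PM _ _) => //; elim: (m i) => [|k IH]; first by rewrite expr0 -(mpolyC1 n R).
by rewrite exprS; apply: (PM _ _).
Qed.

End Morphisms.

(** * Singling out the last variable *)

Section LastVariable.
Variables (R : comNzRingType) (n : nat) (lam : 'I_n -> R).

(* [split_last] makes the substitution [x_j |-> x_j + lam_j t], [x_n |-> t]. *)
Definition split_var (i : 'I_n.+1) : {poly {mpoly R[n]}} :=
  if unlift ord_max i is Some j then ('X_j)%:P + ((lam j)%:MP)%:P * 'X else 'X.

Definition split_last : {mpoly R[n.+1]} -> {poly {mpoly R[n]}} :=
  mmap (polyC \o @mpolyC n R) split_var.
HB.instance Definition _ := GRing.RMorphism.copy split_last split_last.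

Definition join_coef : {mpoly R[n]} -> {mpoly R[n.+1]} :=
  mmap (@mpolyC n.+1 R) (fun j => 'X_(lift ord_max j) - (lam j)%:MP * 'X_ord_max).
HB.instance Definition _ := GRing.RMorphism.copy join_coef join_coef.

Definition join_last (p : {poly {mpoly R[n]}}) : {mpoly R[n.+1]} :=
  (map_poly join_coef p).['X_ord_max].
HB.instance Definition _ := GRing.RMorphism.copy join_last
  (horner_eval ('X_ord_max : {mpoly R[n.+1]}) \o map_poly join_coef).

Lemma split_lastC c : split_last c%:MP = (c%:MP)%:P.
Proof. by rewrite /split_last mmapC. Qed.

Lemma split_lastX i : split_last 'X_i = split_var i.
Proof. by rewrite /split_last mmapX mmap1U. Qed.

Lemma join_coefC c : join_coef c%:MP = c%:MP.
Proof. by rewrite /join_coef mmapC. Qed.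

Lemma join_coefX j :
  join_coef 'X_j = 'X_(lift ord_max j) - (lam j)%:MP * 'X_ord_max.
Proof. by rewrite /join_coef mmapX mmap1U. Qed.

Lemma join_lastC c : join_last c%:P = join_coef c.
Proof. by rewrite /join_last map_polyC hornerC. Qed.

Lemma join_lastX : join_last 'X = 'X_ord_max.
Proof. by rewrite /join_last map_polyX hornerX. Qed.

Lemma split_lastK : cancel split_last join_last.
Proof.
apply: (mpoly_morph_ext (f := join_last \o split_last) (g := idfun)) => [c|i] /=.
  by rewrite split_lastC join_lastC join_coefC.
rewrite split_lastX /split_var; case: unliftP => [j ->|->].
  by rewrite rmorphD rmorphM /= !join_lastC join_coefC join_coefX join_lastX subrK.
by rewrite join_lastX.
Qed.

Lemma join_lastK : cancel join_last split_last.
Proof.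
apply: (poly_morph_ext (f := split_last \o join_last) (g := idfun)) => [c|] /=.
  rewrite join_lastC; move: c.
  apply: (mpoly_morph_ext (f := split_last \o join_coef)
    (g := polyC)) => [c|j] /=.
    by rewrite join_coefC split_lastC.
  rewrite join_coefX rmorphB rmorphM /= split_lastC !split_lastX /split_var.
  by rewrite liftK unlift_none addrK.
by rewrite join_lastX split_lastX /split_var unlift_none.
Qed.

End LastVariable.

(** * Evaluation of polynomials at points *)

Section Points.
Variables (C : closedFieldType).
Implicit Types n : nat.

Lemma evX n i (v : 'rV[C]_n) : ev 'X_i v = v ord0 i.
Proof. exact: mevalXU. Qed.

Lemma ev0 n (v : 'rV[C]_n) : ev 0 v = 0.
Proof. exact: meval0. Qed.

Lemma evB n (P Q : {mpoly C[n]}) v : ev (P - Q) v = ev P v - ev Q v.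
Proof. exact: mevalB. Qed.

Lemma evZ n c (P : {mpoly C[n]}) v : ev (c *: P) v = c * ev P v.
Proof. exact: mevalZ. Qed.

Lemma evXn n (P : {mpoly C[n]}) k v : ev (P ^+ k) v = ev P v ^+ k.
Proof. by rewrite /ev rmorphXn. Qed.

Lemma ev_sum n I (r : seq I) (p : pred I) (P : I -> {mpoly C[n]}) v :
  ev (\sum_(i <- r | p i) P i) v = \sum_(i <- r | p i) ev (P i) v.
Proof. by rewrite /ev rmorph_sum. Qed.

Lemma ev_prod n I (r : seq I) (p : pred I) (P : I -> {mpoly C[n]}) v :
  ev (\prod_(i <- r | p i) P i) v = \prod_(i <- r | p i) ev (P i) v.
Proof. by rewrite /ev rmorph_prod. Qed.

Definition evpt n (v : 'rV[C]_n) : {mpoly C[n]} -> C := fun P => ev P v.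
HB.instance Definition _ n (v : 'rV[C]_n) := GRing.RMorphism.copy (evpt v)
  (meval (fun i => v ord0 i)).

Definition join_pt n (lam : 'I_n -> C) (a : 'rV[C]_n) t : 'rV[C]_n.+1 :=
  \row_i (if unlift ord_max i is Some j then a ord0 j + lam j * t else t).

Lemma ev_split n lam (P : {mpoly C[n.+1]}) a t :
  (map_poly (evpt a) (split_last lam P)).[t] = ev P (join_pt lam a t).
Proof.
have H := mpoly_morph_ext (f := horner_eval t \o map_poly (evpt a) \o split_last lam)
  (g := evpt (join_pt lam a t)).
apply: H => [c|i]; rewrite /= /horner_eval.
  by rewrite split_lastC map_polyC hornerC /= /evpt !evC.
rewrite split_lastX /split_var [RHS]evX mxE; case: unliftP => [j _|_].
  rewrite rmorphD rmorphM /= !map_polyC map_polyX hornerD hornerM !hornerC hornerX.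
  by rewrite /= /evpt evC evX.
by rewrite map_polyX hornerX.
Qed.

(** Induction on the number of variables: where the leading coefficient in the last variable does
    not vanish, a nonzero polynomial in one variable remains, and [C] is infinite. *)
Lemma mpoly_nonroot n (P : {mpoly C[n]}) : P != 0 -> exists v, ev P v != 0.
Proof.
elim: n P => [|n IH] P P0.
  exists 0; rewrite (nvar0_mpolyC P) evC; apply: contra_neq P0 => e.
  by rewrite (nvar0_mpolyC P) e mpolyC0.
pose p := split_last (fun=> 0) P.
have p0 : p != 0.
  apply: contra_neq P0 => e; rewrite -(split_lastK (fun=> 0) P) -/p e.
  exact: rmorph0.
have [a ha] : exists a, ev (lead_coef p) a != 0.
  by apply: IH; rewrite lead_coef_eq0.
have q0 : map_poly (evpt a) p != 0.
  apply: contra_neq ha => /(congr1 (coefp (size p).-1)).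
  by rewrite /= coef_map coef0.
have [t ht] := closed_nonrootP _ q0.
by exists (join_pt (fun=> 0) a t); rewrite -ev_split.
Qed.

Lemma mpoly_ext n (P Q : {mpoly C[n]}) : ev P =1 ev Q -> P = Q.
Proof.
move=> PQ; apply/eqP; rewrite -subr_eq0; apply/negPn/negP => /mpoly_nonroot[v].
by rewrite evB PQ subrr eqxx.
Qed.

End Points.

(** * Nullstellensatz *)

Inductive ideal (R : nzRingType) (S : R -> Prop) : R -> Prop :=
| ideal0 : ideal S 0
| idealD a x y : S x -> ideal S y -> ideal S (a * x + y).

Section Ideal.
Variables (R : comNzRingType) (S : R -> Prop).

Lemma ideal_gen x : S x -> ideal S x.
Proof. by move=> Sx; rewrite -[x]mul1r -[1 * x]addr0; do 2?constructor. Qed.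

Lemma ideal_add x y : ideal S x -> ideal S y -> ideal S (x + y).
Proof.
move=> Ix Iy; elim: Ix => [|a z t Sz _ It]; first by rewrite add0r.
by rewrite -addrA; constructor.
Qed.

Lemma ideal_mul a x : ideal S x -> ideal S (a * x).
Proof.
elim=> [|b z t Sz _ It]; first by rewrite mulr0; constructor.
by rewrite mulrDr mulrA; constructor.
Qed.

Lemma ideal_mulr a x : ideal S x -> ideal S (x * a).
Proof. by rewrite mulrC; exact: ideal_mul. Qed.

End Ideal.

Lemma ideal_morph (R R' : comNzRingType) (f : {rmorphism R -> R'})
    (S : R -> Prop) (T : R' -> Prop) x :
  (forall y, S y -> ideal T (f y)) -> ideal S x -> ideal T (f x).
Proof.
move=> ST; elim=> [|a y z /ST Ty _ Tz]; first by rewrite rmorph0; constructor.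
by rewrite rmorphD rmorphM; apply: ideal_add => //; exact: ideal_mul.
Qed.

(** The degrees do not drop under [f], so the Sylvester matrix keeps its size. *)
Lemma morph_resultant (R R' : comNzRingType) (f : {rmorphism R -> R'})
    (p q : {poly R}) : f (lead_coef p) != 0 -> f (lead_coef q) != 0 ->
  f (resultant p q) = resultant (map_poly f p) (map_poly f q).
Proof.
move=> fp fq; rewrite /resultant /Sylvester_mx !size_map_poly_id0 //.
rewrite -det_map_mx map_col_mx; congr (\det (col_mx _ _));
  by apply/matrixP => i j; rewrite !mxE /= !rVpoly_delta -coef_map rmorphM /= map_polyXn.
Qed.

Section Nullstellensatz.
Variable C : closedFieldType.

(** By division, an element of least degree divides all of [J]; it is not constant since [1] is not
    in [J], so it has a root. *)
Lemma pid_zero (J : {poly C} -> Prop) :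
  (exists2 g, J g & g != 0) -> (forall f g, J f -> J g -> J (f + g)) ->
  (forall a f, J f -> J (a * f)) -> ~ J 1 ->
  exists b, forall f, J f -> f.[b] = 0.
Proof.
move=> [g Jg g0] JD JM J1.
have {g Jg g0} [h [Jh h0 hmin]] : exists h, [/\ J h, h != 0 &
    forall f, J f -> f != 0 -> (size h <= size f)%N].
  have [m hm] := ubnP (size g); elim: m => // m IH in g Jg g0 hm *.
  have [[f [Jf f0 fg]]|H] := pselect (exists f, [/\ J f, f != 0 & (size f < size g)%N]).
    by apply: (IH f) => //; rewrite (leq_trans fg).
  exists g; split=> // f Jf f0; rewrite leqNgt; apply/negP => fg.
  by apply: H; exists f.
have dvd f : J f -> h %| f.
  move=> Jf; rewrite /dvdp; apply: contraPT (leqnn 0) => r0.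
  have: J (f %% h).
    have -> : f %% h = f + (- (f %/ h)) * h.
      by rewrite {2}(divp_eq f h) mulNr addrAC subrr add0r.
    by apply: (JD _ _) => //; exact: JM.
  move=> /hmin/(_ r0); rewrite leqNgt ltn_modp h0 //.
have [b /rootP hb] : exists b, root h b.
  apply/closed_rootP; apply/eqP => /eqP/size_poly1P[c c0 hc]; apply: J1.
  have -> : 1 = c^-1%:P * h by rewrite hc -polyCM mulVf.
  exact: JM.
by exists b => f /dvd/dvdpP[q ->]; rewrite hornerM hb mulr0.
Qed.

Definition nullstellensatz n := forall S : {mpoly C[n]} -> Prop,
  (forall v, exists2 P, S P & ev P v != 0) -> ideal S 1.

(* Elimination of the last variable: the resultant with an element whose leading
   coefficient is constant specialises well. *)
Lemma nullstellensatz_poly n (S : {poly {mpoly C[n]}} -> Prop) g c :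
  nullstellensatz n -> S g -> lead_coef g = c%:MP -> c != 0 ->
  (forall a t, exists2 P, S P & (map_poly (evpt a) P).[t] != 0) -> ideal S 1.
Proof.
move=> Nn Sg gc c0 HS; apply: contrapT => nI.
(* The induction hypothesis is applied to the elimination ideal; its zero [a] will be completed by a
   last coordinate. *)
have [a Ha] : exists a, forall r, ideal S r%:P -> ev r a = 0.
  apply: contrapT => H; apply: nI.
  have := Nn (fun r => ideal S r%:P); rewrite -polyC1 => N.
  have {N} : ideal (fun r => ideal S r%:P) 1.
    apply: N => v; apply: contrapT => H'; apply: H; exists v => r Ir.
    by apply/eqP/negPn/negP => r0; apply: H'; exists r.
  by apply: (ideal_morph (f := polyC)).
have ga : evpt a (lead_coef g) = c by rewrite gc /evpt evC.
have g0 : g != 0 by rewrite -lead_coef_eq0 gc mpolyC_eq0.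
pose J f := exists2 p, ideal S p & f = map_poly (evpt a) p.
have [|f1 f2 [p1 I1 ->] [p2 I2 ->]|f1 f2 [p2 I2 ->]|[f If f1]|b Hb] :=
  @pid_zero J.
- exists (map_poly (evpt a) g); first by exists g => //; exact: ideal_gen.
  by rewrite -lead_coef_eq0 lead_coef_map_eq /= ga.
- by exists (p1 + p2); rewrite ?rmorphD //; exact: ideal_add.
- have [f1' ->] : exists f1', f1 = map_poly (evpt a) f1'.
    exists (map_poly (@mpolyC n C) f1); rewrite -map_poly_comp_id0 ?rmorph0 //.
    by rewrite map_poly_id // => x _; rewrite /= /evpt evC.
  by exists (f1' * p2); rewrite ?rmorphM //; exact: ideal_mul.
- have [g1|g1] := leqP (size g) 1.
    apply: nI; have -> : 1 = (c^-1%:MP)%:P * g.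
      have gg : g = (lead_coef g)%:P by rewrite {1}(size1_polyC g1) lead_coefE; case: (size g) g1 => [|[]].
      by rewrite gg gc -!rmorphM /= mulVf // !rmorph1.
    by apply: ideal_mul; exact: ideal_gen.
  (* Adding a high multiple of [g] gives [f] a constant leading coefficient and keeps it coprime to
     [g] at [a], where [f] becomes 1. The resultant is then nonzero at [a], although it lies in the
     elimination ideal. *)
  pose f' := g * 'X^(size f) + f.
  have sf : (size f < size (g * 'X^(size f))%R)%N.
    by rewrite size_mulXn // -[X in (X < _)%N]addn0 ltn_add2l (ltn_trans _ g1).
  have lf : lead_coef f' = c%:MP.
    by rewrite /f' lead_coefDl // lead_coef_Mmonic ?monicXn.
  have fa : evpt a (lead_coef f') = c by rewrite lf /evpt evC.
  have sf' : (1 < size f')%N.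
    rewrite size_polyDl // size_mulXn //.
    by rewrite (leq_trans g1) // leq_addl.
  have [[u v] /= _ uv] := resultant_in_ideal sf' g1.
  have : evpt a (resultant f' g) = 0.
    apply: Ha; rewrite uv; apply: ideal_add; apply: ideal_mul; last exact: ideal_gen.
    apply: ideal_add => //; rewrite mulrC; apply: ideal_mul; exact: ideal_gen.
  rewrite morph_resultant /= ?fa ?ga // => /eqP; rewrite resultant_eq0.
  apply/negP; rewrite -leqNgt.
  have -> : map_poly (evpt a) f' = map_poly (evpt a) g * 'X^(size f) + 1.
    by rewrite rmorphD rmorphM /= map_polyXn f1.
  set h := map_poly _ g.
  have hg : gcdp (h * 'X^(size f) + 1) h %| 1.
    have d1 := dvdp_gcdl (h * 'X^(size f) + 1) h.
    have d2 := dvdp_gcdr (h * 'X^(size f) + 1) h.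
    by move: d1; rewrite dvdp_addr // dvdp_mulr.
  by move: hg; rewrite dvdp1 => /eqP ->.
- have [P SP /eqP] := HS a b; apply; apply: Hb; exists P => //; exact: ideal_gen.
Qed.

Section LinearChange.
Variables (n : nat) (lam : 'I_n -> C).

Let top (d : nat) (p : {poly {mpoly C[n]}}) (c : C) :=
  (size p <= d.+1)%N /\ p`_d = c%:MP.

Let topM d e p q a b : top d p a -> top e q b -> top (d + e) (p * q) (a * b).
Proof.
move=> [sp pa] [sq qb]; split.
  apply: leq_trans (size_polyMleq p q) _.
  by have := leq_add sp sq; rewrite addnS addSn; case: (_ + _)%N.
rewrite coefM (bigD1 (Ordinal (leq_addr e d : d < (d + e).+1)%N)) //= pa.
rewrite addKn qb big1 ?addr0 ?rmorphM // => i; rewrite -val_eqE /= neq_ltn.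
case/orP => hi; last by rewrite (nth_default _ (leq_trans sp hi)) mul0r.
rewrite [X in _ * X]nth_default ?mulr0 // (leq_trans sq) //.
by rewrite ltn_subRL ltn_add2r.
Qed.

(** Each variable contributes one power of [t], with coefficient [lam j] or 1, which is its value at
    [join_pt lam 0 1]; top coefficients multiply. *)
Lemma split_last_monomial (m : 'X_{1..n.+1}) :
  top (mdeg m) (split_last lam 'X_[m]) (ev 'X_[m] (join_pt lam 0 1)).
Proof.
rewrite mpolyXE_id rmorph_prod ev_prod mdegE /=.
elim/big_rec3: _ => [|i p a d _ IH].
  by split; rewrite ?size_poly1 // coef1.
apply: topM => //; rewrite rmorphXn evXn /=; elim: (m i) => [|k IHk].
  by split; rewrite ?size_poly1 // coef1.
rewrite !exprS -add1n; apply: topM => //; rewrite split_lastX evX mxE /split_var.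
case: unlift => [j|].
  split; last by rewrite coefD coefC coefCM coefX /= add0r mulr1 !mxE add0r mulr1.
  apply: leq_trans (size_polyD _ _) _; rewrite geq_max (leq_trans (size_polyC_leq1 _)) //.
  by rewrite (leq_trans (size_polyMleq _ _)) // size_polyX addn2 /= ltnS size_polyC_leq1.
by split; rewrite ?size_polyX ?coefX.
Qed.

Lemma split_last_lead (P : {mpoly C[n.+1]}) d :
  (msize P <= d.+1)%N -> ev (pihomog mdeg d P) (join_pt lam 0 1) != 0 ->
  lead_coef (split_last lam P) = (ev (pihomog mdeg d P) (join_pt lam 0 1))%:MP.
Proof.
set c := ev _ _ => sP c0.
have [sz cf] : top d (split_last lam P) c.
  rewrite /c pihomogE big_mkcond ev_sum /= [X in top _ (_ X) _]mpolyE rmorph_sum /=.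
  rewrite big_seq [X in top _ _ X]big_seq.
  elim/big_rec2: _ => [|m q b mP [h1 h2]]; first by split; rewrite ?size_poly0 ?coef0 ?mpolyC0.
  have md : (mdeg m <= d)%N by rewrite -ltnS (leq_trans (msize_mdeg_lt mP)).
  have [h3 h4] := split_last_monomial m.
  have sZ : split_last lam (P@_m *: 'X_[m]) = (P@_m)%:MP *: split_last lam 'X_[m].
    by rewrite -mul_mpolyC rmorphM /= split_lastC mul_polyC.
  split.
    rewrite (leq_trans (size_polyD _ _)) // geq_max h1 andbT sZ.
    by rewrite (leq_trans (size_scale_leq _ _)) // (leq_trans h3).
  rewrite coefD h2 rmorphD; congr (_ + _); rewrite sZ coefZ.
  case: eqP => [<-|/eqP ne]; first by rewrite h4 evZ rmorphM.
  by rewrite nth_default ?mulr0 ?ev0 ?mpolyC0 // (leq_trans h3) // ltn_neqAle ne.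
rewrite lead_coefE; suff -> : size (split_last lam P) = d.+1 by [].
apply/eqP; rewrite eqn_leq sz /= ltnNge; apply/negP => h.
by move: c0; have := cf; rewrite nth_default // => /esym/eqP; rewrite mpolyC_eq0 => ->.
Qed.

End LinearChange.

Lemma homog_evZ n d (P : {mpoly C[n]}) t v : P \is d.-homog ->
  ev P (t *: v) = t ^+ d * ev P v.
Proof.
move=> hP; rewrite /ev !mevalE mulr_sumr; apply: eq_big_seq => m mP.
have md : mdeg m = d := dhomog_mf hP mP.
rewrite -md mulrCA; congr (_ * _).
rewrite mdegE -prodrXr -big_split /=; apply: eq_bigr => i _.
by rewrite mxE exprMn.
Qed.

(* A direction in which [P] becomes monic, up to a nonzero constant. *)
Lemma mpoly_monic_dir n (P : {mpoly C[n.+1]}) : P != 0 ->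
  exists lam c, c != 0 /\ lead_coef (split_last lam P) = c%:MP.
Proof.
move=> P0; pose d := (msize P).-1; have sP : msize P = d.+1 by exact: mpolySpred.
pose T := pihomog mdeg d P.
(* The extra factor forces a nonzero last coordinate, which can then be scaled to 1. *)
have T0 : T * 'X_ord_max != 0.
  rewrite mulf_neq0 //; last by rewrite -msize_poly_eq0 msizeX.
  apply/negP => /eqP /(congr1 (mcoeff (mlead P))) /eqP.
  have dl : mdeg (mlead P) = d by apply/eqP; rewrite -eqSS mlead_deg // sP.
  rewrite mcoeff0 /T pihomogE big_mkcond (bigD1_seq (mlead P)) ?msupp_uniq ?mlead_supp //=.
  rewrite dl eqxx mcoeffD mcoeffZ mcoeffX eqxx mulr1 raddf_sum big1 ?addr0 ?mleadc_eq0 ?(negPf P0) //=.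
  move=> m /negPf ne; case: ifP => _; rewrite ?mcoeff0 //.
  by rewrite mcoeffZ mcoeffX ne mulr0.
have [v] := mpoly_nonroot T0; rewrite evM evX mulf_eq0 negb_or => /andP[Tv v0].
pose t := v ord0 ord_max; pose lam j := t^-1 * v ord0 (lift ord_max j).
have vE : v = t *: join_pt lam 0 1.
  apply/rowP => i; rewrite !mxE; case: unliftP => [j ->|->]; last by rewrite mulr1.
  by rewrite mxE add0r mulr1 mulVKf.
exists lam, (ev T (join_pt lam 0 1)); suff: ev T (join_pt lam 0 1) != 0.
  by move=> h; split=> //; apply: split_last_lead; rewrite ?sP.
by move: Tv; rewrite vE (homog_evZ _ _ (pihomogP _ _ _)) mulf_eq0 negb_or => /andP[].
Qed.

Lemma weak_nullstellensatz n : nullstellensatz n.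
Proof.
elim: n => [|n IH] S HS.
  have [P SP] := HS 0; rewrite (nvar0_mpolyC P) evC => c0.
  have -> : 1 = (P@_0%MM)^-1%:MP * P by rewrite {2}(nvar0_mpolyC P) -mpolyCM mulVf.
  by apply: ideal_mul; exact: ideal_gen.
have [P SP] := HS 0; have [->|P0 _] := eqVneq P 0; first by rewrite ev0 eqxx.
have [lam [c [c0 hc]]] := mpoly_monic_dir P0.
have : ideal (fun p => exists2 Q, S Q & p = split_last lam Q) 1.
  apply: (nullstellensatz_poly IH _ hc c0); first by exists P.
  move=> a t; have [Q SQ Qv] := HS (join_pt lam a t).
  by exists (split_last lam Q); [exists Q|rewrite ev_split].
rewrite -(rmorph1 (join_last lam)).
apply: ideal_morph => p [Q SQ ->] /=; rewrite split_lastK; exact: ideal_gen.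
Qed.

Lemma strong_nullstellensatz n (S : {mpoly C[n]} -> Prop) g :
  (forall v, (forall P, S P -> ev P v = 0) -> ev g v = 0) ->
  exists M, ideal S (g ^+ M).
Proof.
move=> HS.
(* Rabinowitsch: the inverse of [g] is the last variable. *)
pose T (p : {poly {mpoly C[n]}}) := (exists2 P, S P & p = P%:P) \/ p = 1 - g%:P * 'X.
have I1 : ideal T 1.
  have H : ideal (fun Q => T (split_last (fun=> 0) Q)) 1.
    apply: (@weak_nullstellensatz n.+1) => v; apply: contrapT => H.
    pose a : 'rV[C]_n := \row_j v ord0 (lift ord_max j).
    pose t := v ord0 ord_max.
    have vE : v = join_pt (fun=> 0) a t.
      apply/rowP => i; rewrite !mxE; case: unliftP => [j ->|-> //].
      by rewrite mxE mul0r addr0.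
    have H' p : T p -> (map_poly (evpt a) p).[t] = 0.
      move=> Tp; apply/eqP/negPn/negP => p0; apply: H.
      exists (join_last (fun=> 0) p); first by rewrite join_lastK.
      by rewrite vE -ev_split join_lastK.
    have g0 : ev g a = 0.
      apply: HS => P SP; have := H' P%:P; rewrite map_polyC hornerC; apply.
      by left; exists P.
    have := H' (1 - g%:P * 'X); rewrite rmorphB rmorph1 /= rmorphM /=.
    rewrite map_polyC map_polyX hornerD hornerN hornerM !hornerC /= /evpt g0 mul0r subr0.
    by move=> /(_ (or_intror erefl)) /eqP; rewrite oner_eq0.
  rewrite -(rmorph1 (split_last (fun=> 0))).
  by apply: (ideal_morph _ H) => Q; exact: ideal_gen.
(* Substitution of [1 / g] for the new variable, cleared of denominators by [g ^+ M]; for large [M]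
   it kills the multiples of [1 - g%:P * 'X]. *)
pose ev_inv M (p : {poly {mpoly C[n]}}) := \sum_(l < M.+1) p`_l * g ^+ (M - l).
have {I1} [M I1] : exists M0, forall M, (M0 <= M)%N -> ideal S (ev_inv M 1).
  elim: I1 => [|a x y Tx _ [M0 IH]].
    exists 0%N => M _; rewrite /ev_inv big1 => [|l _]; first exact: ideal0.
    by rewrite coef0 mul0r.
  exists (maxn M0 (size a)) => M; rewrite geq_max => /andP[MM0 Ma].
  have -> : ev_inv M (a * x + y) = ev_inv M (a * x) + ev_inv M y.
    by rewrite /ev_inv -big_split; apply: eq_bigr => l _; rewrite coefD mulrDl.
  apply: ideal_add; last exact: IH.
  case: Tx => [[P SP ->]|->].
    have -> : ev_inv M (a * P%:P) = ev_inv M a * P.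
      by rewrite /ev_inv mulr_suml; apply: eq_bigr => l _; rewrite coefMC mulrAC.
    by apply: ideal_mul; exact: ideal_gen.
  have -> : ev_inv M (a * (1 - g%:P * 'X)) = 0; last exact: ideal0.
  rewrite /ev_inv mulrBr mulr1 mulrCA mul_polyC.
  transitivity (\sum_(l < M.+1) (a`_l * g ^+ (M - l)) -
                \sum_(l < M.+1) ((a * 'X)`_l * g ^+ (M - l).+1)).
    rewrite -sumrB; apply: eq_bigr => l _.
    by rewrite coefB coefZ mulrBl exprS mulrA [_ * g]mulrC.
  rewrite [X in X - _]big_ord_recr /= (nth_default _ Ma) mul0r addr0.
  rewrite [X in _ - X]big_ord_recl coefMX mul0r add0r.
  apply/eqP; rewrite subr_eq0; apply/eqP; apply: eq_bigr => l _.
  by rewrite coefMX /= /bump /= add1n subnSK.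
exists M; have := I1 M (leqnn M); rewrite /ev_inv big_ord_recl subn0 coef1 mul1r.
by rewrite big1 ?addr0 // => l _; rewrite coef1 mul0r.
Qed.

End Nullstellensatz.

(** * Unique factorisation *)

Section Factorial.
Variable R : idomainType.
Implicit Types a b p : R.

Definition divides p a := exists c, a = c * p.

Definition prime_elt p :=
  [/\ p != 0, p \isn't a GRing.unit &
    forall a b, divides p (a * b) -> divides p a \/ divides p b].

(** The factors are asked to be prime and not only irreducible, which makes uniqueness automatic. *)
Definition factorial := forall a, a != 0 -> exists u (s : seq R),
  [/\ u \is a GRing.unit, forall p, p \in s -> prime_elt p & a = u * \prod_(p <- s) p].

Lemma divides_mull p a b : divides p a -> divides p (b * a).
Proof. by move=> [c ->]; exists (b * c); rewrite mulrA. Qed.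

Lemma divides_mulr p a b : divides p a -> divides p (a * b).
Proof. by rewrite mulrC; exact: divides_mull. Qed.

Lemma divides_add p a b : divides p a -> divides p b -> divides p (a + b).
Proof. by move=> [c ->] [d ->]; exists (c + d); rewrite mulrDl. Qed.

Lemma divides_opp p a : divides p a -> divides p (- a).
Proof. by move=> [c ->]; exists (- c); rewrite mulNr. Qed.

Lemma divides0 p : divides p 0. Proof. by exists 0; rewrite mul0r. Qed.

Lemma divides_addl p a b : divides p a -> divides p (b + a) -> divides p b.
Proof. by move=> /divides_opp pa /divides_add/(_ pa); rewrite addrK. Qed.

Lemma divides_sum p (I : Type) (r : seq I) (P : pred I) (F : I -> R) :
  (forall i, P i -> divides p (F i)) -> divides p (\sum_(i <- r | P i) F i).
Proof.
move=> h; elim/big_rec: _ => [|i x Pi]; first exact: divides0.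
by apply: divides_add; exact: h.
Qed.

Lemma prime_elt_unit p u : prime_elt p -> u \is a GRing.unit -> ~ divides p u.
Proof.
move=> [_ /negP pu _] uu [c uE]; apply: pu.
by move: uu; rewrite uE unitrM => /andP[].
Qed.

Lemma prime_elt_prod p u s : prime_elt p -> u \is a GRing.unit ->
  divides p (u * \prod_(q <- s) q) -> exists2 q, q \in s & divides p q.
Proof.
move=> pp uu; have [_ _ pM] := pp; elim: s => [|q s IH].
  by rewrite big_nil mulr1 => /(prime_elt_unit pp uu).
rewrite big_cons mulrCA => /pM[pq|/IH[r rs pr]]; first by exists q; rewrite ?mem_head.
by exists r => //; rewrite inE rs orbT.
Qed.

Lemma prime_elt_divides p q : prime_elt p -> prime_elt q -> divides p q ->
  exists2 c, c \is a GRing.unit & q = c * p.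
Proof.
move=> [p0 pu _] [q0 _ qM] [c qE]; exists c => //.
have : divides q (c * p) by exists 1; rewrite mul1r.
case/qM => [[e cE]|[e pE]].
  case/negP: pu; apply/unitrPr; exists e; apply: (mulIf q0).
  by rewrite mul1r [in RHS]qE cE -[LHS]mulrA mulrC.
apply/unitrPr; exists e; apply: (mulIf p0).
by rewrite mul1r [in RHS]pE qE mulrCA mulrA.
Qed.

End Factorial.

Section FactorialPoly.
Variable R : idomainType.
Hypothesis factR : factorial R.
Implicit Types f g h : {poly R}.

Lemma divides_polyC (p : R) f : divides p%:P f <-> forall i, divides p f`_i.
Proof.
split=> [[c ->] i|H]; first by rewrite coefMC; exists c`_i.
pose c i := sval (cid (H i)); have cE i : f`_i = c i * p := svalP (cid (H i)).
exists (\poly_(i < size f) c i); apply/polyP => i; rewrite coefMC coef_poly.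
by case: ltnP => [_|hi]; rewrite ?cE // -cE nth_default // mul0r.
Qed.

(** Gauss's lemma: if the first coefficients of [f] and [g] not divisible by [p] are at [i] and [j],
    then the coefficient of the product at [i + j] is not divisible by [p]. *)
Lemma prime_elt_polyC (p : R) : prime_elt p -> prime_elt p%:P.
Proof.
move=> [p0 pu pM]; split; rewrite ?polyC_eq0 //.
  by apply: contra pu; rewrite poly_unitE coefC /= => /andP[].
move=> f g; rewrite !divides_polyC => H; apply: contrapT => /not_orP[nf ng].
have exn (h : {poly R}) : ~ (forall i, divides p h`_i) -> exists i, ~~ `[< divides p h`_i >].
  by move=> /existsNP[i hi]; exists i; apply/asboolPn.
case: (ex_minnP (exn f nf)) => i /asboolPn fi mini.
case: (ex_minnP (exn g ng)) => j /asboolPn gj minj.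
have lt_i k : (k < i)%N -> divides p f`_k.
  by move=> ki; apply/asboolP; apply: contraLR ki => /mini; rewrite -leqNgt.
have lt_j k : (k < j)%N -> divides p g`_k.
  by move=> kj; apply/asboolP; apply: contraLR kj => /minj; rewrite -leqNgt.
have := H (i + j)%N; rewrite coefM (bigD1 (Ordinal (leq_addr j i : i < (i + j).+1)%N)) //=.
rewrite addKn => Hij; have /pM[] // : divides p (f`_i * g`_j).
apply: (divides_addl _ Hij); apply: divides_sum => k; rewrite -val_eqE /= neq_ltn => /orP[ki|ki].
  by apply: divides_mulr; exact: lt_i.
apply: divides_mull; apply: lt_j.
have := ltn_ord k; rewrite ltnS => kij.
by rewrite ltn_subLR // ltn_add2r.
Qed.

Definition primitive f := forall p, prime_elt p -> ~ divides p%:P f.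

(** A prime constant dividing [f] divides its leading coefficient, so the number of prime factors of
    the latter decreases each time one is removed. *)
Lemma primitive_part f : f != 0 -> exists u (s : seq R) g,
  [/\ forall p, p \in s -> prime_elt p, primitive g, u \is a GRing.unit &
    f = (u * \prod_(p <- s) p)%:P * g].
Proof.
move=> f0; have [u [s [uu sP fE]]] : exists u (s : seq R),
    [/\ u \is a GRing.unit, forall p, p \in s -> prime_elt p &
     lead_coef f = u * \prod_(p <- s) p].
  by apply: factR; rewrite lead_coef_eq0.
have [m] := ubnP (size s); elim: m => // m IH in f f0 u s uu sP fE *.
move=> sm; have [pf|] := pselect (primitive f).
  exists 1, [::], f; split=> //; first exact: unitr1.
  by rewrite big_nil mulr1 mul1r.
move=> /existsNP[p /not_implyP[pp /contrapT[g fgp]]].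
have g0 : g != 0 by apply: contra_neq f0 => g0; rewrite fgp g0 mul0r.
have lf : lead_coef f = lead_coef g * p by rewrite fgp lead_coefM lead_coefC.
have [q qs pq] : exists2 q, q \in s & divides p q.
  by apply: (prime_elt_prod pp uu); exists (lead_coef g); rewrite -fE.
have [c cu qE] := prime_elt_divides pp (sP _ qs) pq.
have lg : lead_coef g = (u * c) * \prod_(p <- rem q s) p.
  have [p0 _ _] := pp; apply: (mulIf p0); rewrite -lf fE (big_rem q) //= qE.
  by rewrite -!mulrA; congr (_ * (_ * _)); rewrite mulrC.
have [|||u' [s' [h [h1 h2 h3 h4]]]] := IH g g0 _ _ _ _ lg.
- by rewrite unitrM uu.
- by move=> r /mem_rem; exact: sP.
- by rewrite size_rem //; case: (s) sm qs.
exists u', (p :: s'), h; split=> //; first by move=> r; rewrite inE => /predU1P[->|/h1].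
by rewrite fgp h4 big_cons mulrAC -polyCM mulrAC -mulrA.
Qed.

(* Pseudo-division by a primitive polynomial is division: the prime factors of the
   scalar can be cancelled one at a time. *)
Lemma primitive_cancel f h (c : R) : c != 0 -> primitive f ->
  (exists q, c *: h = q * f) -> divides f h.
Proof.
move=> c0 pf; have [u [s [uu sP ->]]] := factR c0; rewrite mulrC.
elim: s sP => [|p s IH] sP [q].
  rewrite big_nil mul1r => hE; exists (u^-1 *: q).
  by rewrite -scalerAl -hE scalerA mulVr // scale1r.
rewrite big_cons => hE; apply: IH => [r rs|]; first by apply: sP; rewrite inE rs orbT.
have pp : prime_elt p by apply: sP; rewrite mem_head.
have [_ _ pM] := prime_elt_polyC pp; have [p0 _ _] := pp.
have : divides p%:P (q * f).
  by rewrite -hE; exists ((\prod_(p <- s) p * u) *: h); rewrite [RHS]mulrC mul_polyC scalerA mulrA.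
case/pM => [[q' qE]|/(pf p pp)//].
exists q'; apply: (mulIf (_ : p%:P != 0)); first by rewrite polyC_eq0.
by rewrite mulrAC -qE -hE [LHS]mulrC mul_polyC scalerA mulrA.
Qed.

(** A prime factor of [c] stays prime in the polynomial ring, so it divides [g] or [h] and can be
    cancelled there without changing the degree. *)
Lemma primitive_split f g h (c : R) : c != 0 -> primitive f -> c *: f = g * h ->
  exists g' h', [/\ f = g' * h', size g' = size g & size h' = size h].
Proof.
move=> c0 pf; have [u [s [uu sP ->]]] := factR c0; rewrite mulrC.
have u0 : u != 0 by apply: contraTneq uu => ->; rewrite unitr0.
elim: s sP g h => [|p s IH] sP g h.
  rewrite big_nil mul1r => hE; exists (u^-1 *: g), h; split=> //.
    by rewrite -scalerAl -hE scalerA mulVr // scale1r.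
  by rewrite size_scale // invr_eq0.
rewrite big_cons => hE.
have pp : prime_elt p by apply: sP; rewrite mem_head.
have [_ _ pM] := prime_elt_polyC pp; have [p0 _ _] := pp.
have pP0 : p%:P != 0 by rewrite polyC_eq0.
have sP' r : r \in s -> prime_elt r by move=> rs; apply: sP; rewrite inE rs orbT.
have : divides p%:P (g * h).
  by rewrite -hE; exists ((\prod_(p <- s) p * u) *: f); rewrite [RHS]mulrC mul_polyC scalerA mulrA.
case/pM => [[q' qE]|[q' qE]].
  have [|g' [h' [e1 e2 e3]]] := IH sP' q' h.
    apply: (mulIf pP0); rewrite mulrAC -qE -hE [LHS]mulrC mul_polyC scalerA mulrA //.
  by exists g', h'; split=> //; rewrite e2 qE mulrC mul_polyC size_scale.
have [|g' [h' [e1 e2 e3]]] := IH sP' g q'.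
  by apply: (mulIf pP0); rewrite -mulrA -qE -hE [LHS]mulrC mul_polyC scalerA mulrA.
by exists g', h'; split=> //; rewrite e3 qE mulrC mul_polyC size_scale.
Qed.

(** Up to scalars, the gcd of [f] and [a] is [f] or a constant by irreducibility. In the first case
    [f] divides a multiple of [a] by a scalar, in the second one of [b], and [primitive_cancel]
    removes the scalar. *)
Lemma primitive_prime f : primitive f -> (1 < size f)%N ->
  (forall g h, f = g * h -> (size g <= 1)%N \/ (size h <= 1)%N) -> prime_elt f.
Proof.
move=> pf sf irr; have f0 : f != 0 by rewrite -size_poly_gt0 ltnW.
split=> //.
  by rewrite poly_unitE; apply/negP => /andP[/eqP s1 _]; rewrite s1 in sf.
move=> a b [c abE].
have fab : Pdiv.Idomain.dvdp f (a * b).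
  by apply/Pdiv.Idomain.dvdpP; exists (1, c); rewrite ?oner_neq0 ?scale1r.
pose D := Pdiv.Idomain.gcdp f a.
have /Pdiv.Idomain.dvdpP[[e q] /= e0 eq] : Pdiv.Idomain.dvdp D f by exact: Pdiv.Idomain.dvdp_gcdl.
have D0 : D != 0.
  by apply: contra_neq f0 => D0; move: eq; rewrite D0 mulr0 => /eqP; rewrite scale_poly_eq0 (negPf e0) => /eqP.
have q0 : q != 0.
  by apply: contra_neq f0 => q0; move: eq; rewrite q0 mul0r => /eqP; rewrite scale_poly_eq0 (negPf e0) => /eqP.
have [g [h [fE sg sh]]] := primitive_split e0 pf eq.
have [sq|sD] := irr _ _ fE.
  left; have /Pdiv.Idomain.dvdpP[[e' q'] /= e'0 eq'] : Pdiv.Idomain.dvdp D a by exact: Pdiv.Idomain.dvdp_gcdr.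
  have [c' qc] : exists c', q = c'%:P by exists q`_0; apply: size1_polyC; rewrite -sg.
  have c'0 : c' != 0 by rewrite -polyC_eq0 -qc.
  apply: (@primitive_cancel f a (c' * e')) => //; first by rewrite mulf_neq0.
  exists (e *: q'); rewrite -scalerA eq' -scalerAl [RHS]scalerAr eq qc mul_polyC.
  by rewrite scalerAr.
right; have cp : Pdiv.Idomain.coprimep f a.
  by rewrite Pdiv.Idomain.coprimep_def eqn_leq -/D -sh sD sh size_poly_gt0.
have : Pdiv.Idomain.dvdp f b by rewrite -(Pdiv.Idomain.Gauss_dvdpr b cp).
by move=> /Pdiv.Idomain.dvdpP[[e' q'] /= e'0 eq']; apply: (primitive_cancel e'0 pf); exists q'.
Qed.

(** Induction on the degree: the content is factored in [R], and a primitive part of positive degree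
    is prime or splits into factors of smaller degree. *)
Lemma factorial_poly : factorial {poly R}.
Proof.
move=> f; have [m] := ubnP (size f); elim: m => // m IH in f * => sf f0.
have [u [s [g [sP pg uu fE]]]] := primitive_part f0.
have g0 : g != 0 by apply: contra_neq f0 => e; rewrite fE e mulr0.
have a0 : u * \prod_(p <- s) p != 0 by apply: contra_neq f0 => e; rewrite fE e mul0r.
have sg : size g = size f by rewrite fE mul_polyC size_scale.
suff [v [t [vu tP gE]]] : exists v (t : seq {poly R}), [/\ v \is a GRing.unit,
    forall p, p \in t -> prime_elt p & g = v * \prod_(p <- t) p].
  exists (u%:P * v), (map polyC s ++ t); split.
  - by rewrite unitrM vu andbT rmorph_unit.
  - move=> p; rewrite mem_cat => /orP[/mapP[q qs ->]|/tP//].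
    by apply: prime_elt_polyC; exact: sP.
  - by rewrite fE gE big_cat big_map /= -rmorph_prod polyCM -!mulrA; congr (_ * _); rewrite mulrCA.
have [g1|g1] := leqP (size g) 1.
  have gC := size1_polyC g1; set c := g`_0 in gC.
  have c0 : c != 0 by rewrite -polyC_eq0 -gC.
  have [v [t [vu tP cE]]] := factR c0.
  exists v%:P, (map polyC t); split; first by rewrite rmorph_unit.
    by move=> p /mapP[q qs ->]; apply: prime_elt_polyC; exact: tP.
  by rewrite gC cE big_map -rmorph_prod -polyCM.
have [[h1 [h2 [gE s1 s2]]]|H] := pselect (exists h1 h2, [/\ g = h1 * h2, (1 < size h1)%N & (1 < size h2)%N]).
  have n1 : h1 != 0 by rewrite -size_poly_gt0 ltnW.
  have n2 : h2 != 0 by rewrite -size_poly_gt0 ltnW.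
  have sz : (size h1 + size h2 = (size f).+1)%N.
    by rewrite -sg gE size_mul // prednK // addn_gt0 size_poly_gt0 n1.
  have l1 : (size h1 < size f)%N by rewrite -ltnS -sz -[X in (X < _)%N]addn1 ltn_add2l.
  have l2 : (size h2 < size f)%N by rewrite -ltnS -sz -[X in (X < _)%N]add1n ltn_add2r.
  have [|v1 [t1 [u1 p1 e1]]] := IH h1 _ n1; first exact: leq_trans l1 _.
  have [|v2 [t2 [u2 p2 e2]]] := IH h2 _ n2; first exact: leq_trans l2 _.
  exists (v1 * v2), (t1 ++ t2); split; first by rewrite unitrM u1.
    by move=> p; rewrite mem_cat => /orP[/p1|/p2].
  by rewrite gE e1 e2 big_cat /= mulrACA.
exists 1, [:: g]; split; first exact: unitr1.
  move=> p; rewrite inE => /eqP ->; apply: primitive_prime => // h1 h2 gE.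
  have [|s1] := leqP (size h1) 1; [by left | right].
  by rewrite leqNgt; apply/negP => s2; apply: H; exists h1, h2.
by rewrite big_seq1 mul1r.
Qed.

End FactorialPoly.

Lemma factorial_iso (R R' : idomainType) (f : {rmorphism R -> R'})
    (g : {rmorphism R' -> R}) : cancel f g -> cancel g f ->
  factorial R -> factorial R'.
Proof.
move=> fK gK factR a a0.
have ga0 : g a != 0 by apply: contra_neq a0 => /(congr1 f); rewrite gK rmorph0.
have [u [s [uu sP gE]]] := factR _ ga0.
exists (f u), (map f s); split; first exact: rmorph_unit.
  move=> _ /mapP[p /sP[p0 pu pM] ->]; split.
  - by apply: contra_neq p0 => /(congr1 g); rewrite fK rmorph0.
  - by apply: contra pu => /(rmorph_unit g); rewrite fK.
  - move=> x y [c cE].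
    have : divides p (g x * g y) by exists (g c); rewrite -rmorphM cE rmorphM fK.
    case/pM => [[e eE]|[e eE]]; [left|right]; exists (f e).
      by rewrite -rmorphM -eE gK.
    by rewrite -rmorphM -eE gK.
by rewrite big_map -rmorph_prod -rmorphM -gE gK.
Qed.

Lemma mpoly_factorial (K : fieldType) n : factorial {mpoly K[n]}.
Proof.
elim: n => [|n IH].
  move=> a a0; exists a, [::]; split=> //; last by rewrite big_nil mulr1.
  rewrite (nvar0_mpolyC a); apply: rmorph_unit; rewrite unitfE.
  by apply: contra_neq a0 => e; rewrite (nvar0_mpolyC a) e mpolyC0.
have fp := factorial_poly IH.
pose f : {rmorphism {poly {mpoly K[n]}} -> {mpoly K[n.+1]}} := join_last (fun=> 0).
pose g : {rmorphism {mpoly K[n.+1]} -> {poly {mpoly K[n]}}} := split_last (fun=> 0).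
apply: (factorial_iso (f := f) (g := g)) fp.
  exact: join_lastK.
exact: split_lastK.
Qed.

(** * Krull's height theorem *)

Section Order.
Variables (R : comNzRingType) (m : nat).
Implicit Types p q : {mpoly R[m]}.

Definition vanishing_order s p := forall b : 'X_{1..m}, (mdeg b < s)%N -> p@_b = 0.

Lemma vanishing_orderM s t p q :
  vanishing_order s p -> vanishing_order t q -> vanishing_order (s + t) (p * q).
Proof.
move=> hp hq b bst; rewrite mcoeffM big1 // => -[k l] /= /eqP.
move: (bmnm k) (bmnm l) => {}k {}l bE.
have [ks|ks] := ltnP (mdeg k) s; first by rewrite hp // mul0r.
have dk := congr1 (@mdeg m) bE; rewrite mdegD in dk.
by rewrite hq ?mulr0 // -(ltn_add2l s) (leq_ltn_trans _ bst) // dk leq_add2r.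
Qed.

Lemma vanishing_orderX s p k :
  vanishing_order s p -> vanishing_order (k * s) (p ^+ k).
Proof.
move=> hp; elim: k => [|k IH]; first by move=> b; rewrite mul0n ltn0.
by rewrite exprS mulSn; exact: vanishing_orderM.
Qed.

Lemma vanishing_order_mulr s p q : vanishing_order s p -> vanishing_order s (p * q).
Proof.
move=> hp; rewrite -[s]addn0; exact: vanishing_orderM.
Qed.

End Order.

Lemma mnm_pigeonhole m M (b : 'X_{1..m}) : (0 < m)%N -> (m * M <= mdeg b)%N ->
  exists j, (M <= b j)%N.
Proof.
move=> m0 bM; apply: contrapT => H; move: bM; rewrite mdegE leqNgt => /negP; apply.
have : (\sum_(j < m) (b j).+1 <= \sum_(j < m) M)%N.
  by apply: leq_sum => j _; rewrite ltnNge; apply/negP => h; apply: H; exists j.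
rewrite sum_nat_const card_ord; apply: leq_trans.
have -> : (\sum_(j < m) (b j).+1 = \sum_(j < m) b j + m)%N.
  under eq_bigr do rewrite -addn1.
  by rewrite big_split /= sum_nat_const card_ord muln1.
by rewrite -addn1 leq_add2l.
Qed.

Lemma mpolyX_split (R : comNzRingType) m M (b : 'X_{1..m}) j : (M <= b j)%N ->
  'X_[R, b] = 'X_j ^+ M * 'X_[b - U_(j) *+ M].
Proof.
move=> bj; rewrite mpolyXn -mpolyXD addmC submK //.
by apply/mnm_lepP => i; rewrite mulmnE mnm1E; case: eqP => [<-|_]; rewrite ?mul1n.
Qed.

Section ZeroSets.
Variable C : closedFieldType.

Lemma prime_vanish n (q g : {mpoly C[n]}) : prime_elt q ->
  (forall v, ev q v = 0 -> ev g v = 0) -> divides q g.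
Proof.
move=> [q0 qu qM] H.
have [M] := @strong_nullstellensatz C n (eq q) g (fun v h => H v (h q erefl)).
have gM : ideal (eq q) (g ^+ M) -> divides q (g ^+ M).
  elim=> [|a x y <- _ [c ->]]; first exact: divides0.
  by exists (a + c); rewrite mulrDl.
move=> {gM} /gM; elim: M => [[c qc]|M IH].
  case/negP: qu; apply/unitrPr; exists c.
  by rewrite mulrC -qc expr0.
by rewrite exprS => /qM[|/IH].
Qed.

(** * Isolated common zeros *)

Section Isolated.
Variables (m r : nat) (f : 'I_r -> {mpoly C[m]}) (Q : {mpoly C[m]}).
Hypothesis m_gt0 : (0 < m)%N.
Hypotheses (f0 : forall i, ev (f i) 0 = 0) (Q0 : ev Q 0 != 0).
Hypothesis iso : forall b, (forall i, ev (f i) b = 0) -> ev Q b != 0 -> b = 0.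

Let I := ideal (fun p => exists i, p = f i).

Let I_sum p : I p -> exists a, p = \sum_i f i * a i.
Proof.
elim=> [|a x y [i ->] _ [b ->]]; first by exists (fun=> 0); rewrite big1 // => i _; rewrite mulr0.
exists (fun j => (if j == i then a else 0) + b j).
under [RHS]eq_bigr do rewrite mulrDr; rewrite big_split; congr (_ + _).
rewrite (bigD1 i) //= eqxx big1 ?addr0 ?[a * _]mulrC // => j /negPf ->.
by rewrite mulr0.
Qed.

(** ['X_j * Q] vanishes at all common zeros of the [f i]: at the origin because of ['X_j], at the
    others because of [Q]. The sum of the Nullstellensatz exponents serves for all [j]. *)
Lemma isolated_power : exists M, forall j, I (('X_j * Q) ^+ M).
Proof.
have H j : exists M, I (('X_j * Q) ^+ M).
  apply: strong_nullstellensatz => v hv; rewrite evM.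
  have [->|Qv] := eqVneq (ev Q v) 0; first by rewrite mulr0.
  rewrite (iso _ Qv) ?evX ?mxE ?mul0r // => i.
  by apply: hv; exists i.
pose M j := sval (cid (H j)).
exists (\sum_j M j)%N => j; rewrite (bigD1 j) //= exprD; apply: ideal_mulr.
exact: svalP (cid (H j)).
Qed.

Let vo1 (p : {mpoly C[m]}) : ev p 0 = 0 -> vanishing_order 1 p.
Proof.
move=> p0 b; rewrite ltnS leqn0 mdeg_eq0 => /eqP ->; rewrite -p0 /ev mevalE.
have [h|h] := boolP (0%MM \in msupp p).
  rewrite (bigD1_seq 0%MM) ?msupp_uniq //= [X in _ * X]big1 ?mulr1 => [|i _]; last first.
    by rewrite mnm0E expr0.
  rewrite big1 ?addr0 // => k k0; have /existsP[i ki] : [exists i, k i != 0%N].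
    apply: contraR k0; rewrite negb_exists => /forallP H.
    by apply/eqP/mnmP => i; rewrite mnm0E; apply/eqP; move: (H i); rewrite negbK.
  by rewrite (bigD1 i) //= mxE expr0n (negPf ki) mul0r mulr0.
by rewrite memN_msupp_eq0.
Qed.

(** Up to powers of [Q], monomials of degree at least [D] lie in the ideal of the [f i], and
    products of [s] of the [f i] vanish to order [s]. So the products of fewer than [s] of the [f i]
    with monomials of degree below [D] span all polynomials modulo order [s]; it remains to compare
    dimensions. *)
Lemma isolated_growth : exists K, forall s,
  (#|{: 'X_{1..m < s}}| <= #|{: 'X_{1..r < s}}| * K)%N.
Proof.
have [M HM] := isolated_power; pose D := (m * M)%N.
exists #|{: 'X_{1..m < D}}| => s.
(* The exponent of [Q] is chosen so that multiplication by [f i] passes from [s] to [s.+1]. *)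
pose mono s (g : 'X_{1..r}) (b : 'X_{1..m}) :=
  Q ^+ (M * (s - mdeg g)) * (\prod_i f i ^+ g i * 'X_[b]).
pose G s (p : {mpoly C[m]}) := (exists g b,
  [/\ (mdeg g < s)%N, (mdeg b < D)%N & p = mono s g b]) \/ vanishing_order s p.
(* One reduction costs the factor [Q ^+ M] and leaves a remainder [n] of degree below [D]. *)
have reduce p : exists a, exists2 n, (forall b, (D <= mdeg b)%N -> n@_b = 0) &
    Q ^+ M * p = Q ^+ M * n + \sum_i f i * a i.
  have H b : exists a, exists2 n : {mpoly C[m]}, (forall b, (D <= mdeg b)%N -> n@_b = 0) &
      Q ^+ M * 'X_[b] = Q ^+ M * n + \sum_i f i * a i.
    have [bD|bD] := ltnP (mdeg b) D.
      exists (fun=> 0), 'X_[b] => [b' b'D|].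
        by rewrite mcoeffX; case: eqP bD => // ->; rewrite ltnNge b'D.
      by rewrite [X in _ + X]big1 ?addr0 // => i _; rewrite mulr0.
    have [j bj] := mnm_pigeonhole m_gt0 bD.
    have [a aE] := I_sum (HM j).
    exists (fun i => a i * 'X_[b - U_(j) *+ M]), 0 => [b' _|]; first by rewrite mcoeff0.
    rewrite mulr0 add0r; under eq_bigr do rewrite mulrA.
    rewrite -mulr_suml -aE exprMn.
    by rewrite [in LHS](mpolyX_split _ bj) mulrA [Q ^+ M * _]mulrC.
  rewrite (mpolyE p); elim/big_rec: _ => [|b q _ [a [n hn qE]]].
    exists (fun=> 0), 0 => [b _|]; first by rewrite mcoeff0.
    by rewrite mulr0 add0r big1 // => i _; rewrite mulr0.
  have [a' [n' hn' bE]] := H b; exists (fun i => p@_b *: a' i + a i), (p@_b *: n' + n).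
    by move=> b' b'D; rewrite mcoeffD mcoeffZ hn // hn' // mulr0 addr0.
  under eq_bigr do rewrite mulrDr -scalerAr; rewrite big_split /= -scaler_sumr.
  by rewrite !mulrDr qE -!scalerAr bE scalerDr addrACA.
have spanS s' p i : Defs.span (G s') p -> Defs.span (G s'.+1) (f i * p).
  elim=> [q [[g [b [gs bD ->]]]|qs]||q1 q2 _ h1 _ h2|c q _ h].
  - apply: span_gen; left; exists (g + U_(i))%MM, b; split=> //.
      by rewrite mdegD mdeg1 addn1 ltnS.
    rewrite /mono mdegD mdeg1 addn1 subSS mulrCA; congr (_ * _); rewrite mulrA; congr (_ * _).
    rewrite (bigD1 i) //= [in RHS](bigD1 i) //= mnmDE mnm1E eqxx addn1 exprS -mulrA.
    congr (_ * (_ * _)); apply: eq_bigr => j ji.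
    by rewrite mnmDE mnm1E eq_sym (negPf ji) addn0.
  - apply: span_gen; right; rewrite -add1n; apply: vanishing_orderM => //.
    exact: vo1.
  - by rewrite mulr0; exact: span0.
  - by rewrite mulrDr; exact: spanD.
  - by rewrite -scalerAr; exact: spanZ.
have spanQ s' p : Defs.span (G s') (Q ^+ (M * s') * p).
  elim: s' p => [|s' IH] p; first by apply: span_gen; right => b; rewrite ltn0.
  have [a [n hn pE]] := reduce p.
  rewrite mulnS addnC exprD -mulrA pE mulrDr mulrA -exprD addnC -mulnS.
  apply: spanD.
    rewrite (mpolyE n) mulr_sumr big_seq; elim/big_rec: _ => [|b q bn hq].
      exact: span0.
    apply: spanD => //; rewrite -scalerAr; apply: spanZ; apply: span_gen; left.
    exists 0%MM, b; split; rewrite ?mdeg0 //.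
      by rewrite ltnNge; apply/negP => /hn nb; move: bn; rewrite mcoeff_msupp nb eqxx.
    by rewrite /mono mdeg0 subn0 big1 ?mul1r // => i _; rewrite mnm0E expr0.
  rewrite mulr_sumr; elim/big_rec: _ => [|i q _ hq]; first exact: span0.
  by apply: spanD => //; rewrite mulrCA; apply: spanS.
pose B : finType := 'X_{1..m < s}.
pose T : finType := ('X_{1..r < s} * 'X_{1..m < D})%type.
pose trunc (p : {mpoly C[m]}) : 'rV[C]_#|B| := \row_i p@_(bmnm (enum_val i)).
pose Gm : 'M[C]_(#|T|, #|B|) :=
  \matrix_(i < #|T|) trunc (mono s (enum_val i).1 (enum_val i).2).
have truncG p : Defs.span (G s) p -> (trunc p <= Gm)%MS.
  elim=> [q [[g [b [gs bD ->]]]|qs]||q1 q2 _ h1 _ h2|c q _ h].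
  - have -> : trunc (mono s g b) = row (enum_rank (BMultinom gs, BMultinom bD)) Gm.
      by rewrite rowK enum_rankK.
    exact: row_sub.
  - have -> : trunc q = 0 by apply/rowP => i; rewrite !mxE qs // bmdeg.
    exact: sub0mx.
  - have -> : trunc 0 = 0 by apply/rowP => i; rewrite !mxE mcoeff0.
    exact: sub0mx.
  - have -> : trunc (q1 + q2) = trunc q1 + trunc q2.
      by apply/rowP => i; rewrite !mxE mcoeffD.
    exact: addmx_sub.
  - have -> : trunc (c *: q) = c *: trunc q by apply/rowP => i; rewrite !mxE mcoeffZ.
    exact: scalemx_sub.
(* [P] is invertible modulo order [s], by the geometric series in [h], so that its multiples already
   give all truncations. *)
pose P := Q ^+ (M * s); have P0 : ev P 0 != 0 by rewrite /P evXn expf_neq0.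
pose h := 1 - (ev P 0)^-1 *: P.
have h1 : vanishing_order 1 h by apply: vo1; rewrite evB ev1 evZ mulVf ?subrr.
pose P' := (ev P 0)^-1 *: \sum_(i < s) h ^+ i.
have PP' : P * P' = 1 - h ^+ s.
  have -> : P = (ev P 0) *: (1 - h) by rewrite /h opprB addrC subrK scalerA divff ?scale1r.
  rewrite /P' -scalerAl -scalerAr scalerA divff // scale1r.
  by rewrite -opprB mulNr -subrX1 opprB.
rewrite -card_prod -/B -[X in (_ <= X)%N]/#|T| -(mxrank1 C #|B|).
apply: leq_trans (rank_leq_row Gm); apply: mxrankS; apply/row_subP => i.
have -> : row i 1%:M = trunc (P * (P' * 'X_[bmnm (enum_val i)])).
  apply/rowP => j; rewrite !mxE mulrA PP' mulrBl mul1r mcoeffB mcoeffX.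
  rewrite (vanishing_order_mulr _ (vanishing_orderX (k := s) h1)) ?muln1 ?bmdeg // subr0.
  by rewrite -bmeqP (inj_eq enum_val_inj).
by apply: truncG; exact: spanQ.
Qed.

(** In [isolated_growth] the left side grows like [s ^ m], the right side like [s ^ r]. *)
Lemma isolated_dim : (m <= r)%N.
Proof.
rewrite leqNgt; apply/negP => rm; have [K HK] := isolated_growth.
(* For [s = m * t] the two sides are compared through [t ^ m] and [(m * t) ^ r * K]; if [r < m], it
   is enough that [t] exceeds [m ^ r * K]. *)
pose t := (m ^ r * K).+1.
have lo : (t ^ m <= #|{: 'X_{1..m < m * t}}|)%N.
  have bd (e : {ffun 'I_m -> 'I_t}) : (mdeg [multinom (e i : nat) | i < m] < m * t)%N.
    rewrite mdegE; apply: (@leq_ltn_trans (\sum_(i < m) t.-1)%N).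
      by apply: leq_sum => i _; rewrite mnmE -ltnS; exact: ltn_ord.
    by rewrite sum_nat_const card_ord ltn_pmul2l.
  rewrite -[X in (X ^ _)%N]card_ord -[X in (_ ^ X)%N]card_ord -card_ffun.
  apply: (@leq_card _ _ (fun e => BMultinom (bd e))) => e e' /(congr1 val) /mnmP ee'.
  by apply/ffunP => i; apply: val_inj; have := ee' i; rewrite !mnmE.
have hi : (#|{: 'X_{1..r < m * t}}| <= (m * t) ^ r)%N.
  rewrite -[X in (X ^ _)%N]card_ord -[X in (_ ^ X)%N]card_ord -card_ffun.
  have bd (b : 'X_{1..r < m * t}) i : (b i < m * t)%N.
    by apply: leq_ltn_trans (bmdeg b); rewrite mdegE (bigD1 i) //= leq_addr.
  apply: (@leq_card _ _ (fun b : 'X_{1..r < m * t} => [ffun i => Ordinal (bd b i)])).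
  move=> b b' /ffunP bb'; apply: val_inj; apply/mnmP => i.
  by have := congr1 val (bb' i); rewrite !ffunE.
have := leq_trans lo (leq_trans (HK _) (leq_mul hi (leqnn K))).
rewrite expnMn mulnAC leqNgt => /negP; apply.
apply: (@leq_trans (t * t ^ r)); first by rewrite ltn_pmul2r ?expn_gt0 // /t ltnSn.
by rewrite -expnS leq_pexp2l.
Qed.
End Isolated.
End ZeroSets.

(** * Smooth hypersurfaces *)

Section Lines.
Variable C : closedFieldType.
Implicit Types m n : nat.

Definition mshift m (a : 'rV[C]_m) (P : {mpoly C[m]}) : {mpoly C[m]} :=
  P \mPo [tuple 'X_i + (a ord0 i)%:MP | i < m].

Lemma ev_mshift m (a : 'rV[C]_m) P v : ev (mshift a P) v = ev P (v + a).
Proof.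
rewrite /ev comp_mpoly_meval; apply: meval_eq => i.
by rewrite tnth_mktuple mxE mevalD mevalC mevalXU.
Qed.

(* Krull: fewer equations than variables never cut out finitely many points. *)
Lemma zeros_infinite m r (f : 'I_r -> {mpoly C[m]}) Q a (s : seq 'rV[C]_m) :
  (r < m)%N -> (forall i, ev (f i) a = 0) -> ev Q a != 0 ->
  exists b, [/\ b \notin s, forall i, ev (f i) b = 0 & ev Q b != 0].
Proof.
move=> rm fa Qa.
have sep (b : 'rV[C]_m) : b != a -> exists i, b ord0 i != a ord0 i.
  move=> ba; apply/existsP; apply: contraR ba; rewrite negb_exists => /forallP H.
  by apply/eqP/rowP => i; apply/eqP; move: (H i); rewrite negbK.
(* [Q'] removes the points of [s] other than [a]; if there were no further zero, [a] would be
   isolated. *)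
have [Q' [Q'a Q's]] : exists Q', ev Q' a != 0 /\
    forall b, ev Q' b != 0 -> ev Q b != 0 /\ (b \in s -> b = a).
  elim: s => [|c s [Q' [Q'a Q's]]]; first by exists Q; split=> // b.
  have [ca|/sep[i ci]] := eqVneq c a.
    exists Q'; split=> // b /Q's[Qb bs]; split=> //.
    by rewrite inE => /predU1P[->|/bs].
  exists (Q' * ('X_i - (c ord0 i)%:MP)); split.
    by rewrite evM mulf_neq0 // evB evX evC subr_eq0 eq_sym.
  move=> b; rewrite evM mulf_eq0 negb_or => /andP[/Q's[Qb bs] bi]; split=> //.
  rewrite inE => /predU1P[bc|/bs//].
  by move: bi; rewrite bc evB evX evC subrr eqxx.
apply: contrapT => H.
suff : (m <= r)%N by rewrite leqNgt rm.
have m0 : (0 < m)%N by apply: leq_trans rm.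
apply: (@isolated_dim C m r (fun i => mshift a (f i)) (mshift a Q') m0).
- by move=> i; rewrite ev_mshift add0r.
- by rewrite ev_mshift add0r.
move=> b fb; rewrite ev_mshift => Qb; apply/eqP/negPn/negP => b0; apply: H.
have [Qb' bs] := Q's _ Qb; exists (b + a); split=> //.
  by apply/negP => /bs/eqP; rewrite -subr_eq0 addrK (negPf b0).
by move=> i; rewrite -ev_mshift.
Qed.

Definition line m (a v : 'rV[C]_m) : {mpoly C[m]} -> {poly C} :=
  mmap polyC (fun i => (a ord0 i)%:P + (v ord0 i)%:P * 'X).
HB.instance Definition _ m (a v : 'rV[C]_m) :=
  GRing.RMorphism.copy (line a v) (line a v).

Lemma lineC m (a v : 'rV[C]_m) c : line a v c%:MP = c%:P.
Proof. by rewrite /line mmapC. Qed.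

Lemma lineX m (a v : 'rV[C]_m) i :
  line a v 'X_i = (a ord0 i)%:P + (v ord0 i)%:P * 'X.
Proof. by rewrite /line mmapX mmap1U. Qed.

Lemma horner_line m (a v : 'rV[C]_m) P t : (line a v P).[t] = ev P (a + t *: v).
Proof.
apply: (mpoly_morph_ext (f := horner_eval t \o line a v)
  (g := evpt (a + t *: v))) => [c|i] /=; rewrite /horner_eval.
  by rewrite lineC hornerC /evpt evC.
by rewrite lineX hornerD hornerM !hornerC hornerX /evpt evX !mxE mulrC.
Qed.

(** The differential of [P] at [v] applied to [w], written dF(v)w in the overview. *)
Definition dev m (P : {mpoly C[m]}) (v w : 'rV[C]_m) : C :=
  \sum_i w ord0 i * ev P^`M(i) v.

Lemma devDr m (P : {mpoly C[m]}) v w w' : dev P v (w + w') = dev P v w + dev P v w'.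
Proof. by rewrite -big_split; apply: eq_bigr => i _; rewrite mxE mulrDl. Qed.

Lemma devZr m (P : {mpoly C[m]}) v c w : dev P v (c *: w) = c * dev P v w.
Proof. by rewrite /dev mulr_sumr; apply: eq_bigr => i _; rewrite mxE mulrA. Qed.

Lemma devNr m (P : {mpoly C[m]}) v w : dev P v (- w) = - dev P v w.
Proof. by rewrite -scaleN1r devZr mulN1r. Qed.

Lemma devBr m (P : {mpoly C[m]}) v w w' : dev P v (w - w') = dev P v w - dev P v w'.
Proof. by rewrite devDr devNr. Qed.

Lemma dev_delta m (P : {mpoly C[m]}) v i : dev P v (delta_mx ord0 i) = ev P^`M(i) v.
Proof.
rewrite /dev (bigD1 i) //= mxE !eqxx mul1r big1 ?addr0 // => j ji.
by rewrite mxE (negPf ji) andbF mul0r.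
Qed.

Lemma devD m (P Q : {mpoly C[m]}) v w : dev (P + Q) v w = dev P v w + dev Q v w.
Proof. by rewrite -big_split; apply: eq_bigr => i _; rewrite mderivD evD mulrDr. Qed.

Lemma devM m (P Q : {mpoly C[m]}) v w :
  dev (P * Q) v w = dev P v w * ev Q v + ev P v * dev Q v w.
Proof.
rewrite /dev mulr_suml mulr_sumr -big_split; apply: eq_bigr => i _.
by rewrite mderivM evD !evM mulrDr mulrA [ev P v * (_ * _)]mulrCA.
Qed.

Lemma devC m c (v w : 'rV[C]_m) : dev c%:MP v w = 0.
Proof. by rewrite /dev big1 // => i _; rewrite mderivC ev0 mulr0. Qed.

Lemma mderiv_var m (i j : 'I_m) : ('X_i : {mpoly C[m]})^`M(j) = ((i == j)%:R)%:MP.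
Proof.
rewrite mderivX mnm1E; case: eqP => [->|_]; last by rewrite scale0r mpolyC0.
rewrite (_ : (U_(j) - U_(j))%MM = 0%MM) ?mpolyX0 ?scale1r ?mpolyC1 //.
by apply/mnmP => k; rewrite mnmBE subnn mnm0E.
Qed.

Lemma devX m i (v w : 'rV[C]_m) : dev 'X_i v w = w ord0 i.
Proof.
rewrite /dev (bigD1 i) //= mderiv_var eqxx evC mulr1 big1 ?addr0 // => j ji.
by rewrite mderiv_var eq_sym (negPf ji) evC mulr0.
Qed.

Lemma deriv_line m (a v : 'rV[C]_m) P t :
  ((line a v P)^`()).[t] = dev P (a + t *: v) v.
Proof.
elim/mpoly_ind_ring: P => [c|i|p q hp hq|p q hp hq].
- by rewrite lineC derivC horner0 devC.
- by rewrite lineX derivD derivC add0r derivM derivC mul0r add0r derivX mulr1 hornerC devX.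
- by rewrite rmorphD derivD hornerD hp hq devD.
- by rewrite rmorphM derivM hornerD !hornerM hp hq !horner_line devM.
Qed.

Lemma dev_euler m d (P : {mpoly C[m]}) v : P \is d.-homog ->
  dev P v v = d%:R * ev P v.
Proof.
move=> hP; have L : line 0 v P = ev P v *: 'X^d.
  apply/eqP; rewrite -subr_eq0; apply/negPn/negP => /closed_nonrootP[t] /negP; apply.
  rewrite /root hornerD hornerN hornerZ hornerXn horner_line add0r.
  by rewrite (homog_evZ _ _ hP) mulrC subrr.
have := deriv_line 0 v P 1; rewrite L derivZ derivXn hornerZ hornerMn hornerXn.
by rewrite expr1n add0r scale1r mulr_natr => <-; rewrite mulr_natl.
Qed.

Lemma homog_ev0 m d (P : {mpoly C[m]}) : P \is d.-homog -> (0 < d)%N -> ev P 0 = 0.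
Proof. by move=> hP d0; rewrite -(scale0r 0) (homog_evZ _ _ hP) expr0n gtn_eqF ?mul0r. Qed.

Lemma dhomog_deriv m d (P : {mpoly C[m]}) i : P \is d.+1.-homog ->
  P^`M(i) \is d.-homog.
Proof.
move=> hP; apply/dhomogP => b; rewrite mcoeff_msupp mcoeff_deriv => h.
have : (b + U_(i))%MM \in msupp P.
  by rewrite mcoeff_msupp; apply: contraNneq h => ->; rewrite mul0rn.
move=> /(dhomog_mf hP) /=; rewrite mdegD mdeg1 addn1 => -[].
by [].
Qed.

(* Along a line through the origin where [F] does not vanish, a divisor of
   [t ^ d] with nonzero constant term is constant. *)
Lemma homog_factor0 m d (F A B : {mpoly C[m]}) :
  (forall t v, ev F (t *: v) = t ^+ d * ev F v) -> F != 0 ->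
  F = A * B -> A \isn't a GRing.unit -> ev A 0 = 0.
Proof.
move=> hF F0 FAB; apply: contraNeq => A0.
suff -> : A = (ev A 0)%:MP by apply: rmorph_unit; rewrite unitfE.
apply/eqP; rewrite -subr_eq0; apply: contraNT F0 => AC; apply/eqP.
apply: (mulfI AC); rewrite mulr0; apply: mpoly_ext => v; rewrite ev0 evM.
have [->|Fv] := eqVneq (ev F v) 0; first by rewrite mulr0.
suff -> : ev (A - (ev A 0)%:MP) v = 0 by rewrite mul0r.
have L : line 0 v A * line 0 v B = ev F v *: 'X^d.
  rewrite -rmorphM -FAB; apply/eqP; rewrite -subr_eq0.
  apply/negPn/negP => /closed_nonrootP[t] /negP; apply.
  rewrite /root hornerD hornerN hornerZ hornerXn horner_line add0r.
  by rewrite hF mulrC subrr.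
have : line 0 v A %| ('X - 0%:P) ^+ d.
  by rewrite subr0 -(dvdpZr _ _ Fv) -L dvdp_mulr.
move=> /dvdp_exp_XsubCP[k _]; rewrite subr0 => Ak.
have k0 : k = 0%N.
  case: k Ak => // k Ak; have : 'X %| line 0 v A.
    by rewrite (eqp_dvdr _ Ak) exprS dvdp_mulr.
  by rewrite -['X]subr0 dvdp_XsubCl /root horner_line scale0r addr0 (negPf A0).
move: Ak; rewrite k0 expr0 -size_poly_eq1 => /size_poly1P[c _ Ac].
rewrite evB evC; apply/eqP; rewrite subr_eq0; apply/eqP.
have := horner_line 0 v A 1; rewrite scale1r add0r => <-.
by have := horner_line 0 v A 0; rewrite scale0r addr0 => <-; rewrite Ac !hornerC.
Qed.

Lemma evC_unit m (A : {mpoly C[m]}) : A \is a GRing.unit -> forall v, ev A v != 0.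
Proof.
move=> uA v; apply/eqP => Av; have := congr1 (fun P => ev P v) (mulVr uA).
by rewrite evM Av mulr0 ev1 => /eqP; rewrite eq_sym oner_eq0.
Qed.

End Lines.

(** * Irreducibility of smooth hypersurfaces *)

Section Smooth.
Variables (C : closedFieldType) (N d : nat) (F : {mpoly C[N.+3]}).
Hypotheses (hF : F \is d.-homog) (d_gt0 : (0 < d)%N) (smooth : smooth_hypersurface F).

Lemma smooth_neq0 : F != 0.
Proof.
apply/eqP => F0; have v0 : delta_mx ord0 ord0 != 0 :> 'rV[C]_N.+3.
  by apply/eqP => /matrixP/(_ ord0 ord0)/eqP; rewrite !mxE !eqxx oner_eq0.
have [|i] := smooth (v := delta_mx ord0 ord0); first by rewrite F0; split=> //; rewrite ev0.
by rewrite F0 mderiv0 ev0 eqxx.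
Qed.

Lemma smooth_dev v : v != 0 -> ev F v = 0 -> exists i, ev F^`M(i) v != 0.
Proof. by move=> v0 Fv; apply: smooth. Qed.

(** Two factors that are not units vanish at the origin by homogeneity; with at least three
    variables they have another common zero, and [F] would be singular there. *)
Lemma smooth_prime : prime_elt F.
Proof.
have F0 := smooth_neq0; have [u [s [uu sP FE]]] := mpoly_factorial F0.
case: s sP FE => [|q [|q' s]] sP FE.
- have /eqP := homog_ev0 hF d_gt0.
  by rewrite FE big_nil mulr1 (negPf (evC_unit uu 0)).
- have [q0 qu qM] := sP q (mem_head _ _); move: FE; rewrite big_seq1 => FE.
  split=> //; first by rewrite FE unitrM uu.
  have Fq a : divides q a -> divides F a.
    by move=> [c ->]; exists (c * u^-1); rewrite FE mulrA mulrVK.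
  move=> a b [c abE]; have /qM[/Fq|/Fq] : divides q (a * b); [|by left|by right].
  by exists (c * u); rewrite abE FE mulrA.
- have [q0 qu qM] := sP q (mem_head _ _).
  set g := u * \prod_(r <- q' :: s) r; have FE' : F = q * g.
    by rewrite FE big_cons mulrCA.
  have gu : g \isn't a GRing.unit.
    have [_ q'u _] : prime_elt q' by apply: sP; rewrite !inE eqxx orbT.
    by apply: contra q'u; rewrite /g big_cons !unitrM => /and3P[].
  have qz := homog_factor0 (fun t v => homog_evZ t v hF) F0 FE' qu.
  have gz : ev g 0 = 0 by apply: (homog_factor0 (fun t v => homog_evZ t v hF) F0 (B := q) _ gu); rewrite mulrC.
  clearbody g.
  pose f (i : 'I_2) := if i == ord0 then q else g.
  have [||b [b0 fb _]] := @zeros_infinite C N.+3 2 f 1 0 [:: 0] isT.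
  + by move=> i; rewrite /f; case: ifP.
  + by rewrite ev1 oner_neq0.
  move: b0; rewrite inE => b0; have qb : ev q b = 0 := fb ord0.
  have gb : ev g b = 0 := fb ord_max.
  have [|i] := smooth_dev b0; first by rewrite FE' evM qb mul0r.
  by rewrite FE' mderivM evD !evM qb gb mulr0 mul0r addr0 eqxx.
Qed.

(** Nothing is assumed on [g] at the origin, so [g] is multiplied by the coordinates; [F] cannot
    divide all of these, having zeros other than the origin. *)
Lemma vanish_divides (g : {mpoly C[N.+3]}) :
  (forall v, v != 0 -> ev F v = 0 -> ev g v = 0) -> divides F g.
Proof.
move=> H; have pF := smooth_prime; have [_ _ pM] := pF.
have Xg i : divides F ('X_i * g).
  apply: prime_vanish => // v Fv; rewrite evM evX.
  have [->|v0] := eqVneq v 0; first by rewrite mxE mul0r.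
  by rewrite (H v v0 Fv) mulr0.
apply: contrapT => nFg.
have FX i : divides F 'X_i by case: (pM _ _ (Xg i)).
pose i1 : 'I_N.+3 := lift ord0 ord0.
pose v : 'rV[C]_N.+3 := delta_mx ord0 i1.
have Fv0 : forall w, ev F w = 0 -> w = 0.
  by move=> w Fw; apply/rowP => i; have [c Xc] := FX i; rewrite -evX Xc evM Fw mulr0 mxE.
have [||b [b0 fb _]] := @zeros_infinite C N.+3 1 (fun=> F) 1 0 [:: 0] isT.
- by move=> _; exact: homog_ev0 hF d_gt0.
- by rewrite ev1 oner_neq0.
by move: b0; rewrite inE (Fv0 _ (fb ord0)) eqxx.
Qed.

Lemma hypersurface_irreducible (g h : {mpoly C[N.+3]}) :
  (forall v, v != 0 -> ev F v = 0 -> ev g v * ev h v = 0) ->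
  (forall v, ev F v = 0 -> ev g v = 0) \/ (forall v, ev F v = 0 -> ev h v = 0).
Proof.
move=> H; have [_ _ pM] := smooth_prime.
have : divides F (g * h) by apply: vanish_divides => v v0 Fv; rewrite evM H.
by case/pM => -[c ->]; [left|right] => v Fv; rewrite evM Fv mulr0.
Qed.

End Smooth.

Lemma mpolyX_homog1 (R : nzRingType) n i : ('X_i : {mpoly R[n]}) \is 1.-homog.
Proof. by rewrite dhomogX /= mdeg1. Qed.

Section Homogeneous.
Variables (R : comNzRingType) (m : nat).
Implicit Types a x : {mpoly R[m]}.

Lemma pihomog_homog k e x : x \is k.-homog ->
  pihomog mdeg e x = if k == e then x else 0.
Proof.
move=> hx; case: eqP => [<-|/eqP ke]; first exact: pihomog_dE.
exact: pihomog_ne0 ke hx.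
Qed.

Lemma pihomog_mulr k e a x : x \is k.-homog ->
  pihomog mdeg e (a * x) = if (k <= e)%N then pihomog mdeg (e - k) a * x else 0.
Proof.
move=> hx; rewrite (mpolyE a) mulr_suml !raddf_sum /=.
case: ifP => ke; last first.
  rewrite big1 // => b _; rewrite (@pihomog_homog (mdeg b + k)) ?dhomogM ?dhomogZ ?dhomogX //.
  case: eqP => // be; by rewrite -be leq_addl in ke.
rewrite mulr_suml; apply: eq_bigr => b _.
rewrite (@pihomog_homog (mdeg b + k)) ?dhomogM ?dhomogZ ?dhomogX //.
rewrite (@pihomog_homog (mdeg b)) ?dhomogZ ?dhomogX //.
have -> : (mdeg b + k == e)%N = (mdeg b == e - k)%N.
  by rewrite -(eqn_add2r k (mdeg b)) subnK.
by case: eqP => _; rewrite ?mul0r.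
Qed.

End Homogeneous.

(** * Finiteness of the Gauss map *)

Section GaussMap.
Variables (C : closedFieldType) (N d : nat) (F : {mpoly C[N]}).
Hypotheses (N_gt0 : (0 < N)%N) (hF : F \is d.+2.-homog) (dF : (d.+2)%:R != 0 :> C).
Hypothesis (smooth : smooth_hypersurface F).

(** By Euler's formula and smoothness the partial derivatives vanish together at the origin only.
    Taking the part of degree [M] of a Nullstellensatz relation bounds the degrees of its
    coefficients. *)
Lemma gradient_power : exists M, forall j, exists A : 'I_N -> {mpoly C[N]},
  (forall i, (msize (A i) <= M)%N) /\ 'X_j ^+ M = \sum_i A i * F^`M(i).
Proof.
pose S P := exists i, P = F^`M(i).
have hdF i : F^`M(i) \is d.+1.-homog by exact: dhomog_deriv.
have H j : exists M, ideal S ('X_j ^+ M).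
  apply: strong_nullstellensatz => v hv; rewrite evX.
  have dv i : ev F^`M(i) v = 0 by apply: hv; exists i.
  have Fv : ev F v = 0.
    have := dev_euler v hF; rewrite /dev big1 => [|i _]; last by rewrite dv mulr0.
    by move=> /esym/eqP; rewrite mulf_eq0 (negPf dF) => /eqP.
  have [->|v0] := eqVneq v 0; first by rewrite mxE.
  by have [|i] := smooth (v := v); [by split | rewrite dv eqxx].
pose M j := sval (cid (H j)); pose M0 := (\sum_j M j)%N.
have HM j : ideal S ('X_j ^+ M0).
  by rewrite /M0 (bigD1 j) //= exprD; apply: ideal_mulr; exact: svalP (cid (H j)).
have graded g e : ideal S g -> exists A : 'I_N -> {mpoly C[N]},
  (forall i, (msize (A i) <= e)%N) /\ pihomog mdeg e g = \sum_i A i * F^`M(i).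
  elim=> [|a x y [i ->] _ [A [sA yE]]].
    exists (fun=> 0); split=> [i|]; first by rewrite msize0.
    by rewrite raddf0 big1 // => i _; rewrite mul0r.
  rewrite raddfD /= (pihomog_mulr _ _ (hdF i)) yE; case: ifP => de; last first.
    by exists A; split=> //; rewrite add0r.
  pose B := pihomog mdeg (e - d.+1) a.
  have sB : (msize B <= e)%N.
    have [->|B0] := eqVneq B 0; first by rewrite msize0.
    rewrite -mlead_deg //.
    have -> : mdeg (mlead B) = (e - d.+1)%N.
      exact: (dhomog_mf (pihomogP _ _ _) (mlead_supp B0)).
    by rewrite ltn_subrL (leq_trans _ de).
  exists (fun j => (if j == i then B else 0) + A j); split=> [j|].
    rewrite (leq_trans (msizeD_le _ _)) // geq_max sA andbT.
    by case: ifP => _; rewrite ?msize0.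
  under eq_bigr do rewrite mulrDl; rewrite big_split /= [in RHS](bigD1 i) //= eqxx.
  by rewrite [X in _ = _ + X + _]big1 ?addr0 // => j /negPf ->; rewrite mul0r.
exists M0 => j; have [A [sA e]] := graded _ M0 (HM j).
exists A; split=> //; rewrite -e pihomog_dE //.
by rewrite mpolyXn dhomogX /= mdegMn mdeg1 mul1n.
Qed.

(** On a fibre of the gradient the derivatives are constants, so the relation for ['X_j ^+ M] lowers
    degrees: the functions on the fibre form a space of finite dimension. *)
Lemma gradient_fiber_low (a : 'I_N -> C) : exists D, forall P, exists2 P' : {mpoly C[N]},
  (msize P' <= D)%N & forall v, (forall i, ev F^`M(i) v = a i) -> ev P v = ev P' v.
Proof.
have [M HM] := gradient_power; exists (N * M)%N.
pose low P := exists2 P' : {mpoly C[N]}, (msize P' <= N * M)%N &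
  forall v, (forall i, ev F^`M(i) v = a i) -> ev P v = ev P' v.
have low0 : low 0 by exists 0; rewrite ?msize0.
have lowD P P1 : low P -> low P1 -> low (P + P1).
  move=> [P' s e] [P1' s1 e1]; exists (P' + P1').
    by rewrite (leq_trans (msizeD_le _ _)) // geq_max s.
  by move=> v va; rewrite !evD e // e1.
have lowZ c P : low P -> low (c *: P).
  move=> [P' s e]; exists (c *: P'); first by rewrite (leq_trans (msizeZ_le _ _)).
  by move=> v va; rewrite !evZ e.
have lowS k P : (forall b, b \in msupp P -> (mdeg b < k)%N) ->
    (forall b : 'X_{1..N}, (mdeg b < k)%N -> low 'X_[b]) -> low P.
  move=> hP H; rewrite (mpolyE P) big_seq; elim/big_rec: _ => // b Q /hP bP lQ.
  by apply: lowD => //; apply: lowZ; exact: H.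
have lowX k (b : 'X_{1..N}) : (mdeg b < k)%N -> low 'X_[b].
  elim: k b => // k IH b bk.
  have [bM|bM] := ltnP (mdeg b) (N * M); first by exists 'X_[b]; rewrite ?msizeX.
  have [j bj] := mnm_pigeonhole N_gt0 bM; have [A [sA XE]] := HM j.
  pose P := \sum_i a i *: (A i * 'X_[b - U_(j) *+ M]).
  have [P' s e] : low P.
    rewrite /P; elim/big_rec: _ => // i Q _ lQ; apply: lowD => //; apply: lowZ.
    apply: (lowS (mdeg b)) => [c|c cb]; last by apply: IH; rewrite (leq_trans cb).
    move=> /msize_mdeg_lt h; apply: (leq_trans h).
    have [->|A0] := eqVneq (A i) 0; first by rewrite mul0r msize0.
    have X0 : 'X_[C, b - U_(j) *+ M] != 0 by rewrite -msize_poly_eq0 msizeX.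
    rewrite msizeM // msizeX addnS /=.
    have -> : mdeg b = (M + mdeg (b - U_(j) *+ M))%N.
      have := congr1 (fun p => msize p) (mpolyX_split C bj).
      by rewrite mpolyXn -mpolyXD !msizeX mdegD mdegMn mdeg1 mul1n => -[].
    by rewrite leq_add2r.
  exists P' => // v va; rewrite -e // (mpolyX_split C bj) XE mulr_suml !ev_sum.
  by apply: eq_bigr => i _; rewrite evZ !evM va mulrAC mulrC.
by move=> P; apply: (lowS (msize P)) => [b /msize_mdeg_lt|b]; [|exact: lowX].
Qed.

(** The powers of a coordinate are linearly dependent on the fibre, so it takes finitely many values
    there. *)
Lemma gradient_fiber_finite (a : 'I_N -> C) : exists s : seq 'rV[C]_N,
  forall v, (forall i, ev F^`M(i) v = a i) -> v \in s.
Proof.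
have [D HD] := gradient_fiber_low a; pose B : finType := 'X_{1..N < D}.
have Hj j : exists r : seq C, forall v, (forall i, ev F^`M(i) v = a i) -> v ord0 j \in r.
  pose P' k := sval (cid2 (HD ('X_j ^+ k))).
  have sP k : (msize (P' k) <= D)%N by rewrite /P'; case: cid2.
  have eP k v : (forall i, ev F^`M(i) v = a i) -> v ord0 j ^+ k = ev (P' k) v.
    by rewrite /P'; case: cid2 => Q _ e va /=; rewrite -e // evXn evX.
  pose A : 'M[C]_(#|B|.+1, #|B|) := \matrix_(k < _) \row_i (P' k)@_(bmnm (enum_val i)).
  have : kermx A != 0.
    rewrite kermx_eq0 /row_free; apply/negP => /eqP rA.
    by have := rank_leq_col A; rewrite rA ltnn.
  case/rowV0Pn => u /sub_kermxP uA u0; pose q := rVpoly u.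
  have q0 : q != 0 by apply: contra_neq u0 => e; rewrite -(rVpolyK u) -/q e raddf0.
  have [r qE] := closed_field_poly_normal q.
  exists r => v va; have : root q (v ord0 j).
    have -> : root q (v ord0 j) = ((u *m (\col_(k < #|B|.+1) v ord0 j ^+ k)) ord0 ord0 == 0).
      rewrite /root (horner_coef_wide _ (size_poly _ _)) mxE; congr (_ == 0).
      by apply: eq_bigr => k _; rewrite coef_rVpoly_ord mxE.
    have -> : u *m (\col_(k < #|B|.+1) v ord0 j ^+ k) = u *m A *m \col_i ev 'X_[bmnm (enum_val i : B)] v.
      rewrite -mulmxA; congr (_ *m _); apply/matrixP => k l; rewrite !mxE eP //.
      have := mpolywE (sP k) => /(congr1 (fun p => ev p v)); rewrite ev_sum => ->.
      rewrite (reindex_onto enum_val enum_rank) => [|i _]; last by rewrite enum_rankK.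
      rewrite (eq_bigl xpredT) => [|i]; last by rewrite enum_valK eqxx.
      by apply: eq_bigr => i _; rewrite evZ !mxE.
    by rewrite uA mul0mx mxE.
  rewrite {1}qE rootZ ?lead_coef_eq0 // root_prod_XsubC.
  by [].
pose r j := sval (cid (Hj j)); pose t := flatten [seq r j | j : 'I_N].
exists [seq \row_j nth 0 t (f j) | f : {ffun 'I_N -> 'I_(size t)}] => v va.
have vt j : v ord0 j \in t.
  apply/flattenP; exists (r j); first by rewrite map_f ?mem_enum.
  exact: (svalP (cid (Hj j))).
have lt j : (index (v ord0 j) t < size t)%N by rewrite index_mem.
apply/mapP; exists [ffun j => Ordinal (lt j)]; first by rewrite mem_enum.
by apply/rowP => j; rewrite mxE ffunE nth_index.
Qed.

Definition nonparallel (x x' : 'rV[C]_N) := exists e1 e2,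
  dev F x e1 * dev F x' e2 - dev F x e2 * dev F x' e1 != 0.

Lemma parallel_grad x x' : x != 0 -> ev F x = 0 -> ~ nonparallel x x' ->
  exists c, forall i, ev F^`M(i) x' = c * ev F^`M(i) x.
Proof.
move=> x0 Fx H; have [|j Fj] := smooth (v := x); first by [].
exists (ev F^`M(j) x' / ev F^`M(j) x) => i; apply: contrapT => /eqP e; apply: H.
exists (delta_mx ord0 j), (delta_mx ord0 i); rewrite !dev_delta.
apply: contra_neq e => /eqP; rewrite subr_eq0 => /eqP e; apply: (mulfI Fj).
by rewrite e mulrA [_ * (_ / _)]mulrC divfK // mulrC.
Qed.

(** If the gradient at [x'] is [c] times that at [x], then [t *: x'] with [t ^+ d.+1 = c^-1] lies in
    the gradient fibre of [x], which is finite; the normalisation by [l] recovers [x'] from this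
    multiple. *)
Lemma parallel_finite (l x : 'rV[C]_N) : x != 0 -> ev F x = 0 ->
  exists s : seq 'rV[C]_N, forall x', x' != 0 -> ev F x' = 0 ->
    (l *m x'^T) ord0 ord0 = 1 -> ~ nonparallel x x' -> x' \in s.
Proof.
move=> x0 Fx; have [s Hs] := gradient_fiber_finite (fun i => ev F^`M(i) x).
exists [seq ((l *m b^T) ord0 ord0)^-1 *: b | b <- s] => x' x'0 Fx' lx' /(parallel_grad x0 Fx)[c Hc].
have c0 : c != 0.
  have [|i] := smooth (v := x'); first by [].
  by rewrite Hc; apply: contraNneq => ->; rewrite mul0r.
have [t /rootP ht] : exists t, root ('X^(d.+1) - (c^-1)%:P) t.
  by apply/closed_rootP; rewrite size_XnsubC.
have tE : t ^+ d.+1 = c^-1.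
  by apply/eqP; move: ht => /eqP; rewrite hornerD hornerN hornerC hornerXn subr_eq0.
have t0 : t != 0 by apply: contraTneq (invr_neq0 c0) => t0; rewrite -tE t0 expr0n eqxx.
apply/mapP; exists (t *: x').
  apply: Hs => i; rewrite (homog_evZ _ _ (dhomog_deriv i hF)) tE Hc mulrA mulVf //.
  by rewrite mul1r.
have -> : (l *m (t *: x')^T) ord0 ord0 = t.
  rewrite -[RHS]mulr1 -lx' !mxE mulr_sumr; apply: eq_bigr => k _.
  by rewrite !mxE mulrCA.
by rewrite scalerA mulVf // scale1r.
Qed.

End GaussMap.

(** * Constancy in the base point *)

Section FunctionAlgebras.
Variables (C : closedFieldType) (T : Type).

(** This lets one argument show that an expression is polynomial in each group of its variables: a
    point of [X], or a vector moving on a line. *)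
Record subalgebra (A : (T -> C) -> Prop) : Prop := Subalgebra {
  subalg_ext : forall f g, f =1 g -> A f -> A g;
  subalg_cst : forall c, A (fun=> c);
  subalg_add : forall f g, A f -> A g -> A (fun t => f t + g t);
  subalg_mul : forall f g, A f -> A g -> A (fun t => f t * g t) }.

Variables (A : (T -> C) -> Prop) (AP : subalgebra A).

Lemma subalg_sum I (r : seq I) (P : pred I) (f : I -> T -> C) :
  (forall i, P i -> A (f i)) -> A (fun t => \sum_(i <- r | P i) f i t).
Proof.
move=> Af; elim: r => [|i r IH].
  by apply: (subalg_ext AP _ (subalg_cst AP 0)) => t; rewrite big_nil.
have [Pi|Pi] := boolP (P i).
  by apply: (subalg_ext AP _ (subalg_add AP (Af i Pi) IH)) => t; rewrite big_cons Pi.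
by apply: (subalg_ext AP _ IH) => t; rewrite big_cons (negPf Pi).
Qed.

Lemma subalg_sub f g : A f -> A g -> A (fun t => f t - g t).
Proof.
move=> Af Ag; have := subalg_add AP Af (subalg_mul AP (subalg_cst AP (-1)) Ag).
by apply: (subalg_ext AP) => t; rewrite mulN1r.
Qed.

Lemma subalg_exp f k : A f -> A (fun t => f t ^+ k).
Proof.
move=> Af; elim: k => [|k IH].
  by apply: (subalg_ext AP _ (subalg_cst AP 1)) => t; rewrite expr0.
by apply: (subalg_ext AP _ (subalg_mul AP Af IH)) => t; rewrite exprS.
Qed.

Lemma subalg_ev m (x : T -> 'rV[C]_m) (P : {mpoly C[m]}) :
  (forall i, A (fun t => x t ord0 i)) -> A (fun t => ev P (x t)).
Proof.
move=> Ax; elim/mpoly_ind_ring: P => [c|i|P Q hP hQ|P Q hP hQ].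
- by apply: (subalg_ext AP _ (subalg_cst AP c)) => t; rewrite evC.
- by apply: (subalg_ext AP _ (Ax i)) => t; rewrite evX.
- by apply: (subalg_ext AP _ (subalg_add AP hP hQ)) => t; rewrite evD.
- by apply: (subalg_ext AP _ (subalg_mul AP hP hQ)) => t; rewrite evM.
Qed.

Lemma subalg_dev m (x v : T -> 'rV[C]_m) (P : {mpoly C[m]}) :
  (forall i, A (fun t => x t ord0 i)) -> (forall i, A (fun t => v t ord0 i)) ->
  A (fun t => dev P (x t) (v t)).
Proof.
move=> Ax Av; apply: subalg_sum => i _; apply: (subalg_mul AP) => //.
exact: subalg_ev.
Qed.

End FunctionAlgebras.

(** * Irreducible families *)

Section Irreducible.
Variable C : closedFieldType.

Definition irreducible_for T (D : T -> Prop) (A : (T -> C) -> Prop) :=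
  forall f g a b, A f -> A g -> D a -> D b -> f a != 0 -> g b != 0 ->
  exists c, [/\ D c, f c != 0 & g c != 0].

(** The two coordinates are moved one after the other, so it suffices that the functions are of the
    right kind in each variable separately. *)
Lemma irreducible_prod T T' (D : T -> Prop) (D' : T' -> Prop) A A' :
  irreducible_for D A -> irreducible_for D' A' ->
  irreducible_for (fun t => D t.1 /\ D' t.2)
    (fun f => (forall y, A (fun x => f (x, y))) /\ (forall x, A' (fun y => f (x, y)))).
Proof.
move=> irr irr' f g [a a'] [b b'] [fA fA'] [gA gA'] [/= Da Da'] [/= Db Db'] fa gb.
have [c [Dc fc gc]] := irr _ _ _ _ (fA a') (gA b') Da Db fa gb.
have [c' [Dc' fc' gc']] := irr' _ _ _ _ (fA' c) (gA' c) Da' Db' fc gc.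
by exists (c, c').
Qed.

(** Polynomiality along lines is enough for irreducibility and needs no coordinates on [V], which
    will be a product of spaces of vectors and matrices. *)
Definition line_poly (V : lmodType C) (f : V -> C) :=
  forall a b, exists q : {poly C}, forall t, f (a + t *: b) = q.[t].

Lemma line_poly_subalgebra (V : lmodType C) : subalgebra (@line_poly V).
Proof.
split=> [f g fg Af a b|c a b|f g Af Ag a b|f g Af Ag a b].
- by have [q hq] := Af a b; exists q => t; rewrite -fg.
- by exists c%:P => t; rewrite hornerC.
- have [p hp] := Af a b; have [q hq] := Ag a b.
  by exists (p + q) => t; rewrite hornerD hp hq.
- have [p hp] := Af a b; have [q hq] := Ag a b.
  by exists (p * q) => t; rewrite hornerM hp hq.
Qed.

Lemma line_poly_linear (V : lmodType C) (f : V -> C) :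
  (forall a t b, f (a + t *: b) = f a + t * f b) -> line_poly f.
Proof.
move=> fl a b; exists ((f a)%:P + (f b)%:P * 'X) => t.
by rewrite fl hornerD hornerM !hornerC hornerX mulrC.
Qed.

Lemma line_poly_irreducible (V : lmodType C) :
  irreducible_for (fun _ : V => True) (@line_poly V).
Proof.
move=> f g a b Af Ag _ _ fa gb.
have [p hp] := Af a (b - a); have [q hq] := Ag a (b - a).
have p0 : p != 0.
  by apply: contra_neq fa => p0; have := hp 0; rewrite scale0r addr0 p0 horner0.
have q0 : q != 0.
  apply: contra_neq gb => q0; have := hq 1; rewrite scale1r addrC subrK q0 horner0.
  by [].
have [t ht] := closed_nonrootP _ (mulf_neq0 p0 q0).
exists (a + t *: (b - a)); split=> //; rewrite ?hp ?hq.
  by apply: contra ht; rewrite rootM /root => ->.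
by apply: contra ht; rewrite rootM /root orbC => ->.
Qed.

Definition poly_fun m (f : 'rV[C]_m -> C) := exists P : {mpoly C[m]}, forall x, f x = ev P x.

Lemma poly_fun_subalgebra m : subalgebra (@poly_fun m).
Proof.
split=> [f g fg [P hP]|c|f g [P hP] [Q hQ]|f g [P hP] [Q hQ]].
- by exists P => x; rewrite -fg.
- by exists c%:MP => x; rewrite evC.
- by exists (P + Q) => x; rewrite evD hP hQ.
- by exists (P * Q) => x; rewrite evM hP hQ.
Qed.

Lemma poly_fun_coord m i : @poly_fun m (fun x => x ord0 i).
Proof. by exists 'X_i => x; rewrite evX. Qed.

Lemma poly_fun_irreducible N d (F : {mpoly C[N.+3]}) :
  F \is d.-homog -> (0 < d)%N -> smooth_hypersurface F ->
  irreducible_for (hypersurface F) (@poly_fun N.+3).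
Proof.
move=> hF d0 sF f g a b [P hP] [Q hQ] [a0 Fa] [b0 Fb] fa gb; apply: contrapT => H.
have [|h|h] := @hypersurface_irreducible C N d F hF d0 sF P Q.
- move=> v v0 Fv; apply/eqP/negPn/negP; rewrite mulf_eq0 negb_or => /andP[Pv Qv].
  by apply: H; exists v; rewrite hP hQ.
- by move: fa; rewrite hP h ?eqxx.
- by move: gb; rewrite hQ h ?eqxx.
Qed.

End Irreducible.

(** * Polynomials in a point and a frame *)

Section TwoVariables.
Variables (C : closedFieldType) (q N : nat).
Local Notation Rw := {mpoly C[q]}.

(** The frame enters through the coefficients, so that homogeneity refers to the point [y] alone. *)
Definition ev2 (w : 'rV[C]_q) (y : 'rV[C]_N) : {mpoly Rw[N]} -> C :=
  mmap (evpt w) (fun i => y ord0 i).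
HB.instance Definition _ w y := GRing.RMorphism.copy (ev2 w y) (ev2 w y).

Lemma ev2C w y c : ev2 w y c%:MP = ev c w.
Proof. by rewrite /ev2 mmapC. Qed.

Lemma ev2X w y i : ev2 w y 'X_i = y ord0 i.
Proof. by rewrite /ev2 mmapX mmap1U. Qed.

Definition mconst : {mpoly C[N]} -> {mpoly Rw[N]} := map_mpoly (@mpolyC q C).
HB.instance Definition _ := GRing.RMorphism.copy mconst mconst.

Lemma ev2_const w y P : ev2 w y (mconst P) = ev P y.
Proof.
apply: (mpoly_morph_ext (f := ev2 w y \o mconst) (g := evpt y)) => [c|i] /=.
  by rewrite /mconst map_mpolyC ev2C /evpt !evC.
by rewrite /mconst map_mpolyX ev2X /evpt evX.
Qed.

Lemma mconst_homog e P : P \is e.-homog -> mconst P \is e.-homog.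
Proof.
move=> hP; apply/dhomogP => b; rewrite mcoeff_msupp mcoeff_map_mpoly /= mpolyC_eq0.
by rewrite -mcoeff_msupp => /(dhomog_mf hP).
Qed.

Lemma ev2_spec w y P : ev2 w y P = ev (map_mpoly (evpt w) P) y.
Proof.
apply: (mpoly_morph_ext (f := ev2 w y) (g := evpt y \o map_mpoly (evpt w))) => [c|i] /=.
  by rewrite map_mpolyC /evpt evC ev2C.
by rewrite map_mpolyX ev2X /evpt evX.
Qed.

Lemma subalg_ev2 T (A : (T -> C) -> Prop) (AP : subalgebra A)
    (w : T -> 'rV[C]_q) (y : T -> 'rV[C]_N) P :
  (forall i, A (fun t => w t ord0 i)) -> (forall i, A (fun t => y t ord0 i)) ->
  A (fun t => ev2 (w t) (y t) P).
Proof.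
move=> Aw Ay; elim/mpoly_ind_ring: P => [c|i|P Q hP hQ|P Q hP hQ].
- apply: (subalg_ext AP _ (subalg_ev AP c Aw)) => t; by rewrite ev2C.
- by apply: (subalg_ext AP _ (Ay i)) => t; rewrite ev2X.
- by apply: (subalg_ext AP _ (subalg_add AP hP hQ)) => t; rewrite rmorphD.
- by apply: (subalg_ext AP _ (subalg_mul AP hP hQ)) => t; rewrite rmorphM.
Qed.

End TwoVariables.

(** The divided difference, written in coefficients so that it has a value on the diagonal, where it
    is the derivative. *)
Definition divdiff (R : comNzRingType) (q : {poly R}) (a b : R) :=
  \sum_(j < size q) q`_j * \sum_(i < j) a ^+ (j.-1 - i) * b ^+ i.

Lemma divdiffE (R : comNzRingType) (q : {poly R}) (a b : R) :
  (a - b) * divdiff q a b = q.[a] - q.[b].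
Proof.
rewrite /divdiff mulr_sumr !horner_coef -sumrB; apply: eq_bigr => j _.
by rewrite mulrCA -mulrBr subrXX.
Qed.

Lemma divdiff_diag (R : comNzRingType) (q : {poly R}) a : divdiff q a a = q^`().[a].
Proof.
rewrite /divdiff (horner_coef_wide _ (_ : size q^`() <= (size q).-1)%N); last first.
  by rewrite size_poly.
case: (size q) => [|s]; first by rewrite !big_ord0.
rewrite big_ord_recl big_ord0 mulr0 add0r; apply: eq_bigr => j _.
rewrite coef_deriv lift0 mulrnAl -mulrnAr; congr (_ * _).
rewrite (eq_bigr (fun=> a ^+ j)) => [|i _]; first by rewrite sumr_const card_ord.
by rewrite -exprD subnK // -ltnS; exact: ltn_ord.
Qed.

Lemma divdiff_wide (R : comNzRingType) (q : {poly R}) n a b : (size q <= n)%N ->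
  divdiff q a b = \sum_(j < n) q`_j * \sum_(i < j) a ^+ (j.-1 - i) * b ^+ i.
Proof.
move=> qn; rewrite /divdiff.
rewrite (big_ord_widen n (fun j => q`_j * \sum_(i < j) a ^+ (j.-1 - i) * b ^+ i)) //.
rewrite big_mkcond; apply: eq_bigr => j _; case: ltnP => // hj.
by rewrite nth_default // mul0r.
Qed.

(** * Integrality of [phi] and comparison of base points *)

Section Constancy.
Variables (C : closedFieldType) (p d : nat).
Local Notation N := (p.+3).
Variables (F : {mpoly C[N]}).
Hypothesis char0 : forall k, (k.+1)%:R != 0 :> C.
Hypotheses (hF : F \is d.+2.-homog) (smooth : smooth_hypersurface F).

Definition tangent_frame (y : 'rV[C]_N) (w : 'M[C]_(p, N)) :=
  [/\ y != 0, ev F y = 0 & forall i, dev F y (row i w) = 0].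

Variable phi : 'rV[C]_N -> 'M[C]_(p, N) -> C.

Local Notation Rw := {mpoly C[p * N]}.

(** [Q] is a denominator of [phi]. It is meant to have the degree [e] of [P] as well, since [phi]
    has degree 0 in the point. *)
Definition good e (Q : {mpoly C[N]}) := exists2 P : {mpoly Rw[N]}, P \is e.-homog &
  forall y w, tangent_frame y w -> ev Q y * phi y w = ev2 (mxvec w) y P.

Hypothesis phi_local : forall x, x != 0 -> ev F x = 0 ->
  exists e Q, [/\ Q \is e.-homog, ev Q x != 0 & good e Q].

Lemma good_add e Q Q' : good e Q -> good e Q' -> good e (Q + Q').
Proof.
move=> [P hP e1] [P' hP' e2]; exists (P + P'); first exact: rpredD.
by move=> y w Zyw; rewrite evD mulrDl e1 // e2 // rmorphD.
Qed.

Lemma good_mul e k A Q : A \is k.-homog -> good e Q -> good (k + e) (A * Q).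
Proof.
move=> hA [P hP e1]; exists (mconst (p * N) A * P).
  by apply: dhomogM => //; exact: mconst_homog.
by move=> y w Zyw; rewrite evM -mulrA e1 // rmorphM /= ev2_const.
Qed.

Lemma good_vanish e Q : (forall y, y != 0 -> ev F y = 0 -> ev Q y = 0) -> good e Q.
Proof.
move=> H; exists 0; first exact: rpred0.
by move=> y w [y0 Fy _]; rewrite H // mul0r rmorph0.
Qed.

(** The local denominators have no common zero on [X], so by the Nullstellensatz they generate,
    together with [F], all forms of some large degree; homogeneous parts of the relations are again
    of the required shape. *)
Lemma good_all : exists E, forall A, A \is E.-homog -> good E A.
Proof.
pose S Q := Q = F \/ exists2 e, Q \is e.-homog & good e Q.
have H j : exists M, ideal S ('X_j ^+ M).
  apply: strong_nullstellensatz => v hv; rewrite evX.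
  have [->|v0] := eqVneq v 0; first by rewrite mxE.
  have [e [Q [hQ Qv gQ]]] := phi_local v0 (hv F (or_introl erefl)).
  by move: Qv; rewrite hv ?eqxx //; right; exists e.
have graded g e : ideal S g -> good e (pihomog mdeg e g).
  elim=> [|a x y Sx _ IH]; first by rewrite raddf0; apply: good_vanish => y *; exact: ev0.
  rewrite raddfD; apply: good_add => //.
  case: Sx => [->|[k hx gx]].
    rewrite /= (pihomog_mulr _ _ hF); apply: good_vanish => v v0 Fv.
    by case: ifP => _; rewrite ?ev0 // evM Fv mulr0.
  rewrite /= (pihomog_mulr _ _ hx); case: ifP => ke; last first.
    by apply: good_vanish => v *; exact: ev0.
  by rewrite -{1}(subnK ke); apply: good_mul => //; exact: pihomogP.
pose M j := sval (cid (H j)); pose M0 := (\sum_j M j)%N.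
have HM j : good M0 ('X_j ^+ M0).
  rewrite -(@pihomog_dE _ _ mdeg M0 ('X_j ^+ M0)); last first.
    by rewrite mpolyXn dhomogX /= mdegMn mdeg1 mul1n.
  apply: graded; rewrite /M0 (bigD1 j) //= exprD; apply: ideal_mulr.
  exact: svalP (cid (H j)).
have HX b : mdeg b = (N * M0)%N -> good (N * M0) 'X_[b].
  move=> bM; have [j bj] : exists j, (M0 <= b j)%N by apply: mnm_pigeonhole; rewrite ?bM.
  rewrite (mpolyX_split C bj) mulrC.
  have -> : (N * M0)%N = (mdeg (b - U_(j) *+ M0) + M0)%N.
    rewrite -bM -[in LHS](submK (_ : U_(j) *+ M0 <= b)%MM) ?mdegD ?mdegMn ?mdeg1 ?mul1n //.
    by apply/mnm_lepP => i; rewrite mulmnE mnm1E; case: eqP => [<-|_]; rewrite ?mul1n.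
  by apply: good_mul; rewrite ?dhomogX.
exists (N * M0)%N => A hA; rewrite (mpolyE A) big_seq; elim/big_rec: _ => [|b Q bA gQ].
  by apply: good_vanish => v *; exact: ev0.
apply: good_add => //; rewrite -mul_mpolyC -[(N * M0)%N]add0n.
apply: good_mul; last by apply: HX; exact: (dhomog_mf hA bA).
by rewrite -[_%:MP]mulr1 mul_mpolyC; apply: rpredZ; exact: dhomog1.
Qed.

Lemma ev2_coef e (P : {mpoly Rw[N]}) w y : P \is e.-homog ->
  ev2 w y P = \sum_(b : 'X_{1..N < e.+1} | mdeg b == e) ev (P@_b) w * ev 'X_[b] y.
Proof.
move=> hP; have sP : (msize P <= e.+1)%N.
  have [->|P0] := eqVneq P 0; first by rewrite msize0.
  by rewrite -mlead_deg // ltnS; have := dhomog_mf hP (mlead_supp P0) => /= ->.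
rewrite /ev2 (mmapE _ sP) [in RHS]big_mkcond; apply: eq_bigr => b _.
case: eqP => be; first by rewrite /ev mevalX.
by rewrite (dhomog_nemf_coeff hP) /= ?rmorph0 ?mul0r //; exact/eqP.
Qed.

(* Multiplication by [phi] acts on the forms of large degree in [x], hence [phi] is
   a root of a characteristic polynomial with coefficients depending on [w] only. *)
Lemma integral_equation : exists2 chi : {poly Rw}, chi \is monic &
  forall y w, tangent_frame y w -> root (map_poly (evpt (mxvec w)) chi) (phi y w).
Proof.
have [E gE] := good_all; pose B : finType := 'X_{1..N < E.+1}.
have exP (b : B) : exists P : {mpoly Rw[N]}, if mdeg b == E then P \is E.-homog /\
    forall y w, tangent_frame y w -> ev 'X_[b] y * phi y w = ev2 (mxvec w) y P else P = 0.
  case bE: (mdeg b == E); last by exists 0.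
  by have [|P hP e] := gE 'X_[b]; [rewrite dhomogX|exists P].
pose Pb b := sval (cid (exP b)).
have PbP (b : B) : if mdeg b == E then Pb b \is E.-homog /\
    forall y w, tangent_frame y w -> ev 'X_[b] y * phi y w = ev2 (mxvec w) y (Pb b)
    else Pb b = 0 by exact: svalP (cid (exP b)).
pose Mx : 'M[Rw]_#|B| := \matrix_(j, i) (Pb (enum_val i))@_(bmnm (enum_val j : B)).
exists (char_poly Mx) => [|y w Zyw]; first exact: char_poly_monic.
rewrite map_char_poly -eigenvalue_root_char; apply/eigenvalueP.
(* The values at [y] of the monomials of degree [E] form an eigenvector with eigenvalue
   [phi y w]. *)
pose v : 'rV[C]_#|B| := \row_i (if mdeg (enum_val i : B) == E then ev 'X_[bmnm (enum_val i : B)] y else 0).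
exists v; last first.
  have [y0 _ _] := Zyw; have [j yj] : exists j, y ord0 j != 0.
    apply/existsP; apply: contraR y0; rewrite negb_exists => /forallP h.
    by apply/eqP/rowP => j; rewrite mxE; apply/eqP; move: (h j); rewrite negbK.
  have bE : (mdeg (U_(j) *+ E) < E.+1)%N by rewrite mdegMn mdeg1 mul1n.
  apply: contra_neq (expf_neq0 E yj) => /rowP/(_ (enum_rank (BMultinom bE : B))).
  by rewrite !mxE enum_rankK /= mdegMn mdeg1 mul1n eqxx -mpolyXn evXn evX.
apply/rowP => i; rewrite !mxE.
have := PbP (enum_val i); case: ifP => [iE [hP e]|iE P0]; last first.
  by rewrite mulr0 big1 // => j _; rewrite !mxE P0 mcoeff0 /= rmorph0 mulr0.
rewrite mulrC e // (ev2_coef _ _ hP) [RHS]big_mkcond [RHS](reindex_onto enum_val enum_rank) => [|b _]; last first.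
  by rewrite enum_rankK.
rewrite [RHS](eq_bigl xpredT) => [|j]; last by rewrite enum_valK eqxx.
by apply: eq_bigr => j _; rewrite !mxE; case: ifP => _; rewrite ?mul0r // mulrC.
Qed.

(** In a monic equation of least degree, the derivative divided by the degree is monic of smaller
    degree, so [phi] does not satisfy it identically. The given frame excludes the equation
    [1 = 0]. *)
Lemma separable_equation y0 w0 : tangent_frame y0 w0 -> exists2 chi : {poly Rw},
  forall y w, tangent_frame y w -> root (map_poly (evpt (mxvec w)) chi) (phi y w) &
  exists x w, tangent_frame x w /\ ((map_poly (evpt (mxvec w)) chi)^`()).[phi x w] != 0.
Proof.
move=> Z0; pose ann (chi : {poly Rw}) := chi \is monic /\
  forall y w, tangent_frame y w -> root (map_poly (evpt (mxvec w)) chi) (phi y w).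
have [chi0 m0 r0] := integral_equation.
have [chi [[mc rc] minc]] : exists chi, ann chi /\
    forall chi', ann chi' -> (size chi <= size chi')%N.
  have ex : exists k, `[< exists2 chi, ann chi & size chi = k >].
    by exists (size chi0); apply/asboolP; exists chi0.
  case: (ex_minnP ex) => k /asboolP[chi ac <-] h; exists chi; split=> // chi' ac'.
  by apply: h; apply/asboolP; exists chi'.
exists chi => //; apply: contrapT => H.
have s1 : (1 < size chi)%N.
  rewrite ltnNge; apply/negP => s1; have cC := size1_polyC s1.
  have c1 : chi = 1.
    by rewrite cC; congr (_%:P); have := monicP mc; rewrite {1}cC lead_coefC.
  by have := rc _ _ Z0; rewrite c1 rmorph1 /root hornerC oner_eq0.
case sE : (size chi) s1 => [|[|k]] // _.
pose c : Rw := ((k.+1)%:R^-1 : C)%:MP.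
pose chi' := c *: chi^`().
have c1 : c * (k.+1)%:R = 1.
  by rewrite /c -(mpolyC_nat (p * N) C k.+1) -mpolyCM mulVf ?mpolyC1.
have cf : chi'`_k = 1.
  have ck : chi`_k.+1 = 1 by rewrite -(monicP mc) lead_coefE sE.
  by rewrite coefZ coef_deriv ck.
have s' : (size chi' <= k.+1)%N.
  by rewrite (leq_trans (size_scale_leq _ _)) // (leq_trans (size_poly _ _)) // sE.
have s'' : size chi' = k.+1.
  apply/eqP; rewrite eqn_leq s' ltnNge; apply/negP => h.
  by move: cf; rewrite nth_default // => /eqP; rewrite eq_sym oner_eq0.
have : ann chi'.
  split=> [|y w Zyw]; first by rewrite monicE lead_coefE s'' /= cf.
  rewrite /root /chi' -mul_polyC rmorphM /= map_polyC hornerM mulf_eq0; apply/orP; right.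
  rewrite -deriv_map; apply/negPn/negP => h; apply: H; exists y, w; split=> //.
by move=> /minc; rewrite s'' sE ltnn.
Qed.

Definition linear_form (l : 'rV[C]_N) : {mpoly C[N]} := \sum_i l ord0 i *: 'X_i.

Lemma ev_linear_form l x : ev (linear_form l) x = \sum_i l ord0 i * x ord0 i.
Proof. by rewrite /linear_form ev_sum; apply: eq_bigr => i _; rewrite evZ evX. Qed.

Lemma linear_form_homog l : linear_form l \is 1.-homog.
Proof. by apply: rpred_sum => i _; apply: rpredZ; exact: mpolyX_homog1. Qed.

(** The pairing of [l] and [x] is symmetric, so it suffices to find a point [l] outside the zeros of
    the product of the [linear_form x]. *)
Lemma linear_form_neq0 (s : seq 'rV[C]_N) : (forall x, x \in s -> x != 0) ->
  exists l, forall x, x \in s -> ev (linear_form l) x != 0.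
Proof.
move=> s0; pose P := \prod_(x <- s) linear_form x.
have P0 : P != 0.
  rewrite /P prodf_seq_neq0; apply/allP => x xs /=.
  have [j xj] : exists j, x ord0 j != 0.
    apply/existsP; apply: contraR (s0 x xs); rewrite negb_exists => /forallP h.
    by apply/eqP/rowP => j; rewrite mxE; apply/eqP; move: (h j); rewrite negbK.
  apply: contra_neq xj => /(congr1 (fun P => ev P (delta_mx ord0 j))).
  rewrite ev0 ev_linear_form (bigD1 j) //= mxE !eqxx mulr1 big1 ?addr0 // => i ij.
  by rewrite mxE (negPf ij) andbF mulr0.
have [l] := mpoly_nonroot P0; rewrite ev_prod prodf_seq_neq0 => /allP h.
exists l => x xs; have := h x xs; rewrite /= !ev_linear_form.
by under eq_bigr do rewrite mulrC.
Qed.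

(** The conditions [F = 0], [l = 1] and tangency of the [p] rows are [p + 2] equations in [p + 3]
    coordinates. So there are infinitely many solutions off the zeros of [Q], whose value at [x0] is
    the derivative of [chi], and only finitely many of them are parallel to [x0]. *)
Lemma second_point chi x0 w0 : tangent_frame x0 w0 ->
  ((map_poly (evpt (mxvec w0)) chi)^`()).[phi x0 w0] != 0 ->
  exists x1, [/\ tangent_frame x1 w0, nonparallel F x0 x1 &
    divdiff (map_poly (evpt (mxvec w0)) chi) (phi x0 w0) (phi x1 w0) != 0].
Proof.
set q := map_poly _ chi => Z0 q0; have [x00 Fx0 w0x0] := Z0.
have [l lx0] : exists l, ev (linear_form l) x0 = 1.
  have [x xs|l0 hl] := @linear_form_neq0 [:: x0]; first by move: xs; rewrite inE => /eqP ->.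
  have := hl _ (mem_head _ _); rewrite ev_linear_form => l0x.
  exists ((\sum_i l0 ord0 i * x0 ord0 i)^-1 *: l0).
  rewrite ev_linear_form; under eq_bigr do rewrite mxE -mulrA.
  by rewrite -mulr_sumr mulVf.
have [E gE] := good_all.
have [|P _ eP] := gE (linear_form l ^+ E).
  by have := dhomogMn E (linear_form_homog l); rewrite mul1n.
(* On [l = 1] the denominator is 1, and [phi] is given by the polynomial [Pw]. *)
pose Pw := map_mpoly (evpt (mxvec w0)) P.
have PwE y : tangent_frame y w0 -> ev (linear_form l) y = 1 -> ev Pw y = phi y w0.
  by move=> Zy ly; rewrite /Pw -ev2_spec -eP // evXn ly expr1n mul1r.
pose Q := \sum_(j < size q) (q`_j)%:MP *
  \sum_(i < j) ((phi x0 w0)%:MP ^+ (j.-1 - i) * Pw ^+ i).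
have QE y : ev Q y = divdiff q (phi x0 w0) (ev Pw y).
  rewrite ev_sum; apply: eq_bigr => j _; rewrite evM evC ev_sum; congr (_ * _).
  by apply: eq_bigr => i _; rewrite evM !evXn evC.
pose f (i : 'I_(1 + (1 + p))) : {mpoly C[N]} := match fintype.split i with
  | inl _ => F
  | inr j => match fintype.split j with
    | inl _ => linear_form l - 1
    | inr k => \sum_c w0 k c *: F^`M(c)
    end
  end.
have fk k y : ev (\sum_c w0 k c *: F^`M(c)) y = dev F y (row k w0).
  by rewrite ev_sum; apply: eq_bigr => c _; rewrite evZ mxE.
have [s Hs] := parallel_finite (ltn0Sn _) hF (char0 d.+1) smooth l x00 Fx0.
have [|i||x1 [x1s fx1 Qx1]] := @zeros_infinite C N (1 + (1 + p)) f Q x0 s.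
- exact: leqnn.
- rewrite /f; case: fintype.split => // j; case: fintype.split => [_|k]; first by rewrite evB lx0 ev1 subrr.
  by rewrite fk.
- by rewrite QE PwE // divdiff_diag.
have Fx1 : ev F x1 = 0 by have := fx1 (unsplit (inl ord0)); rewrite /f unsplitK.
have lx1 : ev (linear_form l) x1 = 1.
  have := fx1 (unsplit (inr (unsplit (inl ord0)))); rewrite /f !unsplitK evB ev1.
  by move=> /eqP; rewrite subr_eq0 => /eqP.
have wx1 k : dev F x1 (row k w0) = 0.
  by have := fx1 (unsplit (inr (unsplit (inr k)))); rewrite /f !unsplitK fk.
have x10 : x1 != 0.
  apply: contra_eq_neq lx1 => ->; rewrite ev_linear_form big1 ?(eq_sym 0) ?oner_neq0 //.
  by move=> i _; rewrite mxE mulr0.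
have Z1 : tangent_frame x1 w0 by split.
exists x1; split=> //; last by rewrite -(PwE _ Z1 lx1) -QE.
apply: contrapT => np; move: x1s; rewrite (Hs x1) //.
by rewrite mxE -[RHS]lx1 ev_linear_form; apply: eq_bigr => i _; rewrite mxE.
Qed.

(** Cramer's rule: the rows of [u], multiplied by a minor of the two differentials, are corrected by
    [e1] and [e2] to lie in both kernels. The parameters [e1], [e2], [u] range over a vector space
    that does not depend on [x] and [x']. *)
Definition frame_of (x x' e1 e2 : 'rV[C]_N) (u : 'M[C]_(p, N)) : 'M[C]_(p, N) :=
  \matrix_k ((dev F x e1 * dev F x' e2 - dev F x e2 * dev F x' e1) *: row k u
    - (dev F x (row k u) * dev F x' e2 - dev F x' (row k u) * dev F x e2) *: e1
    - (dev F x e1 * dev F x' (row k u) - dev F x' e1 * dev F x (row k u)) *: e2).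

Lemma frame_of_tangent x x' e1 e2 u i :
  dev F x (row i (frame_of x x' e1 e2 u)) = 0 /\
  dev F x' (row i (frame_of x x' e1 e2 u)) = 0.
Proof. by rewrite /frame_of rowK !devBr !devZr; split; ring. Qed.

Lemma frame_of_id x x' e1 e2 u :
  (forall i, dev F x (row i u) = 0) -> (forall i, dev F x' (row i u) = 0) ->
  frame_of x x' e1 e2 u = (dev F x e1 * dev F x' e2 - dev F x e2 * dev F x' e1) *: u.
Proof.
move=> h h'; apply/row_matrixP => i; rewrite rowK h h' !mul0r !mulr0 !subrr !scale0r.
by rewrite !subr0 linearZ.
Qed.

Section FrameAlgebra.
Variables (T : Type) (A : (T -> C) -> Prop) (AP : subalgebra A).
Variables (x x' e1 e2 : T -> 'rV[C]_N) (u : T -> 'M[C]_(p, N)).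
Hypotheses (Ax : forall i, A (fun t => x t ord0 i)) (Ax' : forall i, A (fun t => x' t ord0 i)).
Hypotheses (Ae1 : forall i, A (fun t => e1 t ord0 i)) (Ae2 : forall i, A (fun t => e2 t ord0 i)).
Hypothesis (Au : forall k i, A (fun t => u t k i)).

Lemma frame_of_algebra k :
  A (fun t => mxvec (frame_of (x t) (x' t) (e1 t) (e2 t) (u t)) ord0 k).
Proof.
case/mxvec_indexP: k => i j.
have Aui k : A (fun t => row i (u t) ord0 k).
  by apply: (subalg_ext AP _ (Au i k)) => t; rewrite mxE.
have Adev (y v : T -> 'rV[C]_N) : (forall i, A (fun t => y t ord0 i)) -> (forall i, A (fun t => v t ord0 i)) ->
   A (fun t => dev F (y t) (v t)) by exact: subalg_dev.
have Adet (a b c e : T -> C) : A a -> A b -> A c -> A e -> A (fun t => a t * b t - c t * e t).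
  by move=> *; apply: (subalg_sub AP); apply: (subalg_mul AP).
apply: (subalg_ext AP (f := fun t =>
  (dev F (x t) (e1 t) * dev F (x' t) (e2 t) - dev F (x t) (e2 t) * dev F (x' t) (e1 t))
    * u t i j
  - (dev F (x t) (row i (u t)) * dev F (x' t) (e2 t)
     - dev F (x' t) (row i (u t)) * dev F (x t) (e2 t)) * e1 t ord0 j
  - (dev F (x t) (e1 t) * dev F (x' t) (row i (u t))
     - dev F (x' t) (e1 t) * dev F (x t) (row i (u t))) * e2 t ord0 j)) => [t|].
  by rewrite mxvecE !mxE.
by apply: (subalg_sub AP); [apply: (subalg_sub AP)|]; apply: (subalg_mul AP) => //;
  apply: Adet; apply: Adev.
Qed.

End FrameAlgebra.

(** [frame_of] is tangent at both points even if the differentials are parallel, so the whole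
    product of [X], [X] and [V] serves as irreducible parameter space. There [f] and [g] are the
    difference of the two values and the divided difference of [chi], cleared of denominators, and
    their product is zero. *)
Lemma frames_agree x x' w : tangent_frame x w -> tangent_frame x' w ->
  nonparallel F x x' -> phi x w = phi x' w.
Proof.
move=> Zx Zx' [e1 [e2 D0]].
have [chi rchi [y0 [w0 [Z0 chi0]]]] := separable_equation Zx.
have [y1 [Z1 [g1 [g2 D1]] dd]] := second_point Z0 chi0.
have [x_0 Fx wx] := Zx; have [x'_0 Fx' wx'] := Zx'.
have [y0_0 Fy0 wy0] := Z0; have [y1_0 Fy1 wy1] := Z1.
have [y ys|l hl] := @linear_form_neq0 [:: x; x'; y0; y1].
  by move: ys; rewrite !inE => /or4P[]/eqP ->.
have [E gE] := good_all; pose L := linear_form l ^+ E.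
have [|P _ eP] := gE L.
  by have := dhomogMn E (linear_form_homog l); rewrite mul1n.
have L0 y : y \in [:: x; x'; y0; y1] -> ev L y != 0.
  by move=> /hl ly; rewrite /L evXn expf_neq0.
pose V : lmodType C := ('rV[C]_N * 'rV[C]_N * 'M[C]_(p, N))%type.
pose T := ('rV[C]_N * ('rV[C]_N * V))%type.
pose W (t : T) := frame_of t.1 t.2.1 t.2.2.1.1 t.2.2.1.2 t.2.2.2.
pose n := size chi.
pose f (t : T) := ev2 (mxvec (W t)) t.1 P * ev L t.2.1 - ev2 (mxvec (W t)) t.2.1 P * ev L t.1.
(* Each term is completed so as to carry the same factor [L ^+ n] for both points. *)
pose g (t : T) := \sum_(j < n) ev chi`_j (mxvec (W t)) * \sum_(i < j)
  (ev2 (mxvec (W t)) t.1 P ^+ (j.-1 - i) * ev2 (mxvec (W t)) t.2.1 P ^+ i *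
   (ev L t.1 ^+ (n - (j.-1 - i)) * ev L t.2.1 ^+ (n - i))).
have fgA T' (A : (T' -> C) -> Prop) (AP : subalgebra A) (h : T' -> T) :
  (forall i, A (fun t => (h t).1 ord0 i)) -> (forall i, A (fun t => (h t).2.1 ord0 i)) ->
  (forall i, A (fun t => (h t).2.2.1.1 ord0 i)) -> (forall i, A (fun t => (h t).2.2.1.2 ord0 i)) ->
  (forall k i, A (fun t => (h t).2.2.2 k i)) ->
  A (fun t => f (h t)) /\ A (fun t => g (h t)).
  move=> h1 h2 h3 h4 h5; have hW := frame_of_algebra AP h1 h2 h3 h4 h5.
  have e1A := subalg_ev2 AP P hW h1; have e2A := subalg_ev2 AP P hW h2.
  have L1 := subalg_ev AP L h1; have L2 := subalg_ev AP L h2.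
  split; first by apply: (subalg_sub AP); apply: (subalg_mul AP).
  apply: (subalg_sum AP) => j _; apply: (subalg_mul AP); first exact: (subalg_ev AP chi`_j hW).
  apply: (subalg_sum AP) => i _; apply: (subalg_mul AP); apply: (subalg_mul AP);
    exact: subalg_exp.
pose D (t : T) := hypersurface F t.1 /\ (hypersurface F t.2.1 /\ True).
have irrX := @poly_fun_irreducible C p d.+2 F hF isT smooth.
have irr := irreducible_prod irrX (irreducible_prod irrX (@line_poly_irreducible C V)).
have PA := poly_fun_subalgebra C N; have LA := line_poly_subalgebra V.
have Pc := @poly_fun_coord C N.
have fgP : (forall y, poly_fun (fun x => f (x, y)) /\ poly_fun (fun x => g (x, y))) /\
    forall x, (forall y, poly_fun (fun x' => f (x, (x', y))) /\ poly_fun (fun x' => g (x, (x', y))))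
     /\ forall x', line_poly (fun e => f (x, (x', e))) /\ line_poly (fun e => g (x, (x', e))).
  split=> [b|a]; first by apply: (fgA _ _ PA (fun x => (x, b))) => *; first [exact: Pc | exact: (subalg_cst PA)].
  split=> b.
    by apply: (fgA _ _ PA (fun x' => (a, (x', b)))) => *; first [exact: Pc | exact: (subalg_cst PA)].
  apply: (fgA _ _ LA (fun e => (a, (b, e)))) => *; first [exact: (subalg_cst LA)
    | by apply: line_poly_linear => u t v; rewrite !mxE].
apply/eqP/negPn/negP => ne.
(* [frame_of] multiplies a frame tangent at both points by the minor, whence the inverse minor. *)
pose t0 : T := (x, (x', (e1, e2, (dev F x e1 * dev F x' e2 - dev F x e2 * dev F x' e1)^-1 *: w))).
pose t1 : T := (y0, (y1, (g1, g2, (dev F y0 g1 * dev F y1 g2 - dev F y0 g2 * dev F y1 g1)^-1 *: w0))).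
have Wt0 : W t0 = w.
  rewrite /W /= frame_of_id => [|i|i]; try by rewrite linearZ devZr ?wx ?wx' mulr0.
  by rewrite scalerA divff // scale1r.
have Wt1 : W t1 = w0.
  rewrite /W /= frame_of_id => [|i|i]; try by rewrite linearZ devZr ?wy0 ?wy1 mulr0.
  by rewrite scalerA divff // scale1r.
have fE t : tangent_frame t.1 (W t) -> tangent_frame t.2.1 (W t) ->
    f t = ev L t.1 * ev L t.2.1 * (phi t.1 (W t) - phi t.2.1 (W t)).
  by move=> Zt Zt'; rewrite /f -!eP //; ring.
have gE' t : tangent_frame t.1 (W t) -> tangent_frame t.2.1 (W t) ->
    g t = ev L t.1 ^+ n * ev L t.2.1 ^+ n *
      divdiff (map_poly (evpt (mxvec (W t))) chi) (phi t.1 (W t)) (phi t.2.1 (W t)).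
  move=> Zt Zt'; rewrite /g (divdiff_wide _ _ (size_poly _ _)).
  rewrite mulr_sumr; apply: eq_bigr => j _; rewrite coef_map mulrCA; congr (_ * _).
  rewrite mulr_sumr; apply: eq_bigr => i _; rewrite -!eP //.
  have ij : (i < n)%N by apply: ltn_trans (ltn_ord i) (ltn_ord j).
  have jj : (j.-1 - i <= n)%N by rewrite (leq_trans (leq_subr _ _)) // (leq_trans (leq_pred _)) // ltnW.
  have x1 (c : C) : c ^+ n = c ^+ (n - (j.-1 - i)) * c ^+ (j.-1 - i) by rewrite -exprD subnK.
  have x2 (c : C) : c ^+ n = c ^+ (n - i) * c ^+ i by rewrite -exprD (subnK (ltnW ij)).
  by rewrite !exprMn (x1 (ev L t.1)) (x2 (ev L t.2.1)); ring.
have [||||||t [[[Xt Ft] [[Xt' Ft'] _]] ft gt]] := irr f g t0 t1.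
- split=> [y|a]; first by have [] := fgP.1 y.
  by split=> b; [have [] := (fgP.2 a).1 b | have [] := (fgP.2 a).2 b].
- split=> [y|a]; first by have [] := fgP.1 y.
  by split=> b; [have [] := (fgP.2 a).1 b | have [] := (fgP.2 a).2 b].
- by split; [|split].
- by split; [|split].
- by rewrite fE Wt0 // !mulf_neq0 ?subr_eq0 // L0 // !inE eqxx ?orbT.
- by rewrite gE' Wt1 // !mulf_neq0 ?expf_neq0 // L0 // !inE eqxx ?orbT.
have Zt : tangent_frame t.1 (W t) by split=> // i; have [] := frame_of_tangent t.1 t.2.1 t.2.2.1.1 t.2.2.1.2 t.2.2.2 i.
have Zt' : tangent_frame t.2.1 (W t) by split=> // i; have [] := frame_of_tangent t.1 t.2.1 t.2.2.1.1 t.2.2.1.2 t.2.2.2 i.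
move: ft gt; rewrite fE // gE' // !mulf_eq0 !negb_or => /andP[_ ab] /andP[_ kab].
have := divdiffE (map_poly (evpt (mxvec (W t))) chi) (phi t.1 (W t)) (phi t.2.1 (W t)).
rewrite (eqP (rchi _ _ Zt)) (eqP (rchi _ _ Zt')) subrr => /eqP.
by rewrite mulf_eq0 (negPf ab) (negPf kab).
Qed.

End Constancy.

(** * Vanishing *)

Section Derivation.
Variables (C : closedFieldType) (m : nat) (b : 'rV[C]_m).
Hypothesis char0 : forall k, (k.+1)%:R != 0 :> C.
Implicit Types P Q : {mpoly C[m]}.

Definition dder P : {mpoly C[m]} := \sum_i b ord0 i *: P^`M(i).

Lemma ev_dder P v : ev (dder P) v = dev P v b.
Proof. by rewrite ev_sum; apply: eq_bigr => i _; rewrite evZ. Qed.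

Lemma dderM P Q : dder (P * Q) = dder P * Q + P * dder Q.
Proof.
by apply: mpoly_ext => v; rewrite ev_dder devM evD !evM !ev_dder.
Qed.

Lemma dderX P k : dder (P ^+ k.+1) = (k.+1)%:R * P ^+ k * dder P.
Proof.
elim: k => [|k IH]; first by rewrite expr1 expr0 mulr1 mul1r.
rewrite exprS dderM IH -[in RHS](addn1 k.+1) natrD mulrDl mulrDl mul1r addrC.
by rewrite exprS [dder P * _]mulrC; congr (_ + _); rewrite !mulrA [P * _]mulrC.
Qed.

Lemma msize_dder P : P != 0 -> (msize (dder P) < msize P)%N.
Proof.
move=> P0; have [->|D0] := eqVneq (dder P) 0; first by rewrite msize0 lt0n msize_poly_eq0.
rewrite -(mlead_deg D0); have := mlead_supp D0; set k := mlead _.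
rewrite mcoeff_msupp raddf_sum /= => h.
have [i hi] : exists i, (b ord0 i *: P^`M(i))@_k != 0.
  apply/existsP; apply: contraR h; rewrite negb_exists => /forallP h.
  by rewrite big1 // => i _; apply/eqP; move: (h i); rewrite negbK.
have : (k + U_(i))%MM \in msupp P.
  rewrite mcoeff_msupp; apply: contraNneq hi => e.
  by rewrite mcoeffZ mcoeff_deriv e mul0rn mulr0.
by move=> /msize_mdeg_lt; rewrite mdegD mdeg1 addn1.
Qed.

(** [dder] lowers the degree, so a nonzero [dder Q] is no multiple of [Q]. *)
Lemma divides_dder Q : Q != 0 -> divides Q (dder Q) -> dder Q = 0.
Proof.
move=> Q0 [c cE]; apply/eqP/negPn/negP => D0; have := msize_dder Q0.
have c0 : c != 0 by apply: contra_neq D0 => c0; rewrite cE c0 mul0r.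
rewrite cE msizeM // ltnNge; case/negP.
by move: c0; rewrite -msize_poly_eq0; case: (msize c) => // n _; rewrite addSn leq_addl.
Qed.

(* A prime factor of a first integral of [dder] is again a first integral. *)
Lemma prime_first_integral Q P : prime_elt Q -> P != 0 -> dder P = 0 -> divides Q P ->
  dder Q = 0.
Proof.
move=> [Q0 Qu QM] P0 DP QP; apply: divides_dder => //.
have [k [h [PE Qh]]] : exists k h, P = Q ^+ k.+1 * h /\ ~ divides Q h.
  have [n] := ubnP (msize P); elim: n => // n IH in P P0 QP {DP} *; rewrite ltnS => Pn.
  have [c cE] := QP; have c0 : c != 0 by apply: contra_neq P0 => c0; rewrite cE c0 mul0r.
  have [Qc|Qc] := pselect (divides Q c); last by exists 0%N, c; rewrite expr1 mulrC.
  have [|k [h [cE' Qh]]] := IH c c0 Qc.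
    rewrite (leq_trans _ Pn) // cE msizeM //.
    have : (1 < msize Q)%N.
      rewrite ltnNge; apply: contra Qu => /msize1_polyC Qc'.
      by rewrite Qc' rmorph_unit // unitfE; apply: contraNneq Q0 => e; rewrite Qc' e mpolyC0.
    by case: (msize Q) => [|[|s]] // _; rewrite !addnS /= ltnS leq_addr.
  by exists k.+1, h; split=> //; rewrite cE cE' [in RHS]exprS mulrC mulrA.
move: DP; rewrite PE dderM dderX; set A := dder Q; set B := dder h.
rewrite (_ : _ + _ = Q ^+ k * ((k.+1)%:R * (A * h) + Q * B)); last first.
  by rewrite mulrDr exprSr -!mulrA; congr (_ + _); rewrite mulrCA.
move=> /eqP; rewrite mulf_eq0 expf_eq0 (negPf Q0) andbF /= addr_eq0 => /eqP e.
have : divides Q ((k.+1)%:R * (A * h)) by exists (- B); rewrite e mulNr mulrC.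
case/QM => [[c cE]|/QM[//|/Qh//]].
case/negP: Qu; apply/unitrPr; exists (((k.+1)%:R^-1)%:MP * c).
by rewrite mulrCA -[Q * c]mulrC -cE -(mpolyC_nat m C k.+1) -mpolyCM mulVf.
Qed.

End Derivation.

Lemma unit_dev (C : closedFieldType) m (u : {mpoly C[m]}) v w :
  u \is a GRing.unit -> dev u v w = 0.
Proof.
move=> uu; have u0 : u != 0 by apply: contraTneq uu => ->; rewrite unitr0.
have v0 : u^-1 != 0 by rewrite invr_eq0.
have := congr1 (fun p => msize p) (mulVr uu); rewrite msizeM // msize1.
have : (msize u <= 1)%N -> dev u v w = 0 by move=> /msize1_polyC ->; rewrite devC.
move: u0 v0; rewrite -!msize_poly_eq0.
case: (msize u) => [|[|s]]; case: (msize u^-1) => [|[|t]] //= _ _ h; try by move=> _; apply: h.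
by rewrite addnS.
Qed.

Lemma dev_prod0 (C : closedFieldType) m (s : seq {mpoly C[m]}) v w :
  (forall q, q \in s -> dev q v w = 0) -> dev (\prod_(q <- s) q) v w = 0.
Proof.
elim: s => [|q s IH] h; first by rewrite big_nil -(mpolyC1 m C) devC.
rewrite big_cons devM h ?mem_head // mul0r add0r IH ?mulr0 // => r rs.
by apply: h; rewrite inE rs orbT.
Qed.

Lemma dev_comp (C : closedFieldType) m m' (f : {mpoly C[m']}) (F : {mpoly C[m]})
    (tau : 'rV[C]_m' -> 'rV[C]_m) c b :
  (forall c, ev f c = ev F (tau c)) ->
  (forall t, tau (c + t *: b) = tau c + t *: tau b) -> dev f c b = dev F (tau c) (tau b).
Proof.
move=> fF taul; have e : line c b f = line (tau c) (tau b) F.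
  apply/eqP; rewrite -subr_eq0; apply/negPn/negP => /closed_nonrootP[t] /negP; apply.
  by rewrite /root hornerD hornerN !horner_line fF taul subrr.
have := deriv_line c b f 0; rewrite e deriv_line !scale0r !addr0.
by move=> ->.
Qed.

Lemma poly_fun_ext (C : closedFieldType) (P Q : {poly C}) :
  (forall t, P.[t] = Q.[t]) -> P = Q.
Proof.
move=> e; apply/eqP; rewrite -subr_eq0; apply/negPn/negP => /closed_nonrootP[t] /negP; apply.
by rewrite /root hornerD hornerN e subrr.
Qed.

Lemma dev_line_const (C : closedFieldType) m (P : {mpoly C[m]}) c b :
  (forall t, ev P (c + t *: b) = ev P c) -> dev P c b = 0.
Proof.
move=> h; have := deriv_line c b P 0; rewrite scale0r addr0 => <-.
have -> : line c b P = (ev P c)%:P by apply: poly_fun_ext => t; rewrite horner_line h hornerC.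
by rewrite derivC horner0.
Qed.

Lemma deriv0_const (C : closedFieldType) (P : {poly C}) : (forall k, (k.+1)%:R != 0 :> C) ->
  (forall t, P^`().[t] = 0) -> forall s t, P.[s] = P.[t].
Proof.
move=> char0 DP; have {}DP : P^`() = 0 by apply: poly_fun_ext => t; rewrite DP horner0.
suff /size1_polyC -> : (size P <= 1)%N by move=> s t; rewrite !hornerC.
apply/leq_sizeP => -[//|j] _; have := congr1 (fun p : {poly C} => p`_j) DP.
by rewrite coef_deriv coef0 -mulr_natr => /eqP; rewrite mulf_eq0 (negPf (char0 j)) orbF => /eqP.
Qed.

(** Taylor expansion modulo [t ^ 2] with a polynomial remainder; [polar_vanish] uses it to neglect
    the part of order two of a curve. *)
Lemma curve_expansion (C : closedFieldType) m (P : {mpoly C[m]}) (A B : 'I_m -> {poly C}) :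
  exists p r : {poly C}, forall t, ev P (\row_i (A i).[t]) = p.[t] /\
    ev P (\row_i ((A i).[t] + t ^+ 2 * (B i).[t])) = p.[t] + t ^+ 2 * r.[t].
Proof.
elim/mpoly_ind_ring: P => [c|i|P Q [p [r h]] [p' [r' h']]|P Q [p [r h]] [p' [r' h']]].
- by exists c%:P, 0 => t; rewrite !evC hornerC horner0 mulr0 addr0.
- by exists (A i), (B i) => t; rewrite !evX !mxE.
- exists (p + p'), (r + r') => t; have [e1 e2] := h t; have [e3 e4] := h' t.
  by rewrite !evD e1 e2 e3 e4 !hornerD mulrDr addrACA.
exists (p * p'), (p * r' + r * p' + 'X^2 * (r * r')) => t.
have [e1 e2] := h t; have [e3 e4] := h' t.
rewrite !evM e1 e2 e3 e4 !hornerD !hornerM ?hornerXn ?hornerX; split=> //; ring.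
Qed.

(** * Restriction of [F] to a tangent hyperplane *)

Section Vanishing.
Variables (C : closedFieldType) (q d : nat).
Local Notation N := (q.+4).
Variables (F : {mpoly C[N]}).
Hypothesis char0 : forall k, (k.+1)%:R != 0 :> C.
Hypotheses (hF : F \is d.+3.-homog) (smooth : smooth_hypersurface F).
Variable phi : 'rV[C]_N -> 'M[C]_(q.+1, N) -> C.
Local Notation frame := (@tangent_frame C q.+1 F).
Hypothesis phi_local : forall x : 'rV[C]_N, x != 0 -> ev F x = 0 ->
  exists e Q, [/\ Q \is e.-homog, ev Q x != 0 & @good C q.+1 F phi e Q].
Hypothesis phi_self : forall x w i, frame x w -> row i w = x -> phi x w = 0.
Hypothesis phi_shift : forall x w (c : 'cV_q.+1), frame x w -> phi x (w + c *m x) = phi x w.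

Lemma dev_self x : ev F x = 0 -> dev F x x = 0.
Proof. by move=> Fx; rewrite (dev_euler _ hF) Fx mulr0. Qed.

Lemma devZl t x y : dev F (t *: x) y = t ^+ d.+2 * dev F x y.
Proof.
rewrite /dev mulr_sumr; apply: eq_bigr => i _.
by rewrite (homog_evZ _ _ (dhomog_deriv i hF)) mulrCA.
Qed.

Lemma dev0l y : dev F 0 y = 0.
Proof. by rewrite -(scale0r 0) devZl expr0n mul0r. Qed.

(** Every vector is the sum of one in the kernel of dF(x) and a multiple of the basis vector [a], so
    dF(z) would be zero. *)
Lemma singular_along_tangent x z a : ev F^`M(a) x != 0 -> z != 0 -> ev F z = 0 ->
  ev F^`M(a) z = 0 -> ~ (forall y, dev F x y = 0 -> dev F z y = 0).
Proof.
move=> Fa z0 Fz Faz H; have [//|i] := smooth (v := z).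
apply/negP; rewrite negbK; apply/eqP.
have := H (delta_mx ord0 i - (ev F^`M(i) x / ev F^`M(a) x) *: delta_mx ord0 a).
by rewrite !devBr !devZr !dev_delta Faz mulr0 subr0 divfK // subrr; apply.
Qed.

(** Linear coordinates on the kernel of dF(x), solving for the coordinate [a]; the scaling by the
    [a]-th derivative avoids a division. *)
Definition tangent_param (x : 'rV[C]_N) (a : 'I_N) (c : 'rV[C]_q.+3) : 'rV[C]_N :=
  \row_i if unlift a i is Some j then ev F^`M(a) x * c ord0 j
         else - \sum_j ev F^`M(lift a j) x * c ord0 j.

Section Param.
Variables (x : 'rV[C]_N) (a : 'I_N).
Local Notation tau := (tangent_param x a).

Lemma tangent_param_dev c : dev F x (tau c) = 0.
Proof.
rewrite /dev (bigD1_ord a) //= mxE unlift_none mulNr addrC; apply/eqP; rewrite subr_eq0.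
apply/eqP; rewrite mulr_suml; apply: eq_bigr => j _.
by rewrite mxE liftK mulrC mulrA mulrAC.
Qed.

Lemma tangent_paramD c t b : tau (c + t *: b) = tau c + t *: tau b.
Proof.
apply/rowP => i; rewrite !mxE; case: unliftP => [j _|_].
  by rewrite !mxE mulrDr mulrCA.
rewrite mulrN -opprD mulr_sumr -big_split /=; congr (- _); apply: eq_bigr => j _.
by rewrite !mxE mulrDr mulrCA.
Qed.

Lemma tangent_paramZ t b : tau (t *: b) = t *: tau b.
Proof.
have := tangent_paramD 0 t b; rewrite add0r => ->.
suff -> : tau 0 = 0 by rewrite add0r.
apply/rowP => i; rewrite !mxE; case: unliftP => [j _|_]; first by rewrite !mxE mulr0.
by rewrite big1 ?oppr0 // => j _; rewrite mxE mulr0.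
Qed.

Hypothesis Fa : ev F^`M(a) x != 0.

Lemma tangent_param_onto z : dev F x z = 0 -> exists c, tau c = z.
Proof.
rewrite /dev (bigD1_ord a) //= => h; exists (\row_j (z ord0 (lift a j) / ev F^`M(a) x)).
apply/rowP => i; rewrite !mxE; case: unliftP => [j ->|->].
  by rewrite mxE mulrC divfK.
apply: (mulIf Fa); rewrite mulNr mulr_suml; apply/eqP; rewrite eq_sym -addr_eq0.
rewrite -[X in _ == X]h; apply/eqP; congr (_ + _); apply: eq_bigr => j _.
by rewrite mxE -mulrA divfK // mulrC.
Qed.

Lemma tangent_param_eq0 c : tau c = 0 -> c = 0.
Proof.
move=> e; apply/rowP => j; have := congr1 (fun v : 'rV__ => v ord0 (lift a j)) e.
by rewrite !mxE liftK => /eqP; rewrite mulf_eq0 (negPf Fa) => /eqP.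
Qed.

Lemma tangent_param_poly i : poly_fun (fun c => tau c ord0 i).
Proof.
have AP := @poly_fun_subalgebra C q.+3.
have [j ij|ij] := unliftP a i.
  have := subalg_mul AP (subalg_cst AP (ev F^`M(a) x)) (poly_fun_coord C j).
  by apply: (subalg_ext AP) => c; rewrite mxE ij liftK.
have := subalg_sub AP (subalg_cst AP 0) (subalg_sum AP (index_enum 'I_q.+3) (P := predT)
  (f := fun j c => ev F^`M(lift a j) x * c ord0 j) (fun j _ =>
  subalg_mul AP (subalg_cst AP _) (poly_fun_coord C j))).
by apply: (subalg_ext AP) => c; rewrite mxE ij unlift_none sub0r.
Qed.

End Param.

Definition set_row0 (w : 'M[C]_(q.+1, N)) (u : 'rV[C]_N) : 'M[C]_(q.+1, N) :=
  \matrix_(k, i) if k == ord0 then u ord0 i else w k i.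

Lemma row_set_row0 w u k : row k (set_row0 w u) = if k == ord0 then u else row k w.
Proof. by apply/rowP => i; rewrite !mxE; case: eqP => //; rewrite mxE. Qed.

Lemma row_shift (w : 'M[C]_(q.+1, N)) (c : 'cV_q.+1) (x : 'rV_N) k :
  row k (w + c *m x) = row k w + c k ord0 *: x.
Proof. by apply/rowP => i; rewrite !mxE big_ord1. Qed.

Lemma frame_set_row0 x w u : frame x w -> dev F x u = 0 -> frame x (set_row0 w u).
Proof.
by move=> [x0 Fx wx] ux; split=> // k; rewrite row_set_row0; case: ifP.
Qed.

(* Move the base point from [x] to [u] itself, where a row of the frame is the base point. *)
Lemma phi_vanish_at x w u : frame x w -> dev F x u = 0 -> ev F u = 0 -> dev F u x != 0 ->
  phi x (set_row0 w u) = 0.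
Proof.
move=> Z ux Fu D; have [x0 Fx wx] := Z; have [//|a Fa] := smooth (v := x).
have u0 : u != 0 by apply: contraNneq D => ->; rewrite dev0l.
have Zu := frame_set_row0 Z ux.
(* The multiples of [x] that make the rows tangent at [u]; row 0 is [u] already. *)
pose s : 'cV[C]_q.+1 := \col_k (if k == ord0 then 0 else - (dev F u (row k w) / dev F u x)).
rewrite -(phi_shift s Zu); set w' := _ + _.
have Zx : frame x w'.
  split=> // k; rewrite row_shift devDr devZr dev_self // mulr0 addr0.
  by case: Zu => _ _ ->.
have r0 : row ord0 w' = u by rewrite row_shift row_set_row0 eqxx mxE eqxx scale0r addr0.
have Zu' : frame u w'.
  split=> // k; have [->|k0] := eqVneq k ord0; first by rewrite r0 dev_self.
  rewrite row_shift row_set_row0 mxE (negPf k0) devDr devZr mulNr divfK // subrr.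
  by [].
rewrite (frames_agree char0 hF smooth phi_local Zx Zu'); first exact: phi_self Zu' r0.
exists (delta_mx ord0 a), x; rewrite dev_delta dev_self // mul0r subr0 mulf_neq0 //.
Qed.

Lemma linear_form_at (x : 'rV[C]_N) : x != 0 -> exists l, ev (linear_form l) x != 0.
Proof.
move=> x0; have [y|l lx] := @linear_form_neq0 C q.+1 [:: x]; first by rewrite inE => /eqP ->.
by exists l; apply: lx; exact: mem_head.
Qed.

Lemma good_linear : exists E, forall l, @good C q.+1 F phi E (linear_form l ^+ E).
Proof.
have [E gE] := good_all hF phi_local; exists E => l; apply: gE.
by have := dhomogMn E (linear_form_homog l); rewrite mul1n.
Qed.

(** In coordinates on the kernel of dF(x), [f] is [F], [b] is [x] and [Pm] is [phi] as a function of
    the first row. A prime factor [Q] of [f] divides [Pm], and then is a first integral like [Pm];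
    or it divides the derivative of [f], hence, being a simple factor, its own derivative, which has
    smaller degree. So all factors of [f] are constant along [b]. *)
Lemma tangent_polar x w : frame x w -> phi x w != 0 ->
  forall z, dev F x z = 0 -> dev F z x = 0.
Proof.
move=> Z nz z xz; have [x0 Fx wx] := Z; have [//|a Fa] := smooth (v := x).
pose tau := tangent_param x a; have [E gE] := good_linear.
have [l Lx] := linear_form_at x0; have [P hP PE] := gE l.
have AP := @poly_fun_subalgebra C q.+3.
have tauP i : poly_fun (fun c => tau c ord0 i) := tangent_param_poly x a i.
have [f fE] := subalg_ev AP F tauP; have [g gE'] := subalg_ev AP F^`M(a) tauP.
have [Pm PmE] : poly_fun (fun c => ev2 (mxvec (set_row0 w (tau c))) x P).
  apply: (subalg_ev2 AP) => [k|i]; last exact: subalg_cst.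
  case/mxvec_indexP: k => k i; have [k0|k0] := eqVneq k ord0.
    by apply: (subalg_ext AP _ (tauP i)) => c; rewrite mxvecE [RHS]mxE k0 eqxx.
  by apply: (subalg_ext AP _ (subalg_cst AP (w k i))) => c; rewrite mxvecE [RHS]mxE (negPf k0).
have {PmE} PmE c : ev Pm c = ev (linear_form l ^+ E) x * phi x (set_row0 w (tau c)).
  by rewrite PE ?PmE //; apply: frame_set_row0 => //; exact: tangent_param_dev.
have onto y : dev F x y = 0 -> exists c, tau c = y := tangent_param_onto Fa (z := y).
have [b bE] := onto _ (dev_self Fx).
have [c1 c1E] := onto _ (wx ord0).
have Pm0 : Pm != 0.
  apply/eqP => e; have := PmE c1; rewrite e ev0 c1E.
  have -> : set_row0 w (row ord0 w) = w.
    by apply/matrixP => k i; rewrite !mxE; case: eqP => [->|].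
  by move=> /eqP; rewrite eq_sym mulf_eq0 evXn expf_eq0 (negPf Lx) andbF (negPf nz).
have taul c t : tau (c + t *: b) = tau c + t *: tau b by exact: tangent_paramD.
(* Moving along [b] adds a multiple of [x] to the first row. *)
have DPm : dder b Pm = 0.
  apply: mpoly_ext => c; rewrite ev_dder ev0; apply: dev_line_const => t.
  rewrite !PmE taul bE; congr (_ * _).
  rewrite -[RHS](phi_shift (t *: delta_mx ord0 ord0)).
    congr (phi x _); apply/matrixP => k i; rewrite !mxE big_ord1 !mxE eqxx andbT.
    by case: eqP => _ /=; rewrite ?mulr1 ?mulr0 ?mul0r ?addr0.
  by apply: frame_set_row0 => //; exact: tangent_param_dev.
have devf c b' : dev f c b' = dev F (tau c) (tau b').
  by apply: dev_comp => // t; exact: tangent_paramD.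
have key c : ev f c = 0 -> ev Pm c * dev f c b = 0.
  move=> fc; rewrite devf bE; have [->|D] := eqVneq (dev F (tau c) x) 0.
    by rewrite mulr0.
  rewrite PmE phi_vanish_at ?mulr0 ?mul0r //; first exact: tangent_param_dev.
  by rewrite fE.
have fZ t v : ev f (t *: v) = t ^+ d.+3 * ev f v.
  by rewrite -!fE /tau tangent_paramZ (homog_evZ _ _ hF).
suff H c : dev f c b = 0.
  have [c cE] := onto _ xz.
  by have := H c; rewrite devf bE cE.
have [->|f0] := eqVneq f 0; first by rewrite -(mpolyC0 _ C) devC.
have [u [s [uu sP fs]]] := mpoly_factorial f0.
rewrite fs devM unit_dev // mul0r add0r dev_prod0 ?mulr0 // => Q Qs.
have pQ := sP Q Qs; have [Q0 Qu QM] := pQ.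
suff DQ : dder b Q = 0 by rewrite -ev_dder DQ ev0.
have fQ : f = Q * (u * \prod_(r <- rem Q s) r).
  by rewrite fs (perm_big _ (perm_to_rem Qs)) big_cons mulrCA.
move: (u * _) fQ => g' fQ.
(* A multiple factor has a nonzero zero in common with [g], the [a]-th derivative; there dF vanishes
   on the kernel of dF(x) and in the transverse direction [a]. *)
have ndvd : ~ divides Q g'.
  move=> [h hE]; have Qz : ev Q 0 = 0 by apply: (homog_factor0 fZ f0 fQ).
  have gz : ev g 0 = 0.
    rewrite -gE' -{1}(scale0r 0) /tau tangent_paramZ scale0r.
    exact: homog_ev0 (dhomog_deriv a hF) _.
  have [||c' [cs fc _]] := @zeros_infinite C q.+3 2 (fun i => if i == ord0 then Q else g) 1 0
    [:: 0] isT _ _.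
  - by move=> i; case: ifP.
  - by rewrite ev1 oner_neq0.
  have Qc := fc ord0; have gc := fc ord_max; rewrite /= in Qc gc.
  have c0 : c' != 0 by move: cs; rewrite inE.
  apply: (@singular_along_tangent x (tau c') a) => //.
  - by apply: contraNneq c0 => /(tangent_param_eq0 Fa) ->.
  - by rewrite fE fQ evM Qc mul0r.
  - by rewrite gE'.
  move=> y /onto[b' <-]; rewrite -devf fQ hE.
  by rewrite devM evM Qc !(mulr0, mul0r, addr0).
have dP : divides Q (Pm * dder b f).
  apply: prime_vanish => // v Qv; rewrite evM ev_dder; apply: key.
  by rewrite fQ evM Qv mul0r.
case/QM: dP => [QP|]; first exact: prime_first_integral DPm QP.
move=> [h hE]; apply: divides_dder => //.
have : divides Q (dder b Q * g').
  exists (h - dder b g'); rewrite mulrBl -hE fQ dderM [Q * _]mulrC addrK.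
  by [].
by case/QM.
Qed.

(** The projection of [v] to the kernel of dF(y) along [e], multiplied by dF(y)e to be polynomial in
    [y]. *)
Definition flat e v y : 'rV[C]_N := dev F y e *: v - dev F y v *: e.

Lemma flat_poly e v i : poly_fun (fun y => flat e v y ord0 i).
Proof.
have AP := @poly_fun_subalgebra C N.
have Pd u : poly_fun (fun y => dev F y u).
  by apply: (subalg_dev AP F _ _) => j; [exact: poly_fun_coord|exact: subalg_cst].
have := subalg_sub AP (subalg_mul AP (Pd e) (subalg_cst AP (v ord0 i)))
  (subalg_mul AP (Pd v) (subalg_cst AP (e ord0 i))).
by apply: (subalg_ext AP) => y; rewrite !mxE.
Qed.

(** The frame [w0] follows the base point by [flat]. If the conclusion failed at [x], irreducibility
    of [X] would provide a point where it fails and [phi] is nonzero, against [tangent_polar]. *)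
Lemma polar_globalise x0 w0 : frame x0 w0 -> phi x0 w0 != 0 ->
  forall e z x, dev F x0 e = 1 -> dev F x0 z = 0 -> x != 0 -> ev F x = 0 ->
  dev F (flat e z x) x = 0.
Proof.
move=> [x00 Fx0 wx0] nz e z x e1 z0 x_0 Fx; apply/eqP/negPn/negP => D.
have [E gE] := good_linear; have [l lx0] := linear_form_at x00.
have [P hP PE] := gE l; have AP := @poly_fun_subalgebra C N.
have flat_dev v y : dev F y (flat e v y) = 0 by rewrite devBr !devZr mulrC subrr.
pose fw y := \matrix_k flat e (row k w0) y.
have Pf1 : poly_fun (fun y => ev2 (mxvec (fw y)) y P).
  apply: (subalg_ev2 AP) => [k|i]; last exact: poly_fun_coord.
  case/mxvec_indexP: k => k i.
  by apply: (subalg_ext AP _ (flat_poly e (row k w0) i)) => y; rewrite mxvecE [RHS]mxE.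
have Pf2 : poly_fun (fun y => dev F (flat e z y) y).
  by apply: (subalg_dev AP F _ _) => j; [exact: flat_poly|exact: poly_fun_coord].
have fwE y : y != 0 -> ev F y = 0 -> frame y (fw y) by move=> y0 Fy; split=> // k; rewrite rowK.
have [|y [[y0 Fy] f1 f2]] := poly_fun_irreducible hF isT smooth Pf1 Pf2
  (conj x00 Fx0) (conj x_0 Fx) _ D.
  rewrite -PE; last exact: fwE.
  have -> : fw x0 = w0.
    by apply/row_matrixP => k; rewrite rowK /flat e1 wx0 scale0r subr0 scale1r.
  by rewrite mulf_neq0 // evXn expf_neq0.
have fy := fwE y y0 Fy; case/negP: f2; apply/eqP.
apply: (tangent_polar fy _ (flat_dev z y)).
by apply: contraNneq f1 => p0; rewrite -PE // p0 mulr0.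
Qed.

(** The derivative in [s] of [F(t z + s x0)] is zero by [tangent_polar]; compare [s = 1] with
    [s = 0]. *)
Lemma polar_cone x0 w0 : frame x0 w0 -> phi x0 w0 != 0 ->
  forall z t, dev F x0 z = 0 -> ev F (x0 + t *: z) = t ^+ d.+3 * ev F z.
Proof.
move=> Z nz z t z0; have [x00 Fx0 _] := Z.
have h : forall s, ((line (t *: z) x0 F)^`()).[s] = 0.
  move=> s; rewrite deriv_line; apply: (tangent_polar Z nz).
  by rewrite devDr !devZr z0 dev_self // !mulr0 addr0.
have := deriv0_const char0 h 1 0.
by rewrite !horner_line scale1r scale0r addr0 addrC (homog_evZ _ _ hF).
Qed.

(* Restrict the polynomial [H] vanishing on the hypersurface to the line through
   [x0] and [z]: modulo the square of the parameter it is [d.+3 * F(z)] times it. *)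
Lemma polar_vanish x0 w0 : frame x0 w0 -> phi x0 w0 != 0 ->
  forall z, dev F x0 z = 0 -> ev F z = 0.
Proof.
move=> Z nz z z0; have [x00 Fx0 _] := Z; have [//|a Fa] := smooth (v := x0).
have [e e1] : exists e, dev F x0 e = 1.
  by exists ((ev F^`M(a) x0)^-1 *: delta_mx ord0 a); rewrite devZr dev_delta mulVf.
have AP := @poly_fun_subalgebra C N.
have [H HE] : poly_fun (fun y => dev F (flat e z y) y).
  by apply: (subalg_dev AP F _ _) => j; [exact: flat_poly|exact: poly_fun_coord].
have [c cE] : divides F H.
  apply: (vanish_divides hF isT smooth) => y y0 Fy; rewrite -HE.
  exact: (polar_globalise Z nz).
have cone t : ev F (x0 + t *: z) = t ^+ d.+3 * ev F z by exact: (polar_cone Z nz).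
have [al alE] : exists al : {poly C}, forall t, al.[t] = dev F (x0 + t *: z) e.
  exists (line x0 z (\sum_i e ord0 i *: F^`M(i))) => t.
  by rewrite horner_line ev_sum; apply: eq_bigr => i _; rewrite evZ.
(* The derivative of [t ^ d.+3] is divisible by [t ^ 2], since [F] has degree at least 3. So on the
   line [flat e z] equals [al z] modulo [t ^ 2]. *)
have devz t : dev F (x0 + t *: z) z = t ^+ 2 * ((d.+3)%:R * t ^+ d * ev F z).
  rewrite -deriv_line (_ : line x0 z F = ev F z *: 'X^(d.+3)); last first.
    by apply: poly_fun_ext => s; rewrite horner_line cone hornerZ hornerXn mulrC.
  rewrite derivZ derivXn hornerZ hornerMn hornerXn -mulr_natl (_ : d.+3.-1 = (2 + d)%N) //.
  rewrite exprD; move: (d.+3)%:R (ev F z) (t ^+ d) => D f u; ring.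
pose A i := al * (z ord0 i)%:P; pose B i := - ((d.+3)%:R * ev F z * e ord0 i)%:P * 'X^d.
have [pr prE] : exists pr : 'I_N -> {poly C} * {poly C}, forall i t,
    ev F^`M(i) (al.[t] *: z) = (pr i).1.[t] /\
    ev F^`M(i) (flat e z (x0 + t *: z)) =
      (pr i).1.[t] + t ^+ 2 * (pr i).2.[t].
  have h i : exists pr : {poly C} * {poly C}, forall t,
    ev F^`M(i) (al.[t] *: z) = pr.1.[t] /\
    ev F^`M(i) (flat e z (x0 + t *: z)) =
      pr.1.[t] + t ^+ 2 * pr.2.[t].
    have [p [r pr]] := curve_expansion F^`M(i) A B; exists (p, r) => s.
    have [<- <-] := pr s; rewrite /flat -alE devz; split; congr (ev _ _).
      by apply/rowP => j; rewrite !mxE /A hornerM hornerC.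
    apply/rowP => j; rewrite !mxE /A /B hornerM hornerC hornerM hornerN hornerC hornerXn.
    by move: (d.+3)%:R => D; ring.
  exists (fun i => sval (cid (h i))) => i; exact: (svalP (cid (h i))).
pose rr := \sum_i ((x0 ord0 i)%:P + (z ord0 i)%:P * 'X) * (pr i).2.
have Hline t : ev H (x0 + t *: z) = al.[t] ^+ d.+2 * (t * ((d.+3)%:R * ev F z)) + t ^+ 2 * rr.[t].
  rewrite -HE; set y := x0 + t *: z.
  have -> : al.[t] ^+ d.+2 * (t * ((d.+3)%:R * ev F z)) = dev F (al.[t] *: z) y.
    rewrite devZl devDr devZr (tangent_polar Z nz z0) add0r (dev_euler _ hF).
    by [].
  rewrite /rr horner_sum mulr_sumr -big_split; apply: eq_bigr => i _ /=.
  have [-> ->] := prE i t; rewrite mulrDr; congr (_ + _).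
  by rewrite hornerM hornerD hornerM !hornerC hornerX !mxE mulrCA [z ord0 i * t]mulrC.
(* The difference of the two expressions of [H] on the line, divided by [t]; at [t = 0] only [d.+3]
   times [F(z)] remains, as [al] is 1 there. *)
have [S SE] : exists S : {poly C}, forall t, S.[t] =
    al.[t] ^+ d.+2 * ((d.+3)%:R * ev F z) + t * rr.[t] - (line x0 z c).[t] * t ^+ d.+2 * ev F z.
  have [P1 P1E] : exists P1 : {poly C}, forall t, P1.[t] = al.[t] ^+ d.+2.
    by exists (al ^+ d.+2) => t; rewrite horner_exp.
  have [P2 P2E] : exists P2 : {poly C}, forall t, P2.[t] = t ^+ d.+2.
    by exists 'X^(d.+2) => t; rewrite hornerXn.
  exists (P1 * ((d.+3)%:R * ev F z)%:P + 'X * rr - line x0 z c * P2 * (ev F z)%:P) => t.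
  by rewrite hornerD hornerN hornerD !hornerM P1E P2E !hornerC hornerX.
have /eqP : 'X * S = 0.
  apply: poly_fun_ext => t; rewrite horner0 hornerM hornerX SE horner_line.
  have := Hline t; rewrite cE evM cone (exprS t d.+2) => h; rewrite mulrBr mulrDr.
  apply/eqP; rewrite subr_eq0; apply/eqP; rewrite mulrCA [t * (t * _)]mulrA -expr2 -h.
  by move: (t ^+ d.+2) (ev c _) => u v; ring.
rewrite mulf_eq0 polyX_eq0 /= => /eqP S0; have := SE 0; rewrite S0 horner0.
rewrite alE scale0r addr0 e1 expr1n mul1r mul0r addr0 exprS mul0r mulr0 mul0r subr0 => /esym/eqP.
by rewrite mulf_eq0 (negPf (char0 _)) => /eqP.
Qed.

(** As [F] vanishes on the kernel of dF(x), so does dF(z) for each [z] in it. Krull's theorem gives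
    such a [z], not zero, where the [a]-th derivative vanishes too, and [X] is singular there. *)
Lemma phi_eq0 x w : frame x w -> phi x w = 0.
Proof.
move=> Z; apply/eqP/negPn/negP => nz; have [x0 Fx wx] := Z.
have vT := polar_vanish Z nz; have [//|a Fa] := smooth (v := x).
pose lx := linear_form (\row_i ev F^`M(i) x).
have lxE y : ev lx y = dev F x y.
  by rewrite ev_linear_form; apply: eq_bigr => i _; rewrite mxE mulrC.
have [||z [zs fz _]] := @zeros_infinite C N 2 (fun i => if i == ord0 then lx else F^`M(a)) 1 0
  [:: 0] isT _ _.
- move=> i; case: ifP => _; first by rewrite lxE /dev big1 // => j _; rewrite mxE mul0r.
  exact: homog_ev0 (dhomog_deriv a hF) _.
- by rewrite ev1 oner_neq0.
have lz := fz ord0; have az := fz ord_max; rewrite /= lxE in lz az.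
have z0 : z != 0 by move: zs; rewrite inE.
apply: (singular_along_tangent Fa z0 (vT z lz) az) => y xy.
apply: dev_line_const => t; rewrite !vT // devDr devZr lz xy.
by rewrite mulr0 addr0.
Qed.

End Vanishing.

(** * Regular functions and derivations *)

Section Volume.
Variables (C : fieldType) (q : nat).
Local Notation N := (q.+4).
Implicit Types (x y e : 'rV[C]_N) (w : 'M[C]_(q.+1, N)).

Definition vol_mx x y e w : 'M[C]_N := \matrix_(i < N)
  match val i with
  | 0 => x
  | 1 => y
  | 2 => e
  | k.+3 => row (inord k) w
  end.

Definition vol x y e w := \det (vol_mx x y e w).

Lemma vol_mulr_eq0 x y e w (c : 'cV_N) : c != 0 -> x *m c = 0 -> y *m c = 0 -> e *m c = 0 ->
  (forall i, row i w *m c = 0) -> vol x y e w = 0.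
Proof.
move=> c0 xc yc ec wc; apply/eqP; rewrite /vol -det_tr; apply/det0P; exists c^T.
  by apply: contra_neq c0 => /(congr1 trmx); rewrite trmxK linear0.
rewrite -trmx_mul (_ : _ *m c = 0) ?linear0 //; apply/row_matrixP => i.
by rewrite row_mul rowK row0; case: (val i) => [|[|[|k]]].
Qed.

Lemma vol_neq0 x y e w : (forall c : 'cV_N, x *m c = 0 -> y *m c = 0 -> e *m c = 0 ->
  (forall i, row i w *m c = 0) -> c = 0) -> vol x y e w != 0.
Proof.
move=> H; apply/negP; rewrite /vol -det_tr => /det0P[v v0 vA].
have {}vA : vol_mx x y e w *m v^T = 0 by apply: trmx_inj; rewrite trmx_mul trmxK vA linear0.
have rA i : row i (vol_mx x y e w) *m v^T = 0 by rewrite -row_mul vA row0.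
case/eqP: v0; apply: trmx_inj; rewrite linear0; apply: H.
- by have := rA ord0; rewrite rowK.
- by have := rA (@Ordinal N 1 isT); rewrite rowK.
- by have := rA (@Ordinal N 2 isT); rewrite rowK.
move=> i; have := rA (@Ordinal N i.+3 (ltn_ord i)); rewrite rowK /=.
by rewrite (_ : inord i = i) //; apply: val_inj; rewrite /= inordK.
Qed.

Lemma vol_linear2 x y y' e w a b :
  vol x (a *: y + b *: y') e w = a * vol x y e w + b * vol x y' e w.
Proof.
apply: (@determinant_multilinear _ _ _ _ _ (@Ordinal N 1 isT)).
- by rewrite !rowK.
- by apply/matrixP => -[[|i] hi] j; rewrite !mxE.
- by apply/matrixP => -[[|i] hi] j; rewrite !mxE.
Qed.

Lemma vol_linear3 x y e e' w a b :
  vol x y (a *: e + b *: e') w = a * vol x y e w + b * vol x y e' w.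
Proof.
apply: (@determinant_multilinear _ _ _ _ _ (@Ordinal N 2 isT)).
- by rewrite !rowK.
- by apply/matrixP => -[[|[|i]] hi] j; rewrite !mxE.
- by apply/matrixP => -[[|[|i]] hi] j; rewrite !mxE.
Qed.

Lemma vol_alternate12 x e w : vol x x e w = 0.
Proof.
by apply: (@determinant_alternate _ _ _ ord0 (@Ordinal N 1 isT)) => // j; rewrite !mxE.
Qed.

Lemma vol_alternate_frame1 x y e w i : row i w = x -> vol x y e w = 0.
Proof.
move=> wi; apply: (@determinant_alternate _ _ _ ord0 (@Ordinal N i.+3 (ltn_ord i))) => // j.
by rewrite !mxE /= -wi mxE (_ : inord i = i) //; apply: val_inj; rewrite /= inordK.
Qed.

Lemma vol_alternate_frame2 x y e w i : row i w = y -> vol x y e w = 0.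
Proof.
move=> wi; apply: (@determinant_alternate _ _ _ (@Ordinal N 1 isT)
  (@Ordinal N i.+3 (ltn_ord i))) => // j.
by rewrite !mxE /= -wi mxE (_ : inord i = i) //; apply: val_inj; rewrite /= inordK.
Qed.

(** The shift is left multiplication by the unitriangular matrix [L]. *)
Lemma vol_shift x y e w (c : 'cV_q.+1) : vol x y e (w + c *m x) = vol x y e w.
Proof.
pose u : 'cV[C]_N := \col_i if val i is k.+3 then c (inord k) ord0 else 0.
pose L : 'M[C]_N := 1%:M + u *m delta_mx ord0 ord0.
have LE : vol_mx x y e (w + c *m x) = L *m vol_mx x y e w.
  rewrite mulmxDl mul1mx -mulmxA -rowE; apply/matrixP => i j.
  rewrite !mxE big_ord1 !mxE; case: i => [[|[|[|i]]] hi]; rewrite /= ?mul0r ?addr0 //.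
  by rewrite !mxE big_ord1.
rewrite /vol LE det_mulmx det_trig ?big1 ?mul1r //.
  by move=> i _; rewrite !mxE big_ord1 !mxE eqxx; case: i => [[|i] hi]; rewrite ?mul0r ?mulr0 addr0.
apply/is_trig_mxP => i j ij; rewrite !mxE big_ord1 !mxE.
have -> : (i == j) = false by apply: contraTF ij => /eqP ->; rewrite ltnn.
have -> : (j == ord0) = false by apply: contraTF ij => /eqP ->.
by rewrite andbF mulr0 addr0.
Qed.

End Volume.

Local Open Scope classical_set_scope.

(** * Regular functions as local quotients, derivations as vector fields *)

Section Regular.
Variables (C : closedFieldType) (N : nat) (F : {mpoly C[N]}).
Local Notation V := 'rV[C]_N.
Local Notation X := (hypersurface F).
Implicit Types (U W Z : zopen F) (u v : V).

Lemma zprin_open P : (exists e, P \is e.-homog) ->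
  zariski_open F [set v | X v /\ ev P v != 0].
Proof.
move=> hP; exists [set P]; split=> [Q ->//|]; apply/seteqP; split=> v [Xv Pv]; split=> //.
  by exists P.
by case: Pv => Q ->.
Qed.

Definition zprin P (hP : exists e, P \is e.-homog) : zopen F := ZOpen (zprin_open hP).

Lemma zopen_sub U v : zset U v -> X v.
Proof. by have [S [_ ->]] := zsetP U => -[]. Qed.

Lemma zopen_prin U v : zset U v -> exists e P,
  [/\ P \is e.-homog, ev P v != 0 & forall u, X u -> ev P u != 0 -> zset U u].
Proof.
have [S [hS ->]] := zsetP U => -[Xv [P SP Pv]]; have [e he] := hS P SP.
by exists e, P; split=> // u Xu Pu; split=> //; exists P.
Qed.

(** Extension by 0, so that functions on different open sets can be compared at a vector without
    carrying proofs of membership. *)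
Definition rv U (f : {v | zset U v} -> C) (v : V) : C :=
  if pselect (zset U v) is left h then f (exist _ v h) else 0.

Lemma rvE U (f : {v | zset U v} -> C) v (h : zset U v) : rv f v = f (exist _ v h).
Proof. by rewrite /rv; case: pselect => // h'; congr f; apply: eq_exist. Qed.

Lemma rv_sval U (f : {v | zset U v} -> C) (u : {v | zset U v}) : rv f (sval u) = f u.
Proof. by rewrite (rvE _ (svalP u)); congr f; case: u => u h; apply: eq_exist. Qed.

(** Numerator and denominator are multiplied by forms whose nonvanishing implies membership in [U]
    and in [W]; the formula then holds wherever the new denominator is nonzero. *)
Lemma regular_local m U (f : {v | zset U v} -> C) v : regular F m f -> zset U v ->
  exists e A B, [/\ A \is (e + m).-homog, B \is e.-homog, ev B v != 0 &
    forall u, X u -> ev B u != 0 -> zset U u /\ rv f u = ev A u / ev B u].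
Proof.
move=> fr Uv; have [W [Wv [e [P [Q [hP hQ PQ]]]]]] := fr (exist _ v Uv).
have [e1 [R1 [hR1 R1v R1U]]] := zopen_prin Uv.
have [e2 [R2 [hR2 R2v R2W]]] := zopen_prin Wv.
exists (e + e1 + e2)%N, (P * R1 * R2), (Q * R1 * R2); split.
- by rewrite !(addnAC _ _ m); do 2 apply: dhomogM => //.
- by do 2 apply: dhomogM => //.
- by have [Qv _] := PQ (exist _ v Uv) Wv; rewrite !evM !mulf_neq0.
move=> u Xu; rewrite !evM !mulf_eq0 !negb_or => /andP[/andP[Qu R1u] R2u].
have Uu := R1U u Xu R1u; split=> //; rewrite (rvE _ Uu).
have [_ ->] := PQ (exist _ u Uu) (R2W u Xu R2u) => /=.
by rewrite -(mulrA (ev P u)) -(mulrA (ev Q u)) -mulf_div divff ?mulr1 // mulf_neq0.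
Qed.

(** The degree is positive so that [dhomog_deriv] applies; [rep_exists] multiplies by a coordinate
    to achieve this. *)
Definition rep Z (f : {v | zset Z v} -> C) u (A B : {mpoly C[N]}) :=
  [/\ exists e, A \is e.+1.-homog /\ B \is e.+1.-homog, ev B u != 0 &
    forall v, X v -> ev B v != 0 -> zset Z v /\ rv f v = ev A v / ev B v].

Lemma rep_exists Z (f : regfun Z) u : zset Z u -> exists A B, rep (rval f) u A B.
Proof.
move=> Zu; have fr : regular F 0 (rval f) by apply/asboolP; exact: rvalP.
have [e [A [B [hA hB Bu AB]]]] := regular_local fr Zu; rewrite addn0 in hA.
have [b ub] : exists b, u ord0 b != 0.
  have [u0 _] := zopen_sub Zu; apply/existsP; apply: contraR u0.
  rewrite negb_exists => /forallP h; apply/eqP/rowP => i; rewrite mxE; apply/eqP.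
  by move: (h i); rewrite negbK.
have hX := mpolyX_homog1 C b.
exists ('X_b * A), ('X_b * B); split.
- by exists e; rewrite -add1n; split; apply: dhomogM.
- by rewrite evM evX mulf_neq0.
move=> v Xv; rewrite !evM evX mulf_eq0 negb_or => /andP[vb Bv].
by have [Zv ->] := AB v Xv Bv; split=> //; rewrite -mulf_div divff ?mul1r.
Qed.

Lemma rep_move Z (f : {v | zset Z v} -> C) u u' A B :
  rep f u A B -> ev B u' != 0 -> rep f u' A B.
Proof. by move=> [hA Bu H] Bu'; split. Qed.

Definition quot_dev (A B : {mpoly C[N]}) u t :=
  (ev B u * dev A u t - ev A u * dev B u t) / ev B u ^+ 2.

Lemma regfunP Z (f g : regfun Z) : (forall v, zset Z v -> rv (rval f) v = rv (rval g) v) -> f = g.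
Proof.
move=> h; apply/val_inj/funext => u; rewrite -[LHS]rv_sval -[RHS]rv_sval.
by apply: h; exact: svalP.
Qed.

Lemma rv_add Z (f g : regfun Z) v : rv (rval (f + g)) v = rv (rval f) v + rv (rval g) v.
Proof. by rewrite /rv; case: pselect => // _; rewrite addr0. Qed.

Lemma rv_mul Z (f g : regfun Z) v : rv (rval (f * g)) v = rv (rval f) v * rv (rval g) v.
Proof. by rewrite /rv; case: pselect => // _; rewrite mulr0. Qed.

Lemma rv_zero Z v : rv (rval (0 : regfun Z)) v = 0.
Proof. by rewrite /rv; case: pselect. Qed.

Lemma rv_cst Z c v : zset Z v -> rv (rval (regcst Z c)) v = c.
Proof. by move=> Zv; rewrite (rvE _ Zv). Qed.

Lemma rv_sum Z I (r : seq I) (p : pred I) (f : I -> regfun Z) v :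
  rv (rval (\sum_(i <- r | p i) f i)) v = \sum_(i <- r | p i) rv (rval (f i)) v.
Proof.
elim/big_rec2: _ => [|i y z _ e]; first exact: (rv_zero Z v).
by rewrite (rv_add (f i) z v) e.
Qed.

Lemma rv_res Z Z' (ZZ : zset Z' `<=` zset Z) (f : regfun Z) v : zset Z' v ->
  rv (rval (regfun_res ZZ f)) v = rv (rval f) v.
Proof. by move=> Zv; rewrite (rvE _ Zv) (rvE _ (ZZ v Zv)) /=; congr (rval f _); apply: eq_exist. Qed.

Lemma der_germ U (D : derivation U) Z Z' (ZU : zset Z `<=` zset U) (ZU' : zset Z' `<=` zset U)
    (f : regfun Z) (f' : regfun Z') v : zset Z' `<=` zset Z ->
  (forall u, zset Z' u -> rv (rval f') u = rv (rval f) u) -> zset Z' v ->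
  rv (rval (der D ZU' f')) v = rv (rval (der D ZU f)) v.
Proof.
move=> ZZ ff' Zv; rewrite (_ : f' = regfun_res ZZ f).
  by rewrite (der_res D ZU) rv_res.
by apply: regfunP => u Zu; rewrite rv_res // ff'.
Qed.

Lemma coord_ratio_regular (W : zopen F) b i : (forall v, zset W v -> v ord0 b != 0) ->
  regular F 0 (fun u : {v | zset W v} => sval u ord0 i / sval u ord0 b).
Proof.
move=> Wb u; exists W; split; first exact: svalP.
exists 1%N, 'X_i, 'X_b; split=> [||w Ww]; rewrite ?mpolyX_homog1 //.
by rewrite !evX Wb.
Qed.

Definition coord_ratio (W : zopen F) b (Wb : forall v, zset W v -> v ord0 b != 0) i : regfun W :=
  RegFun (asboolT (coord_ratio_regular i Wb)).

Lemma rv_coord_ratio W b (Wb : forall v, zset W v -> v ord0 b != 0) i v : zset W v ->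
  rv (rval (coord_ratio Wb i)) v = v ord0 i / v ord0 b.
Proof. by move=> Wv; rewrite (rvE _ Wv). Qed.

Lemma coord_homog b : exists e, ('X_b : {mpoly C[N]}) \is e.-homog.
Proof. by exists 1%N; exact: mpolyX_homog1. Qed.

Definition chart U b := zopenI U (zprin (coord_homog b)).

Lemma chartP U b v : zset (chart U b) v <-> zset U v /\ v ord0 b != 0.
Proof.
split=> [[Uv [_]]|[Uv vb]]; first by rewrite evX.
by split=> //; split; [exact: zopen_sub Uv|rewrite evX].
Qed.

Lemma chart_sub U b : zset (chart U b) `<=` zset U.
Proof. by move=> v /chartP[]. Qed.

Lemma chart_coord U b v : zset (chart U b) v -> v ord0 b != 0.
Proof. by move=> /chartP[]. Qed.

(* The tangent vector at [v] defined by [D], for the lift of the point [v] with constant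
   coordinate [b]. *)
Definition vfield U (D : derivation U) b v : V :=
  v ord0 b *: \row_i rv (rval (der D (@chart_sub U b) (coord_ratio (@chart_coord U b) i))) v.

(** The derivation and the vector field agree on the ratios of coordinates, and both satisfy the
    Leibniz rule. *)
Lemma dehomog_der U (D : derivation U) W (WU : zset W `<=` zset U) b
    (Wb : forall v, zset W v -> v ord0 b != 0) P :
  exists g : regfun W, forall v, zset W v -> rv (rval g) v = ev P ((v ord0 b)^-1 *: v) /\
    rv (rval (der D WU g)) v = dev P ((v ord0 b)^-1 *: v) ((v ord0 b)^-1 *: vfield D b v).
Proof.
elim/mpoly_ind_ring: P => [c|i|P Q [g hg] [h hh]|P Q [g hg] [h hh]].
- by exists (regcst W c) => v Wv; rewrite der_cst rv_zero rv_cst // evC devC.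
- exists (coord_ratio Wb i) => v Wv; rewrite rv_coord_ratio // evX devX !mxE; split; first by rewrite mulrC.
  rewrite mulKf ?Wb //; apply: der_germ => // u Wu; first by apply/chartP; split; [exact: WU|exact: Wb].
  by rewrite !rv_coord_ratio //; apply/chartP; split; [exact: WU|exact: Wb].
- exists (g + h) => v Wv; have [e1 e2] := hg v Wv; have [e3 e4] := hh v Wv.
  by rewrite derD !rv_add e1 e2 e3 e4 evD devD.
exists (g * h) => v Wv; have [e1 e2] := hg v Wv; have [e3 e4] := hh v Wv.
rewrite derM !rv_add !rv_mul e1 e2 e3 e4 evM devM; split=> //.
by rewrite addrC [ev Q _ * _]mulrC.
Qed.

(** Apply [D] to the function [F(v / v_b)], which is zero on [X]. *)
Lemma vfield_tangent d U (D : derivation U) b v : F \is d.+1.-homog -> zset U v ->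
  v ord0 b != 0 -> dev F v (vfield D b v) = 0.
Proof.
move=> hF Uv vb; have [g hg] := dehomog_der D (@chart_sub U b) (@chart_coord U b) F.
have cv : zset (chart U b) v by apply/chartP.
have [_] := hg v cv; rewrite (_ : g = 0); last first.
  apply: regfunP => u cu; have [-> _] := hg u cu; rewrite rv_zero (homog_evZ _ _ hF).
  by have [_ ->] := zopen_sub cu; rewrite mulr0.
have -> : der D (@chart_sub U b) 0 = 0 by apply: (addrI (der D (@chart_sub U b) 0)); rewrite -derD !addr0.
rewrite rv_zero devZr (_ : dev F (_ *: v) _ = (v ord0 b)^-1 ^+ d * dev F v (vfield D b v)).
  by move/esym/eqP; rewrite !mulf_eq0 expf_eq0 invr_eq0 (negPf vb) andbF => /eqP.
rewrite /dev mulr_sumr; apply: eq_bigr => i _.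
by rewrite (homog_evZ _ _ (dhomog_deriv i hF)) mulrCA.
Qed.

(** With [gA], [gB] the functions [A(v / v_b)], [B(v / v_b)], the Leibniz rule for [f * gB = gA] is
    solved for the derivative of [f]. *)
Lemma der_at U (D : derivation U) Z (ZU : zset Z `<=` zset U) (f : regfun Z) b u A B :
  zset Z u -> u ord0 b != 0 -> rep (rval f) u A B ->
  rv (rval (der D ZU f)) u = quot_dev A B u (vfield D b u).
Proof.
move=> Zu ub [[e [hA hB]] Bu AB].
have hY : exists e, 'X_b * B \is e.-homog.
  by exists (1 + e.+1)%N; apply: dhomogM => //; exact: mpolyX_homog1.
pose Y := zprin hY.
have YP v : zset Y v -> [/\ X v, v ord0 b != 0 & ev B v != 0].
  by move=> [Xv]; rewrite evM evX mulf_eq0 negb_or => /andP[].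
have Yb v : zset Y v -> v ord0 b != 0 by case/YP.
have YZ : zset Y `<=` zset Z by move=> v /YP[Xv _ Bv]; have [] := AB v Xv Bv.
have Yu : zset Y u by split; [exact: zopen_sub Zu|rewrite evM evX mulf_neq0].
pose YU := subset_trans YZ ZU.
have [gA hgA] := dehomog_der D YU Yb A; have [gB hgB] := dehomog_der D YU Yb B.
have dZ P t v : P \is e.+1.-homog -> dev P (t *: v) (t *: vfield D b u) =
    t ^+ e.+1 * dev P v (vfield D b u).
  move=> hP; rewrite devZr exprS -mulrA; congr (_ * _); rewrite /dev mulr_sumr.
  by apply: eq_bigr => i _; rewrite (homog_evZ _ _ (dhomog_deriv i hP)) mulrCA.
have E : regfun_res YZ f * gB = gA.
  apply: regfunP => v Yv; have [-> _] := hgA v Yv; rewrite rv_mul rv_res //.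
  have [-> _] := hgB v Yv; have [Xv _ Bv] := YP v Yv; have [_ ->] := AB v Xv Bv.
  by rewrite (homog_evZ _ _ hA) (homog_evZ _ _ hB) mulrCA divfK.
have := congr1 (fun g => rv (rval (der D YU g)) u) E; rewrite derM rv_add !rv_mul rv_res //.
rewrite (der_res D ZU) rv_res // ; have [-> ->] := hgB u Yu; have [_ ->] := hgA u Yu.
rewrite !dZ // (homog_evZ _ _ hB); have [Xu _ _] := YP u Yu; have [_ ->] := AB u Xu Bu.
rewrite /quot_dev; set x := rv _ u; set t := _ ^+ e.+1; have t0 : t != 0 by rewrite expf_neq0 // invr_eq0.
move: (ev A u) (ev B u) Bu (dev A u _) (dev B u _) => a c c0 da dc h.
have {}h : a / c * dc + c * x = da.
  by apply: (mulfI t0); rewrite -h mulrDr -!mulrA mulrCA [t * (c^-1 * _)]mulrCA.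
by rewrite -h; field.
Qed.

End Regular.

Section DerivationValue.
Variables (C : closedFieldType) (N : nat) (F : {mpoly C[N]}).
Implicit Types (U W : zopen F).

Lemma coord_ratio_rep U c i u : zset (chart U c) u -> exists A B,
  rep (rval (coord_ratio (@chart_coord C N F U c) i)) u A B /\
  forall t, quot_dev A B u t = (u ord0 c * t ord0 i - u ord0 i * t ord0 c) / u ord0 c ^+ 2.
Proof.
move=> cu; have uc := chart_coord cu; have [e [R [hR Ru RU]]] := zopen_prin cu.
exists ('X_i * R), ('X_c * R); split; last first.
  move=> t; rewrite /quot_dev !evM !devM !evX !devX; move: (dev R _ _) => r.
  by field; rewrite ?uc.
split.
- by exists e; rewrite -add1n; split; apply: dhomogM; rewrite ?mpolyX_homog1.
- by rewrite evM evX mulf_neq0.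
move=> v Xv; rewrite !evM !evX mulf_eq0 negb_or => /andP[vc Rv]; have cv := RU v Xv Rv.
by split=> //; rewrite rv_coord_ratio // -mulf_div divff // mulr1.
Qed.

Lemma der_ratio U (D : derivation U) b c i (u : 'rV[C]_N) : zset U u -> u ord0 b != 0 ->
  u ord0 c != 0 ->
  rv (rval (der D (@chart_sub C N F U c) (coord_ratio (@chart_coord C N F U c) i))) u =
  (u ord0 c * vfield D b u ord0 i - u ord0 i * vfield D b u ord0 c) / u ord0 c ^+ 2.
Proof.
move=> Uu ub uc; have cu : zset (chart U c) u by apply/chartP.
have [A [B [AB <-]]] := coord_ratio_rep i cu.
exact: der_at.
Qed.

Lemma vfield_chart U (D : derivation U) b c u : zset U u -> u ord0 b != 0 -> u ord0 c != 0 ->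
  vfield D c u = vfield D b u - (vfield D b u ord0 c / u ord0 c) *: (u : 'rV[C]_N).
Proof.
move=> Uu ub uc; apply/rowP => i; rewrite [LHS]mxE [X in _ * X]mxE (der_ratio D _ Uu ub uc).
rewrite [RHS]mxE [X in _ = _ + X]mxE [X in _ = _ - X]mxE.
by move: (vfield D b u ord0 i) (vfield D b u ord0 c) => s t; field.
Qed.

Lemma vfield_base U (D : derivation U) b u : zset U u -> u ord0 b != 0 ->
  vfield D b u ord0 b = 0 :> C.
Proof.
move=> Uu ub; rewrite [LHS]mxE [X in _ * X]mxE (der_ratio D _ Uu ub ub).
by rewrite subrr mul0r mulr0.
Qed.

Lemma vfield_linear U (a : regfun U) (D E : tangent F U) b (u : 'rV[C]_N) :
  vfield (a *: D + E : tangent F U) b u = rv (rval a) u *: vfield D b u + vfield E b u.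
Proof.
apply/rowP => i; rewrite !mxE rv_add rv_mul mulrDr; congr (_ + _).
rewrite mulrCA; have [cu|cu] := pselect (zset (chart U b) u); first by rewrite rv_res.
by rewrite {2 4}/rv; case: pselect => // _; rewrite !mulr0.
Qed.

Lemma vfield_res U W (WU : zset W `<=` zset U) (D : derivation U) b (u : 'rV[C]_N) :
  zset W u -> u ord0 b != 0 -> vfield (derivation_res WU D) b u = vfield D b u.
Proof.
move=> Wu ub; apply/rowP => i; rewrite !mxE /=; congr (_ * _); apply: der_germ.
- by move=> v /chartP[/WU Uv vb]; apply/chartP.
- by move=> v cv; rewrite !rv_coord_ratio //; have /chartP[/WU Uv vb] := cv; apply/chartP.
- exact/chartP.
Qed.

End DerivationValue.

(** * Evaluation of sections *)

Section Evaluation.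
Variables (C : closedFieldType) (q m k : nat).
Local Notation N := (q.+4).
Variables (F : {mpoly C[N]}).
Hypotheses (hF : F \is m.+3.-homog) (smooth : smooth_hypersurface F).
Local Notation V := 'rV[C]_N.
Local Notation frame := (@tangent_frame C q.+1 F).
Implicit Types (U W : zopen F) (u : V) (w : 'M[C]_(q.+1, N)).

Definition pick_coord u := odflt ord0 [pick b | u ord0 b != 0].
Definition pick_grad u := odflt ord0 [pick a | ev F^`M(a) u != 0].

Lemma pick_coordP u : u != 0 -> u ord0 (pick_coord u) != 0.
Proof.
move=> u0; rewrite /pick_coord; case: pickP => //= h.
by case/eqP: u0; apply/rowP => i; rewrite mxE; apply/eqP; have := h i; rewrite /= => /negbFE.
Qed.

Lemma pick_gradP u : u != 0 -> ev F u = 0 -> ev F^`M(pick_grad u) u != 0.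
Proof.
move=> u0 Fu; rewrite /pick_grad; case: pickP => //= h.
by have [//|a] := smooth (v := u); rewrite h.
Qed.

(** The scalar of the overview. The lift and the vector [e] are fixed by a choice depending on [u]
    alone; [theta_eq] removes this dependence on frames. *)
Definition theta U (D : derivation U) u w : C :=
  vol u (vfield D (pick_coord u) u) (delta_mx ord0 (pick_grad u)) w / ev F^`M(pick_grad u) u.

(** The combination of [e] and [e'] on which dF(u) vanishes lies with all other rows in the kernel
    of dF(u), so its determinant is zero. *)
Lemma vol_swap u t e e' w : frame u w -> dev F u t = 0 ->
  vol u t e w * dev F u e' = vol u t e' w * dev F u e.
Proof.
move=> [u0 Fu uw] ut; have [//|a Fa] := smooth (v := u).
pose c : 'cV[C]_N := \col_i ev F^`M(i) u.
have cE x : x *m c = (dev F u x)%:M.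
  apply/matrixP => i j; rewrite !ord1 !mxE eqxx mulr1n.
  by apply: eq_bigr => l _; rewrite !mxE.
have c0 : c != 0 by apply: contraNneq Fa => c0; have := congr1 (fun z : 'cV__ => z a ord0) c0; rewrite !mxE => ->.
have := vol_linear3 u t e e' w (dev F u e') (- dev F u e).
rewrite (vol_mulr_eq0 c0); last first.
- by move=> i; rewrite cE uw; apply/matrixP => ? ?; rewrite !mxE mul0rn.
- rewrite cE devDr !devZr mulNr mulrC subrr.
  by apply/matrixP => ? ?; rewrite !mxE mul0rn.
- by rewrite cE ut; apply/matrixP => ? ?; rewrite !mxE mul0rn.
- rewrite cE (dev_euler _ hF) Fu mulr0.
  by apply/matrixP => ? ?; rewrite !mxE mul0rn.
move/esym/eqP; rewrite mulNr subr_eq0 => /eqP h; rewrite mulrC h mulrC.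
by [].
Qed.

(** Another chart changes the lift by a multiple of the row [u]; another [e] is treated by
    [vol_swap]. *)
Lemma theta_eq U (D : derivation U) u w a b : zset U u -> frame u w -> u ord0 b != 0 ->
  ev F^`M(a) u != 0 ->
  theta D u w = vol u (vfield D b u) (delta_mx ord0 a) w / ev F^`M(a) u.
Proof.
move=> Uu Z ub Fa; have [u0 Fu _] := Z; have uc := pick_coordP u0; have Fg := pick_gradP u0 Fu.
rewrite /theta (vfield_chart D Uu ub uc) -scaleNr -[vfield D b u]scale1r.
rewrite vol_linear2 vol_alternate12 mulr0 addr0 mul1r scale1r.
apply/eqP; rewrite eqr_div //; apply/eqP.
have := vol_swap (delta_mx ord0 (pick_grad u)) (delta_mx ord0 a) Z (vfield_tangent D hF Uu ub).
by rewrite !dev_delta.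
Qed.

Lemma theta_linear U (a : regfun U) (D E : tangent F U) u w :
  theta (a *: D + E : tangent F U) u w = rv (rval a) u * theta D u w + theta E u w.
Proof.
rewrite /theta vfield_linear -[vfield E _ _]scale1r vol_linear2 scale1r mul1r.
by rewrite mulrDl mulrA.
Qed.

Lemma theta0 U u w : theta (0 : tangent F U) u w = 0.
Proof.
rewrite /theta (_ : vfield _ _ _ = 0); last first.
  by apply/rowP => i; rewrite !mxE rv_zero mulr0.
have := vol_linear2 u 0 0 (delta_mx ord0 (pick_grad u)) w 0 0.
by rewrite scale0r addr0 !mul0r addr0 => ->; rewrite mul0r.
Qed.

Lemma theta_res U W (WU : zset W `<=` zset U) (D : derivation U) u w :
  zset W u -> theta (derivation_res WU D) u w = theta D u w.
Proof.
move=> Wu; rewrite /theta vfield_res //; apply: pick_coordP.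
by have [] := zopen_sub Wu.
Qed.

Lemma theta_self U (D : derivation U) u w i : row i w = u -> theta D u w = 0.
Proof. by move=> wi; rewrite /theta (vol_alternate_frame1 _ _ wi) mul0r. Qed.

Lemma theta_shift U (D : derivation U) u w (c : 'cV_q.+1) :
  theta D u (w + c *m u) = theta D u w.
Proof. by rewrite /theta vol_shift. Qed.

Definition evat U (u : {v | zset U v}) (f : regfun U) : C := rval f u.

Fact evat_additive U (u : {v | zset U v}) : zmod_morphism (evat u).
Proof. by []. Qed.
Fact evat_multiplicative U (u : {v | zset U v}) : monoid_morphism (evat u).
Proof. by []. Qed.
HB.instance Definition _ U (u : {v | zset U v}) :=
  GRing.isZmodMorphism.Build (regfun U) C (evat u) (evat_additive u).
HB.instance Definition _ U (u : {v | zset U v}) :=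
  GRing.isMonoidMorphism.Build (regfun U) C (evat u) (evat_multiplicative u).

Lemma rv_evat U (u : {v | zset U v}) f : rv (rval f) (sval u) = evat u f.
Proof. exact: rv_sval. Qed.

Local Notation E := (tensor_presheaf (tangent F) (OX F m)).

Definition tensor_gen_value U (u : {v | zset U v}) w (p : tangent F U * OX F m U) : C^o :=
  theta p.1 (sval u) w * Defs.tval p.2 u.

Definition tensor_value U (u : {v | zset U v}) w : E U -> C^o :=
  quotlift (freelift (evat u) (tensor_gen_value u w)).

Lemma tensor_value_killed U (u : {v | zset U v}) w x : tensor_rel x ->
  freelift (evat u) (tensor_gen_value u w) x = 0.
Proof.
have L := freelift_semilinear (evat u) (tensor_gen_value u w).
case=> [D D' s|D s s'|a D s|a D s];
  rewrite !(semilinB L) ?(semilinZ L) !freelift_gen /tensor_gen_value /=.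
- rewrite -[D in D + D']scale1r theta_linear rv_evat rmorph1 mul1r mulrDl.
  by rewrite addrAC addrK subrr.
- by rewrite mulrDr addrAC addrK subrr.
- rewrite -[a *: D]addr0 theta_linear rv_evat.
  by rewrite theta0 addr0 -[X in X - _]mulrA subrr.
- by rewrite [X in _ - X]mulrCA subrr.
Qed.

Lemma tensor_valueE U (u : {v | zset U v}) w (D : tangent F U) (s : OX F m U) :
  tensor_value u w (tens D s) = theta D (sval u) w * Defs.tval s u.
Proof.
rewrite /tensor_value /tens (quotliftE (freelift_semilinear _ _) (@tensor_value_killed _ u w)).
by rewrite freelift_gen.
Qed.

Lemma tensor_value_semilinear U (u : {v | zset U v}) w :
  semilinear_map (evat u) (tensor_value u w).
Proof. exact: (quotlift_semilinear (freelift_semilinear _ _) (@tensor_value_killed _ u w)). Qed.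

Lemma tensor_value_res U W (WU : zset W `<=` zset U) (u : {v | zset W v}) w x :
  tensor_value u w (res WU x) = tensor_value (Defs.incl WU u) w x.
Proof.
have L := tensor_value_semilinear (Defs.incl WU u) w; have L' := tensor_value_semilinear u w.
have R := res_semilinear (p := E) WU.
elim/tensor_ind: x => [|a D s x IH]; first by rewrite (semilin0 R) (semilin0 L) (semilin0 L').
rewrite L R L' IH; congr (_ *: _ + _).
rewrite tensor_valueE [res _ _]tensor_mapE; try exact: res_semilinear.
by rewrite tensor_valueE theta_res //; exact: svalP.
Qed.

Local Notation S := (sympow_presheaf E k).

Definition sympow_gen_value U (u : {v | zset U v}) w (t : {ffun 'I_k -> E U}) : C^o :=
  \prod_i tensor_value u w (t i).

Definition sympow_value U (u : {v | zset U v}) w : S U -> C^o :=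
  quotlift (freelift (evat u) (sympow_gen_value u w)).

Lemma sympow_gen_value_subst U (u : {v | zset U v}) w (t : {ffun 'I_k -> E U}) i x :
  sympow_gen_value u w (subst_at t i x) =
  tensor_value u w x * \prod_(j | j != i) tensor_value u w (t j).
Proof.
rewrite /sympow_gen_value (bigD1 i) //= ffunE eqxx; congr (_ * _).
by apply: eq_bigr => j ji; rewrite ffunE (negPf ji).
Qed.

Lemma sympow_value_killed U (u : {v | zset U v}) w x : sym_rel x ->
  freelift (evat u) (sympow_gen_value u w) x = 0.
Proof.
have L := freelift_semilinear (evat u) (sympow_gen_value u w).
have T := tensor_value_semilinear u w.
case=> [t i y z|t i a y|t s];
  rewrite !(semilinB L) ?(semilinZ L) !freelift_gen ?sympow_gen_value_subst /=.
- by rewrite (semilinD T) mulrDl addrAC addrK subrr.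
- by rewrite (semilinZ T) -[X in X - _]mulrA subrr.
apply/eqP; rewrite subr_eq0; apply/eqP; rewrite /sympow_gen_value.
rewrite [RHS](reindex_inj (h := s)) //=; last exact: perm_inj.
by apply: eq_bigr => j _; rewrite ffunE.
Qed.

Lemma sympow_valueE U (u : {v | zset U v}) w (t : {ffun 'I_k -> E U}) :
  sympow_value u w (symprod t) = \prod_i tensor_value u w (t i).
Proof.
rewrite /sympow_value /symprod (quotliftE (freelift_semilinear _ _) (@sympow_value_killed _ u w)).
by rewrite freelift_gen.
Qed.

Lemma sympow_value_semilinear U (u : {v | zset U v}) w :
  semilinear_map (evat u) (sympow_value u w).
Proof. exact: (quotlift_semilinear (freelift_semilinear _ _) (@sympow_value_killed _ u w)). Qed.

Lemma sympow_value_res U W (WU : zset W `<=` zset U) (u : {v | zset W v}) w x :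
  sympow_value u w (res WU x) = sympow_value (Defs.incl WU u) w x.
Proof.
have L := sympow_value_semilinear (Defs.incl WU u) w; have L' := sympow_value_semilinear u w.
have R := res_semilinear (p := S) WU.
elim/sympow_ind: x => [|a t x IH]; first by rewrite (semilin0 R) (semilin0 L) (semilin0 L').
rewrite L R L' IH; congr (_ *: _ + _).
rewrite sympow_valueE [res _ _]sympow_mapE; last exact: (res_semilinear (p := E)).
by rewrite sympow_valueE; apply: eq_bigr => i _; rewrite ffunE (tensor_value_res WU).
Qed.

Lemma sympow_value_point U (u u' : {v | zset U v}) w x :
  sval u = sval u' -> sympow_value u w x = sympow_value u' w x.
Proof.
case: u u' => [u hu] [u' hu'] /= e; rewrite -e in hu' *.
by rewrite (Prop_irrelevance hu hu').
Qed.

Lemma tensor_value_ext U (u : {v | zset U v}) w w' x :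
  (forall D : derivation U, theta D (sval u) w = theta D (sval u) w') ->
  tensor_value u w x = tensor_value u w' x.
Proof.
move=> h; have L := tensor_value_semilinear u w; have L' := tensor_value_semilinear u w'.
elim/tensor_ind: x => [|a D s x IH]; first by rewrite (semilin0 L) (semilin0 L').
by rewrite L L' IH !tensor_valueE h.
Qed.

Lemma sympow_value_shift U (u : {v | zset U v}) w (c : 'cV_q.+1) x :
  sympow_value u (w + c *m sval u) x = sympow_value u w x.
Proof.
have L := sympow_value_semilinear u (w + c *m sval u); have L' := sympow_value_semilinear u w.
elim/sympow_ind: x => [|a t x IH]; first by rewrite (semilin0 L) (semilin0 L').
rewrite L L' IH !sympow_valueE; congr (_ *: _ + _); apply: eq_bigr => i _.
by apply: tensor_value_ext => D; rewrite theta_shift.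
Qed.

Lemma sympow_value_self U (u : {v | zset U v}) w i x : (0 < k)%N -> row i w = sval u ->
  sympow_value u w x = 0.
Proof.
move=> k0 wi; have L := sympow_value_semilinear u w; have T := tensor_value_semilinear u w.
have T0 y : tensor_value u w y = 0.
  elim/tensor_ind: y => [|a D s y IH]; first by rewrite (semilin0 T).
  by rewrite T IH tensor_valueE (theta_self _ wi) mul0r scaler0 addr0.
elim/sympow_ind: x => [|a t x IH]; first by rewrite (semilin0 L).
rewrite L IH sympow_valueE (bigD1 (Ordinal k0)) //= T0 mul0r scaler0 addr0.
by [].
Qed.

End Evaluation.

Lemma ev2_mconstM (C : closedFieldType) r n (w : 'rV[C]_r) (y : 'rV[C]_n) Q
    (P : {mpoly {mpoly C[r]}[n]}) : ev2 w y (mconst r Q * P) = ev Q y * ev2 w y P.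
Proof. by rewrite rmorphM /= ev2_const. Qed.

(** * Local expression of the evaluation of a section *)

Section LocalForm.
Variables (C : closedFieldType) (q m k : nat).
Local Notation N := (q.+4).
Variables (F : {mpoly C[N]}).
Hypotheses (hF : F \is m.+3.-homog) (smooth : smooth_hypersurface F).
Local Notation V := 'rV[C]_N.
Local Notation frame := (@tangent_frame C q.+1 F).
Variables (U : zopen F) (x0 : V).
Hypothesis Ux0 : zset U x0.
Local Notation Pt := {v | zset U v}.
Implicit Types (f g : Pt -> 'M[C]_(q.+1, N) -> C).

(** Locally a quotient of degree [a - b] in the point, polynomial in the frame; [a] and [b] are kept
    apart because degrees are natural numbers. *)
Definition local_form a b f := exists e (Q : {mpoly C[N]}) (P : {mpoly {mpoly C[q.+1 * N]}[N]}),
  [/\ Q \is (e + b).-homog, ev Q x0 != 0, P \is (e + a).-homog &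
    forall (y : Pt) w, frame (sval y) w ->
      ev Q (sval y) * f y w = ev2 (mxvec w) (sval y) P].

(** Multiplied by [R], the required equation is trivial at the points where [f] and [g] may
    differ. *)
Lemma local_form_near e R a b f g : R \is e.-homog -> ev R x0 != 0 ->
  (forall (y : Pt) w, frame (sval y) w -> ev R (sval y) != 0 -> f y w = g y w) ->
  local_form a b g -> local_form a b f.
Proof.
move=> hR Rx fg [e' [Q [P [hQ Qx hP QP]]]].
exists (e + e')%N, (R * Q), (mconst _ R * P); split.
- by rewrite -addnA; apply: dhomogM.
- by rewrite evM mulf_neq0.
- by rewrite -addnA; apply: dhomogM => //; exact: mconst_homog.
move=> y w Z; rewrite evM ev2_mconstM -QP // -mulrA.
by have [->|Ry] := eqVneq (ev R (sval y)) 0; rewrite ?mul0r // fg.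
Qed.

Lemma local_form_ext a b f g : (forall y w, f y w = g y w) -> local_form a b g -> local_form a b f.
Proof.
move=> fg; apply: (@local_form_near 0 1); first exact: dhomog1.
  by rewrite ev1 oner_neq0.
by move=> y w _ _; exact: fg.
Qed.

Lemma local_form_add a b f g : local_form a b f -> local_form a b g ->
  local_form a b (fun y w => f y w + g y w).
Proof.
move=> [e [Q [P [hQ Qx hP QP]]]] [e' [Q' [P' [hQ' Qx' hP' QP']]]].
exists (e + e' + b)%N, (Q * Q'), (mconst _ Q' * P + mconst _ Q * P'); split.
- have -> : (e + e' + b + b = e + b + (e' + b))%N by ring.
  exact: dhomogM.
- by rewrite evM mulf_neq0.
- apply: rpredD.
    have -> : (e + e' + b + a = e' + b + (e + a))%N by ring.
    by apply: dhomogM => //; exact: mconst_homog.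
  have -> : (e + e' + b + a = e + b + (e' + a))%N by ring.
  by apply: dhomogM => //; exact: mconst_homog.
move=> y w Z; rewrite rmorphD [X in _ = X + _]ev2_mconstM.
rewrite [X in _ = _ + X]ev2_mconstM evM.
rewrite -QP // -QP' //.
by rewrite mulrDr -!mulrA [ev Q' _ * (_ * _)]mulrCA.
Qed.

Lemma local_form_mul a b a' b' f g : local_form a b f -> local_form a' b' g ->
  local_form (a + a') (b + b') (fun y w => f y w * g y w).
Proof.
move=> [e [Q [P [hQ Qx hP QP]]]] [e' [Q' [P' [hQ' Qx' hP' QP']]]].
exists (e + e')%N, (Q * Q'), (P * P'); split.
- by rewrite addnACA; apply: dhomogM.
- by rewrite evM mulf_neq0.
- by rewrite addnACA; apply: dhomogM.
by move=> y w Z; rewrite rmorphM /= evM -QP // -QP' // mulrACA.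
Qed.

Lemma local_form_shift c a b f : local_form (a + c) (b + c) f -> local_form a b f.
Proof.
move=> [e [Q [P [hQ Qx hP QP]]]]; exists (e + c)%N, Q, P; split=> //.
  by rewrite -addnA [(c + b)%N]addnC.
by rewrite -addnA [(c + a)%N]addnC.
Qed.

Lemma local_form_poly e A : A \is e.-homog -> local_form e 0 (fun y _ => ev A (sval y)).
Proof.
move=> hA; exists 0%N, 1, (mconst _ A); split; first exact: dhomog1.
- by rewrite ev1 oner_neq0.
- exact: mconst_homog.
by move=> y w _; rewrite ev1 mul1r ev2_const.
Qed.

Lemma local_form_entry i j : local_form 0 0 (fun _ w => w i j).
Proof.
exists 0%N, 1, ('X_(mxvec_index i j))%:MP; split; first exact: dhomog1.
- by rewrite ev1 oner_neq0.
- by rewrite -[_%:MP]mulr1 mul_mpolyC; apply: rpredZ; exact: dhomog1.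
by move=> y w _; rewrite ev1 mul1r ev2C evX mxvecE.
Qed.

Lemma local_form_cst c : local_form 0 0 (fun _ _ => c).
Proof.
apply: (local_form_ext _ (@local_form_poly 0 c%:MP _)) => [y w|]; first by rewrite evC.
by rewrite -[_%:MP]mulr1 mul_mpolyC; apply: rpredZ; exact: dhomog1.
Qed.

Lemma local_form_inv e A : A \is e.-homog -> ev A x0 != 0 ->
  local_form 0 e (fun y _ => (ev A (sval y))^-1).
Proof.
(* The fraction is [A / (A * A)], since the equation must also hold where [A] vanishes and the
   inverse is 0 by convention. *)
move=> hA Ax; exists e, (A * A), (mconst _ A); split; first exact: dhomogM.
- by rewrite evM mulf_neq0.
- by rewrite addn0; exact: mconst_homog.
move=> y w _; rewrite evM ev2_const.
have [->|Ay] := eqVneq (ev A (sval y)) 0; first by rewrite !mul0r.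
by rewrite mulfK.
Qed.

Lemma local_form_sum a (I : Type) (r : seq I) (f : I -> Pt -> 'M[C]_(q.+1, N) -> C) :
  (forall i, local_form a 0 (f i)) -> local_form a 0 (fun y w => \sum_(i <- r) f i y w).
Proof.
move=> h; elim: r => [|i r IH].
  exists 0%N, 1, 0; split; first exact: dhomog1.
  - by rewrite ev1 oner_neq0.
  - exact: rpred0.
  by move=> y w _; rewrite big_nil mulr0 rmorph0.
by apply: (local_form_ext _ (local_form_add (h i) IH)) => y w; rewrite big_cons.
Qed.

Lemma local_form_prod (I : Type) (r : seq I) (a b : I -> nat)
    (f : I -> Pt -> 'M[C]_(q.+1, N) -> C) : (forall i, local_form (a i) (b i) (f i)) ->
  local_form (\sum_(i <- r) a i) (\sum_(i <- r) b i) (fun y w => \prod_(i <- r) f i y w).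
Proof.
move=> h; elim: r => [|i r IH].
  by rewrite !big_nil; apply: (local_form_ext _ (local_form_cst 1)) => y w; rewrite big_nil.
rewrite !big_cons.
by apply: (local_form_ext _ (local_form_mul (h i) IH)) => y w; rewrite big_cons.
Qed.

Lemma local_form_det n (a : 'I_n -> nat) (A : Pt -> 'M[C]_(q.+1, N) -> 'M[C]_n) :
  (forall i j, local_form (a i) 0 (fun y w => A y w i j)) ->
  local_form (\sum_i a i) 0 (fun y w => \det (A y w)).
Proof.
move=> h; apply: local_form_sum => s; rewrite -[(\sum_i a i)%N]add0n -[X in local_form _ X]add0n.
apply: local_form_mul; first exact: local_form_cst.
have := local_form_prod (index_enum 'I_n) (b := fun=> 0%N) (fun i => h i (s i)).
by rewrite big1_eq.
Qed.

Lemma local_form_rv e (W : zopen F) (g : {v | zset W v} -> C) : regular F e g -> zset W x0 ->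
  local_form e 0 (fun y _ => rv g (sval y)).
Proof.
move=> gr Wx; have [d [A [B [hA hB Bx AB]]]] := regular_local gr Wx.
apply: (local_form_near hB Bx (g := fun y _ => ev A (sval y) * (ev B (sval y))^-1)).
  move=> y w [y0 Fy _] By; have [|_ ->] := AB (sval y) _ By; last by [].
  by split.
apply: (local_form_shift (c := d)); rewrite add0n addnC -[d in local_form _ d]add0n -[(d + e)%N]addn0.
by apply: local_form_mul; [exact: local_form_poly|exact: local_form_inv].
Qed.

(** The rows [x] and the lift of [D x] have degree 1, the others degree 0, and the denominator is a
    derivative of [F]. A section of the twist by [m] then compensates the degree in
    [local_form_tensor]. *)
Lemma local_form_theta (D : derivation U) : local_form 2 m.+2 (fun y w => theta D (sval y) w).
Proof.
have [x00 Fx0] := zopen_sub Ux0; have xb := pick_coordP x00; have xa := pick_gradP smooth x00 Fx0.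
set b := pick_coord x0 in xb; set a := pick_grad F x0 in xa.
have hFa : F^`M(a) \is m.+2.-homog by exact: dhomog_deriv.
pose g (y : Pt) w := vol (sval y) (vfield D b (sval y)) (delta_mx ord0 a) w *
  (ev F^`M(a) (sval y))^-1.
apply: (@local_form_near (1 + m.+2) ('X_b * F^`M(a)) _ _ _ g).
- by apply: dhomogM => //; exact: mpolyX_homog1.
- by rewrite evM evX mulf_neq0.
- move=> y w Z; rewrite evM evX mulf_eq0 negb_or => /andP[yb ya].
  exact: (theta_eq hF smooth D (svalP y) Z yb ya).
rewrite -[2%N]addn0 -[m.+2]add0n; apply: local_form_mul; last exact: local_form_inv.
have -> : 2%N = (\sum_(i < N) (i < 2)%N)%N.
  by rewrite !big_ord_recl /= big1.
have hX i : local_form 1 0 (fun y _ => sval y ord0 i).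
  apply: (local_form_ext _ (local_form_poly (mpolyX_homog1 _ i))) => y w.
  by rewrite evX.
apply: local_form_det => i j; rewrite /vol_mx; case: i => [[|[|[|i]]] hi] /=.
- by apply: (local_form_ext _ (hX j)) => y w; rewrite mxE.
- have gr : regular F 0 (rval (der D (@chart_sub C N F U b) (coord_ratio (@chart_coord C N F U b) j))).
    by apply/asboolP; exact: rvalP.
  have cx : zset (chart U b) x0 by apply/chartP.
  apply: (local_form_ext _ (local_form_mul (hX b) (local_form_rv gr cx))) => y w.
  by rewrite !mxE.
- by apply: (local_form_ext _ (local_form_cst ((delta_mx ord0 a : 'rV[C]_N) ord0 j))) => y w; rewrite [LHS]mxE.
- apply: (local_form_ext _ (local_form_entry (inord i) j)) => y w.
  by rewrite !mxE.
Qed.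

Lemma local_form_regfun (a : regfun U) : local_form 0 0 (fun y _ => evat y a).
Proof.
have gr : regular F 0 (rval a) by apply/asboolP; exact: rvalP.
by apply: (local_form_ext _ (local_form_rv gr Ux0)) => y w; rewrite rv_sval.
Qed.

Local Notation E := (tensor_presheaf (tangent F) (OX F m)).

Lemma local_form_tensor (x : E U) : local_form 0 0 (fun y w => tensor_value y w x).
Proof.
elim/tensor_ind: x => [|a D s x IH].
  apply: (local_form_ext _ (local_form_cst 0)) => y w.
  exact: (semilin0 (tensor_value_semilinear y w)).
have sr : regular F m (Defs.tval s) by apply/asboolP; exact: tvalP.
have T : local_form 0 0 (fun y w => tensor_value y w (tens D s)).
  apply: (local_form_shift (c := m.+2)); rewrite !add0n -[m.+2 in X in local_form _ X]addn0.
  apply: (local_form_ext _ (local_form_mul (local_form_theta D) (local_form_rv sr Ux0))) => y w.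
  by rewrite tensor_valueE rv_sval.
apply: (local_form_ext _ (local_form_add (local_form_mul (local_form_regfun a) T) IH)) => y w.
exact: (tensor_value_semilinear y w).
Qed.

Local Notation S := (sympow_presheaf E k).

Lemma local_form_sympow (x : S U) : local_form 0 0 (fun y w => sympow_value y w x).
Proof.
elim/sympow_ind: x => [|a t x IH].
  apply: (local_form_ext _ (local_form_cst 0)) => y w.
  exact: (semilin0 (sympow_value_semilinear y w)).
have T : local_form 0 0 (fun y w => sympow_value y w (symprod t)).
  have := local_form_prod (index_enum 'I_k) (a := fun=> 0%N) (b := fun=> 0%N)
    (f := fun i y w => tensor_value y w (t i)) (fun i => local_form_tensor (t i)).
  rewrite big1_eq => h; apply: (local_form_ext _ h) => y w.
  by rewrite sympow_valueE.
apply: (local_form_ext _ (local_form_add (local_form_mul (local_form_regfun a) T) IH)) => y w.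
exact: (sympow_value_semilinear y w).
Qed.

Lemma local_form_good (x : S U) (phi : V -> 'M[C]_(q.+1, N) -> C) :
  (forall (y : Pt) w, frame (sval y) w -> phi (sval y) w = sympow_value y w x) ->
  exists e Q, [/\ Q \is e.-homog, ev Q x0 != 0 & @good C q.+1 F phi e Q].
Proof.
move=> phiE; have [e [Q [P [hQ Qx hP QP]]]] := local_form_sympow x.
have [e' [R [hR Rx RU]]] := zopen_prin Ux0; rewrite !addn0 in hQ hP.
exists (e' + e)%N, (R * Q); split; first exact: dhomogM.
  by rewrite evM mulf_neq0.
exists (mconst _ R * P); first by apply: dhomogM => //; exact: mconst_homog.
move=> y w Z; rewrite evM ev2_mconstM -mulrA.
have [->|Ry] := eqVneq (ev R y) 0; first by rewrite !mul0r.
have [y0 Fy _] := Z; have Uy : zset U y by apply: RU.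
by rewrite (phiE (exist _ y Uy)) // (QP (exist _ y Uy)).
Qed.

End LocalForm.

(** * Detection of sections *)

Lemma scale_combination (R : comPzRingType) (M : lmodType R) n (r f : R) (c c' : 'I_n -> R)
    (e : 'I_n -> M) : r *: (f *: \sum_i c i *: e i) + \sum_i c' i *: e i =
  \sum_i (r * (f * c i) + c' i) *: e i.
Proof.
rewrite !scaler_sumr -big_split; apply: eq_bigr => i _.
by rewrite scalerDl !scalerA mulrA.
Qed.

(** * Generators of a symmetric power *)

Section SymPowerBasis.
Variables (R : comPzRingType) (M : lmodType R) (k n : nat) (b : 'I_n -> M).
Local Notation idx := {ffun 'I_k -> 'I_n}.

Definition sym_monomial (f : idx) : sympow M k := symprod [ffun i => b (f i)].

Lemma symprod_expand (t : {ffun 'I_k -> M}) :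
  (forall x : M, exists c : 'I_n -> R, x = \sum_i c i *: b i) ->
  exists c : idx -> R, symprod t = \sum_f c f *: sym_monomial f.
Proof.
(* Induction on the number [j] of leading factors still to be expanded. *)
move=> hb; suff H j : (j <= k)%N -> forall t : {ffun 'I_k -> M},
    (forall i : 'I_k, (j <= i)%N -> exists l, t i = b l) ->
    exists c : idx -> R, symprod t = \sum_f c f *: sym_monomial f.
  by apply: (H k) => // i; rewrite leqNgt ltn_ord.
elim: j => [_|j IH jk] {}t ht.
  have /choice[l hl] i : exists l, t i = b l by exact: ht.
  exists (fun f => (f == [ffun i => l i])%:R); rewrite (bigD1 [ffun i => l i]) //= eqxx scale1r.
  rewrite big1 ?addr0 => [|f /negPf ->]; last by rewrite scale0r.
  by congr symprod; apply/ffunP => i; rewrite !ffunE hl.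
pose i0 := Ordinal jk; have [c cE] := hb (t i0).
have te x : t i0 = x -> t = subst_at t i0 x.
  by move=> tx; apply/ffunP => i; rewrite ffunE; case: eqP => [->|].
have /choice[d dE] l : exists d : idx -> R,
    symprod (subst_at t i0 (b l)) = \sum_f d f *: sym_monomial f.
  apply: (IH (ltnW jk)) => i ji; rewrite ffunE; case: eqP => [_|ii0]; first by exists l.
  by apply: ht; rewrite ltn_neqAle ji andbT; apply: contra_not_neq ii0 => e; apply: val_inj.
exists (fun f => \sum_l c l * d l f); rewrite (te _ cE).
transitivity (\sum_l c l *: symprod (subst_at t i0 (b l))).
  elim/big_rec2: _ => [|l x y _ <-]; last by rewrite symprodD symprodZ.
  by have := symprodZ t i0 0 0; rewrite scaler0 scale0r.
under eq_bigr do rewrite dE scaler_sumr; rewrite exchange_big; apply: eq_bigr => f _.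
by rewrite scaler_suml; apply: eq_bigr => l _; rewrite scalerA.
Qed.

Lemma sympow_expand (x : sympow M k) :
  (forall x : M, exists c : 'I_n -> R, x = \sum_i c i *: b i) ->
  exists c : idx -> R, x = \sum_f c f *: sym_monomial f.
Proof.
move=> hb; elim/sympow_ind: x => [|a t x [c ->]].
  by exists (fun=> 0); rewrite big1 // => f _; rewrite scale0r.
have [d ->] := symprod_expand t hb; exists (fun f => a * d f + c f).
by rewrite scaler_sumr -big_split; apply: eq_bigr => f _; rewrite scalerDl scalerA.
Qed.

Definition idx_mnm (f : idx) : 'X_{1..n} := (\sum_i U_(f i))%MM.

Lemma sym_monomial_mnm f g : idx_mnm f = idx_mnm g -> sym_monomial f = sym_monomial g.
Proof.
move=> fg; have /tuple_permP[s sE] : perm_eq [tuple f i | i < k] [tuple g i | i < k].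
  apply/allP => j _ /=; apply/eqP.
  have cE (h : idx) : count_mem j [tuple h i | i < k] = idx_mnm h j.
    rewrite -[tuple.tval _]/(map h (tuple.tval (ord_tuple k))) val_ord_tuple count_map -sum1_count.
    rewrite /idx_mnm mnm_sumE [RHS]big_mkcond /= big_enum_cond /=.
    by rewrite big_mkcond; apply: eq_bigr => i _; rewrite mnm1E /=; case: eqP.
  by rewrite !cE fg.
rewrite /sym_monomial -(symprod_perm [ffun i => b (g i)] s); congr symprod; apply/ffunP => i.
rewrite !ffunE; congr b; have := congr1 (fun r => nth (f i) r i) sE.
by rewrite -!(tnth_nth (f i)) !tnth_mktuple.
Qed.

(** Indices with the same exponents give the same monomial; they are grouped under a common
    representative [r f], and their coefficients add up to 0. *)
Lemma sym_combination_eq0 (c : idx -> R) :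
  (forall m, \sum_(f | idx_mnm f == m) c f = 0) -> \sum_f c f *: sym_monomial f = 0.
Proof.
move=> h; pose r f := odflt f [pick g | idx_mnm g == idx_mnm f].
have rP f : idx_mnm (r f) = idx_mnm f.
  by rewrite /r; case: pickP => /= [g /eqP//|].
have rE f g : idx_mnm f = idx_mnm g -> r f = r g.
  rewrite /r => fg; rewrite (eq_pick (Q := fun g' => idx_mnm g' == idx_mnm g)) => [|g']; last by rewrite fg.
  by case: pickP => //= /(_ g); rewrite eqxx.
rewrite (partition_big r xpredT) //= big1 // => g _.
under eq_bigr => f /eqP rf do rewrite -(sym_monomial_mnm (rP f)) rf.
rewrite -scaler_suml; have [rg|rg] := eqVneq (r g) g; last first.
  rewrite big_pred0 ?scale0r // => f; apply: contraNF rg => /eqP <-.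
  by rewrite (rE (r f) f).
rewrite (_ : \sum_(f | _) _ = 0) ?scale0r // -[RHS](h (idx_mnm g)); apply: eq_bigl => f.
by apply/eqP/eqP => [<-|fg]; [rewrite rP|rewrite (rE f g)].
Qed.

End SymPowerBasis.

(** * Derivations from tangent vector fields *)

Section VectorField.
Variables (C : closedFieldType) (M d : nat).
Local Notation N := (M.+3).
Variables (F : {mpoly C[N]}).
Hypotheses (hF : F \is d.-homog) (d_gt0 : (0 < d)%N) (smooth : smooth_hypersurface F).
Local Notation V := 'rV[C]_N.
Local Notation X := (hypersurface F).
Implicit Types (U W Z : zopen F) (u v : V) (A B : {mpoly C[N]}).

(** [B * B' * (A * B' - A' * B)] vanishes on all of [X], so it is a multiple of [F], and its
    derivative along a tangent vector is zero. *)
Lemma quot_dev_unique Z (f : {v | zset Z v} -> C) u A B A' B' t : X u ->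
  rep f u A B -> rep f u A' B' -> dev F u t = 0 -> quot_dev A B u t = quot_dev A' B' u t.
Proof.
move=> Xu [_ Bu AB] [_ B'u AB'] Ft.
have E v : X v -> ev B v != 0 -> ev B' v != 0 -> ev A v * ev B' v = ev A' v * ev B v.
  move=> Xv Bv Bv'; have [_ e] := AB v Xv Bv; have [_ e'] := AB' v Xv Bv'.
  by apply/eqP; rewrite -eqr_div // -e -e'.
have [c cE] : divides F (B * B' * (A * B' - A' * B)).
  apply: (vanish_divides hF d_gt0 smooth) => v v0 Fv; rewrite !evM evB !evM.
  have [->|Bv] := eqVneq (ev B v) 0; first by rewrite !mul0r.
  have [->|Bv'] := eqVneq (ev B' v) 0; first by rewrite mulr0 mul0r.
  by rewrite E ?subrr ?mulr0.
have := congr1 (fun P => dev P u t) cE; rewrite (devM c) Ft (proj2 Xu) !mulr0 addr0.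
have e := E u Xu Bu B'u; rewrite devM evB !evM e subrr mulr0 add0r.
have devB P Q : dev (P - Q) u t = dev P u t - dev Q u t.
  by rewrite devD -mulN1r -(mpolyC1 _ C) -mpolyCN devM devC mul0r add0r evC mulN1r.
move/eqP; rewrite mulf_eq0 (negPf (mulf_neq0 Bu B'u)) /= devB !devM subr_eq0 => /eqP.
rewrite /quot_dev; move: e; move: (ev A u) (ev B u) Bu (ev A' u) (ev B' u) B'u.
move: (dev A u t) (dev B u t) (dev A' u t) (dev B' u t) => da db da' db' a b b0 a' b' b0' e h.
have -> : a' = a * b' / b by rewrite e mulfK.
have -> : da' = (da * b' + a * db' - a * b' / b * db) / b.
  by apply: (mulIf b0); rewrite divfK // h e mulfK // addrK.
by field; rewrite b0 b0'.
Qed.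

Lemma rep_add Z (f g : regfun Z) u A B A' B' : rep (rval f) u A B -> rep (rval g) u A' B' ->
  rep (rval (f + g)) u (A * B' + A' * B) (B * B').
Proof.
move=> [[e [hA hB]] Bu AB] [[e' [hA' hB']] Bu' AB']; split; last first.
- move=> v Xv; rewrite evM mulf_eq0 negb_or => /andP[Bv Bv'].
  have [Zv e1] := AB v Xv Bv; have [_ e2] := AB' v Xv Bv'; split=> //.
  by rewrite rv_add e1 e2 evD !evM addf_div.
- by rewrite evM mulf_neq0.
exists (e + e').+1; rewrite -addSn -addnS; split; last exact: dhomogM.
by apply: rpredD; [exact: dhomogM|rewrite addnC; exact: dhomogM].
Qed.

Lemma rep_mul Z (f g : regfun Z) u A B A' B' : rep (rval f) u A B -> rep (rval g) u A' B' ->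
  rep (rval (f * g)) u (A * A') (B * B').
Proof.
move=> [[e [hA hB]] Bu AB] [[e' [hA' hB']] Bu' AB']; split; last first.
- move=> v Xv; rewrite evM mulf_eq0 negb_or => /andP[Bv Bv'].
  have [Zv e1] := AB v Xv Bv; have [_ e2] := AB' v Xv Bv'; split=> //.
  by rewrite rv_mul e1 e2 !evM mulf_div.
- by rewrite evM mulf_neq0.
by exists (e + e').+1; rewrite -addSn -addnS; split; exact: dhomogM.
Qed.

Lemma rep_cst Z c u A B : rep (rval (regcst Z c)) u A B -> rep (rval (regcst Z c)) u (c *: B) B.
Proof.
move=> [[e [hA hB]] Bu AB]; split=> //; first by exists e; split=> //; exact: rpredZ.
move=> v Xv Bv; have [Zv _] := AB v Xv Bv; split=> //.
by rewrite rv_cst // evZ mulfK.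
Qed.

Lemma rep_res Z Z' (ZZ : zset Z' `<=` zset Z) (f : regfun Z) u A B :
  rep (rval (regfun_res ZZ f)) u A B -> rep (rval f) u A B.
Proof.
move=> [hA Bu AB]; split=> // v Xv Bv; have [Zv <-] := AB v Xv Bv.
by split; [exact: (ZZ _ Zv)|rewrite rv_res].
Qed.

Variables (W : zopen F) (G : 'I_N -> {mpoly C[N]}) (H : {mpoly C[N]}) (h : nat).
Hypotheses (hG : forall i, G i \is h.+1.-homog) (hH : H \is h.-homog).
Hypothesis HW : forall v, zset W v -> ev H v != 0.

(** Of degree 1 in [v], so that derivatives of functions of degree 0 have degree 0 again. *)
Definition field_at v : V := (ev H v)^-1 *: \row_i ev (G i) v.

Hypothesis tangW : forall v, zset W v -> dev F v (field_at v) = 0.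

Lemma rep_pair Z (f : regfun Z) (u : {v | zset Z v}) :
  exists AB, rep (rval f) (sval u) AB.1 AB.2.
Proof. by have [A [B AB]] := rep_exists f (svalP u); exists (A, B). Qed.

(** A representation is chosen at each point; by [quot_dev_unique] the value does not depend on
    it. *)
Definition field_fun Z (f : regfun Z) (u : {v | zset Z v}) : C :=
  let AB := sval (cid (rep_pair f u)) in quot_dev AB.1 AB.2 (sval u) (field_at (sval u)).

Lemma field_funE Z (ZW : zset Z `<=` zset W) (f : regfun Z) (u : {v | zset Z v}) A B :
  rep (rval f) (sval u) A B -> field_fun f u = quot_dev A B (sval u) (field_at (sval u)).
Proof.
move=> AB; apply: quot_dev_unique (svalP (cid (rep_pair f u))) AB _.
  exact: zopen_sub (svalP u).
by apply/tangW/ZW/svalP.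
Qed.

Lemma field_fun_regular Z (ZW : zset Z `<=` zset W) (f : regfun Z) : regular F 0 (field_fun f).
Proof.
move=> u; have [A [B AB]] := rep_exists f (svalP u); have [[e [hA hB]] Bu _] := AB.
have hB' : exists e, B \is e.-homog by exists e.+1.
exists (zprin F hB'); split; first by split=> //; exact: zopen_sub (svalP u).
exists (h + (e.+1 + e.+1))%N, (\sum_i G i * (B * A^`M(i) - A * B^`M(i))), (H * (B * B)); split.
- rewrite addn0; apply: rpred_sum => i _.
  rewrite (_ : h + (e.+1 + e.+1) = h.+1 + (e.+1 + e))%N; last by rewrite !addnS addSn.
  apply: dhomogM => //; apply: rpredB.
    by apply: dhomogM => //; exact: dhomog_deriv.
  by apply: dhomogM => //; exact: dhomog_deriv.
- by do !apply: dhomogM.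
move=> w [Xw Bw]; have Hw := HW (ZW _ (svalP w)); rewrite !evM !mulf_neq0 //; split=> //.
rewrite (field_funE ZW (rep_move AB Bw)) /quot_dev /field_at !devZr.
set v := sval w in Bw Hw *; set g := \row_i ev (G i) v.
have -> : ev (\sum_i G i * (B * A^`M(i) - A * B^`M(i))) v = ev B v * dev A v g - ev A v * dev B v g.
  rewrite ev_sum [X in X - _]mulr_sumr [X in _ - X]mulr_sumr -sumrB; apply: eq_bigr => i _.
  by rewrite /g mxE evM evB !evM; ring.
move: (dev A v g) (dev B v g) (ev A v) (ev B v) (ev H v) Bw Hw => x y s t r t0 r0.
by field; rewrite t0 r0.
Qed.

Program Definition field_der : derivation W :=
  @Derivation C N F W (fun Z ZW f => RegFun (asboolT (field_fun_regular ZW f))) _ _ _ _.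
Next Obligation.
apply/val_inj/funext => u /=; have [A [B AB]] := rep_exists f (svalP u); have [A' [B' AB']] := rep_exists g (svalP u).
have [_ Bu _] := AB; have [_ Bu' _] := AB'.
rewrite -[RHS]/(field_fun f u + field_fun g u).
rewrite (field_funE WU AB) (field_funE WU AB') (field_funE WU (rep_add AB AB')).
rewrite /quot_dev devD !devM evD !evM; move: (sval u) Bu Bu' => v Bv Bv'.
by field; rewrite Bv Bv'.
Qed.
Next Obligation.
apply/val_inj/funext => u /=; have [A [B AB]] := rep_exists f (svalP u); have [A' [B' AB']] := rep_exists g (svalP u).
have [_ Bu E] := AB; have [_ Bu' E'] := AB'; have Xu := zopen_sub (svalP u).
rewrite -[RHS]/(f u * field_fun g u + g u * field_fun f u).
rewrite (field_funE WU AB) (field_funE WU AB') (field_funE WU (rep_mul AB AB')).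
have [_] := E _ Xu Bu; rewrite rv_sval => ->; have [_] := E' _ Xu Bu'; rewrite rv_sval => ->.
rewrite /quot_dev !devM !evM; move: (sval u) Bu Bu' {Xu} => v Bv Bv'.
by field; rewrite Bv Bv'.
Qed.
Next Obligation.
apply/val_inj/funext => u /=; have [A [B AB]] := rep_exists (regcst W0 c) (svalP u).
rewrite (field_funE WU (rep_cst AB)) /quot_dev -mul_mpolyC devM devC evM evC mul0r add0r.
by rewrite mulrCA mulrA subrr mul0r.
Qed.
Next Obligation.
apply/val_inj/funext => u /=; have [A [B AB]] := rep_exists (regfun_res ZW f) (svalP u).
rewrite (field_funE ZU AB) -[RHS]/(field_fun f (Defs.incl ZW u)).
by rewrite (field_funE WU (u := Defs.incl ZW u) (rep_res AB)).
Qed.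

(** [vfield] is the lift with constant coordinate [b], whence the condition on that coordinate of
    [field_at]. *)
Lemma vfield_field_der b u : zset W u -> u ord0 b != 0 -> field_at u ord0 b = 0 ->
  vfield field_der b u = field_at u.
Proof.
move=> Wu ub fb; have cu : zset (chart W b) u by apply/chartP.
apply/rowP => i; rewrite [LHS]mxE [X in _ * X = _]mxE (rvE _ cu) /=.
have [A [B [AB AE]]] := coord_ratio_rep i cu.
rewrite (field_funE (@chart_sub _ _ _ W b) (u := exist _ u cu) AB) /= AE fb mulr0 subr0.
by move: (field_at u ord0 i) => t; field.
Qed.

End VectorField.

Lemma derivation_eq (C : closedFieldType) N (F : {mpoly C[N]}) (W : zopen F) b
    (D D' : derivation W) : (forall v, zset W v -> v ord0 b != 0) ->
  (forall u, zset W u -> vfield D b u = vfield D' b u) -> D = D'.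
Proof.
move=> Wb DD; apply: derivationP => Z ZW f; apply: regfunP => u Zu.
have [A [B AB]] := rep_exists f Zu; have ub := Wb u (ZW u Zu).
by rewrite (der_at D ZW Zu ub AB) (der_at D' ZW Zu ub AB) DD //; exact: ZW.
Qed.

(** * A local basis and the detection of sections *)

Section Chart.
Variables (C : closedFieldType) (q m k : nat).
Local Notation N := (q.+4).
Variables (F : {mpoly C[N]}).
Hypotheses (hF : F \is m.+3.-homog) (smooth : smooth_hypersurface F).
Local Notation V := 'rV[C]_N.
Local Notation frame := (@tangent_frame C q.+1 F).
Variables (W : zopen F) (a : 'I_N) (b' : 'I_q.+3).
Local Notation b := (lift a b').
Hypotheses (Wa : forall v, zset W v -> ev F^`M(a) v != 0)
  (Wb : forall v, zset W v -> v ord0 b != 0).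
Implicit Types (u v : V).

Lemma grad_homog i : F^`M(i) \is m.+2.-homog.
Proof. exact: dhomog_deriv. Qed.

(** The [j]-th coordinate field on the chart where the equation is solved for the coordinate [a];
    the factor [u ord0 b] gives it the degree 1 required by [field_at]. *)
Definition tau j u : V :=
  u ord0 b *: (delta_mx ord0 j - (ev F^`M(j) u / ev F^`M(a) u) *: delta_mx ord0 a).

Definition tau_num j i : {mpoly C[N]} :=
  'X_b * ((i == j)%:R *: F^`M(a) - (i == a)%:R *: F^`M(j)).

Lemma tau_num_homog j i : tau_num j i \is m.+3.-homog.
Proof.
rewrite -[tau_num j i \is _]/(tau_num j i \is (1 + m.+2).-homog).
apply: dhomogM; first exact: mpolyX_homog1.
by apply: rpredB; apply: rpredZ; exact: grad_homog.
Qed.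

Lemma field_tau j v : zset W v -> field_at (tau_num j) F^`M(a) v = tau j v.
Proof.
move=> Wv; apply/rowP => i; rewrite !mxE evM evX evB !evZ eqxx /=.
by field; exact: Wa.
Qed.

Lemma tau_tangent j v : zset W v -> dev F v (tau j v) = 0.
Proof.
by move=> Wv; rewrite devZr devBr devZr !dev_delta divfK ?Wa // subrr mulr0.
Qed.

Lemma field_tau_tangent j v : zset W v -> dev F v (field_at (tau_num j) F^`M(a) v) = 0.
Proof. by move=> Wv; rewrite field_tau // tau_tangent. Qed.

Definition partial j : tangent F W :=
  field_der hF isT smooth (tau_num_homog j) (grad_homog a) Wa (@field_tau_tangent j).

Lemma vfield_partial j u : zset W u -> j != b -> vfield (partial j) b u = tau j u.
Proof.
move=> Wu jb; rewrite -field_tau //; apply: vfield_field_der => //; first exact: Wb.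
rewrite field_tau // !mxE eqxx /= [b == j]eq_sym (negPf jb) eq_sym (negPf (neq_lift _ _)).
by rewrite mulr0 subrr mulr0.
Qed.

(** The indices other than [a] and [b], as many as the dimension of [X]. *)
Definition chart_idx (i : 'I_q.+2) : 'I_N := lift a (lift b' i).

Lemma chart_idx_a i : chart_idx i != a.
Proof. by rewrite eq_sym neq_lift. Qed.

Lemma chart_idx_b i : chart_idx i != b.
Proof. by rewrite (inj_eq lift_inj) eq_sym neq_lift. Qed.

Lemma chart_idx_inj : injective chart_idx.
Proof. by move=> i j /lift_inj/lift_inj. Qed.

Lemma chart_idxP j : j != a -> j != b -> exists i, j = chart_idx i.
Proof.
case: (unliftP a j) => [l ->|->]; last by rewrite eqxx.
move=> _; rewrite (inj_eq lift_inj); case: (unliftP b' l) => [i ->|->]; last by rewrite eqxx.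
by exists i.
Qed.

Lemma tangent_eq0 u x : dev F u x = 0 -> ev F^`M(a) u != 0 -> (forall i, i != a -> x ord0 i = 0) ->
  x = 0 :> V.
Proof.
move=> ux Fa x0; apply/rowP => i; rewrite mxE; have [->|/x0//] := eqVneq i a.
move: ux; rewrite /dev (bigD1 a) //= big1 ?addr0 => [/eqP|j /x0 ->]; last by rewrite mul0r.
by rewrite mulf_eq0 (negPf Fa) orbF => /eqP.
Qed.

Lemma vfield_sum (I : Type) (r : seq I) (c : I -> regfun W) (D : I -> tangent F W) u :
  vfield (\sum_(i <- r) c i *: D i : tangent F W) b u =
  \sum_(i <- r) rv (rval (c i)) u *: vfield (D i) b u.
Proof.
elim: r => [|i r IH]; last by rewrite !big_cons vfield_linear IH.
by rewrite !big_nil; apply/rowP => i; rewrite !mxE rv_zero mulr0.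
Qed.

Lemma tau_idx i j u : tau (chart_idx i) u ord0 (chart_idx j) = u ord0 b * (j == i)%:R.
Proof.
by rewrite !mxE eqxx /= (negPf (chart_idx_a j)) (inj_eq chart_idx_inj) mulr0 subr0.
Qed.

Definition coef_at (D : derivation W) i : regfun W :=
  der D (@subset_refl _ (zset W)) (coord_ratio Wb (chart_idx i)).

(** The vector fields of both sides vanish in the coordinate [b] and agree in those of [chart_idx];
    tangency determines the coordinate [a]. *)
Lemma tangent_expand (D : tangent F W) : D = \sum_i coef_at D i *: partial (chart_idx i).
Proof.
apply: (@derivation_eq C N F W b D) => // u Wu; have ub := Wb Wu.
apply/eqP; rewrite -subr_eq0; apply/eqP; rewrite vfield_sum.
under eq_bigr do rewrite vfield_partial // ?chart_idx_b //.
apply: (@tangent_eq0 u); [|exact: Wa|].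
  rewrite devBr (vfield_tangent _ hF) // sub0r; apply/eqP; rewrite oppr_eq0; apply/eqP.
  elim/big_rec: _ => [|i x _ IH]; last by rewrite devDr devZr tau_tangent // mulr0 add0r.
  by rewrite -(scale0r 0) devZr mul0r.
move=> i ia; rewrite [LHS]mxE [X in _ + X = _]mxE summxE.
have [->|ib] := eqVneq i b.
  rewrite vfield_base // sub0r big1 ?oppr0 // => j _; rewrite mxE mxE mxE.
  rewrite [X in _ * (_ * (X + _))]mxE eqxx /= eq_sym (negPf (chart_idx_b j)) !mxE.
  by rewrite eq_sym (negPf (neq_lift _ _)) andbF mulr0 subrr !mulr0.
have [j ->] := chart_idxP ia ib; rewrite (bigD1 j) //= big1 => [|l lj]; last first.
  by rewrite mxE tau_idx eq_sym (negPf lj) !mulr0.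
rewrite addr0 [X in _ - X]mxE tau_idx eqxx mulr1 !mxE mulrC; apply/eqP; rewrite subr_eq0; apply/eqP.
congr (_ * _); apply: der_germ => [v /chartP[]//|v cv|].
  by rewrite !rv_coord_ratio //; have /chartP[] := cv.
by apply/chartP.
Qed.

Lemma twist_gen_regular : regular F m (fun u : {v | zset W v} => sval u ord0 b ^+ m).
Proof.
move=> u; exists W; split; first exact: svalP.
exists 0%N, ('X_b ^+ m), 1; split=> [||w _]; last by rewrite ev1 oner_neq0 divr1 evXn evX.
  have hX := mpolyX_homog1 C b.
  by have := dhomogMn m hX; rewrite mul1n.
exact: dhomog1.
Qed.

Definition twist_gen : OX F m W := Twist (asboolT twist_gen_regular).

Lemma twist_expand (s : OX F m W) : exists r : regfun W, s = r *: twist_gen.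
Proof.
pose f (u : {v | zset W v}) := Defs.tval s u / sval u ord0 b ^+ m.
have fr : regular F 0 f.
  have sr : regular F m (Defs.tval s) by apply/asboolP; exact: tvalP.
  have hX := mpolyX_homog1 C b.
  move=> u; have [Z [Zu [e [P [Q [hP hQ PQ]]]]]] := sr u; exists Z; split=> //.
  exists (e + m)%N, P, (Q * 'X_b ^+ m); split=> [||w Zw]; first by rewrite addn0.
    by apply: dhomogM => //; have := dhomogMn m hX; rewrite mul1n.
  have [Qw sE] := PQ w Zw; rewrite evM evXn evX mulf_neq0 ?expf_neq0 ?Wb //; last exact: svalP.
  by split=> //; rewrite /f sE invfM mulrA.
exists (RegFun (asboolT fr)); apply/val_inj/funext => u.
rewrite -[RHS]/(f u * sval u ord0 b ^+ m) /f divfK // expf_neq0 // Wb //.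
exact: svalP.
Qed.

Local Notation E := (tensor_presheaf (tangent F) (OX F m)).

Definition tensor_gen (i : 'I_q.+2) : E W := tens (partial (chart_idx i)) twist_gen.

Lemma tensor_expand (x : E W) : exists c : 'I_q.+2 -> regfun W, x = \sum_i c i *: tensor_gen i.
Proof.
elim/tensor_ind: x => [|r D s x [c ->]].
  by exists (fun=> 0); rewrite big1 // => i _; rewrite scale0r.
have [f ->] := twist_expand s; exists (fun i => r * (f * coef_at D i) + c i).
rewrite tensZr {1}(tangent_expand D).
have -> : tens (\sum_i coef_at D i *: partial (chart_idx i)) twist_gen =
    \sum_i coef_at D i *: tensor_gen i.
  elim/big_rec2: _ => [|i y z _ <-]; last by rewrite tensDl tensZl.
  by have := tensZl 0 (0 : tangent F W) twist_gen; rewrite !scale0r.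
exact: scale_combination.
Qed.

Lemma tensor_value_gen (u : {v | zset W v}) w i : frame (sval u) w ->
  tensor_value u w (tensor_gen i) =
  vol (sval u) (tau (chart_idx i) (sval u)) (delta_mx ord0 a) w / ev F^`M(a) (sval u) *
    sval u ord0 b ^+ m.
Proof.
move=> Z; have Wu := svalP u; rewrite tensor_valueE; congr (_ * _).
by rewrite (theta_eq hF smooth _ Wu Z (Wb Wu) (Wa Wu)) vfield_partial // chart_idx_b.
Qed.

(* The frame spanning the kernel of the linear form [tau_0 |-> 1, tau_i |-> y_(i-1)]. *)
Definition tau_frame u (y : 'rV[C]_q.+1) : 'M[C]_(q.+1, N) :=
  \matrix_i (tau (chart_idx (lift ord0 i)) u - y ord0 i *: tau (chart_idx ord0) u).

Lemma tau_frameP u y : zset W u -> frame u (tau_frame u y).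
Proof.
move=> Wu; have [u0 Fu] := zopen_sub Wu; split=> // i.
by rewrite rowK devBr devZr !tau_tangent // mulr0 subrr.
Qed.

Lemma vol_tau_lift u y i : vol u (tau (chart_idx (lift ord0 i)) u) (delta_mx ord0 a) (tau_frame u y) =
  y ord0 i * vol u (tau (chart_idx ord0) u) (delta_mx ord0 a) (tau_frame u y).
Proof.
have -> : tau (chart_idx (lift ord0 i)) u =
    1 *: row i (tau_frame u y) + y ord0 i *: tau (chart_idx ord0) u.
  by rewrite rowK scale1r subrK.
by rewrite vol_linear2 (@vol_alternate_frame2 _ _ _ _ _ _ i) // mulr0 add0r.
Qed.

(** A column killed by all rows has zero entries: first at [a], then at the [chart_idx], and finally
    at [b] because of the row [u]. *)
Lemma vol_tau_neq0 u y : zset W u ->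
  vol u (tau (chart_idx ord0) u) (delta_mx ord0 a) (tau_frame u y) != 0.
Proof.
move=> Wu; have ub := Wb Wu; apply: vol_neq0 => c uc t0 ac tc.
have ca : c a ord0 = 0.
  have := congr1 (fun z : 'M_1 => z ord0 ord0) ac; rewrite -rowE !mxE.
  by [].
have tauc j : tau j u *m c = (u ord0 b * c j ord0)%:M.
  rewrite -scalemxAl mulmxBl -scalemxAl -!rowE; apply/matrixP => r s.
  by rewrite !ord1 !mxE ca mulr0 subr0 eqxx mulr1n.
have lin (A B : V) z : B *m c = 0 -> (A - z *: B) *m c = 0 -> A *m c = 0.
  by move=> Bc; rewrite mulmxBl -scalemxAl Bc scaler0 subr0.
have c_idx i : c (chart_idx i) ord0 = 0.
  suff h : tau (chart_idx i) u *m c = 0.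
    have := congr1 (fun z : 'M_1 => z ord0 ord0) h; rewrite tauc !mxE eqxx mulr1n => /eqP.
    by rewrite mulf_eq0 (negPf ub) => /eqP.
  case: (unliftP ord0 i) => [l ->|-> //]; have := tc l.
  by rewrite rowK; exact: lin.
have cj j : j != b -> c j ord0 = 0.
  move=> jb; have [-> //|ja] := eqVneq j a.
  by have [i ->] := chart_idxP ja jb.
apply/colP => j; rewrite mxE; have [->|/cj//] := eqVneq j b.
have := congr1 (fun z : 'M_1 => z ord0 ord0) uc; rewrite !mxE (bigD1 b) //= big1 => [|l lb].
  by rewrite addr0 => /eqP; rewrite mulf_eq0 (negPf ub) => /eqP.
by rewrite cj // mulr0.
Qed.

Local Notation S := (sympow_presheaf E k).

(** At [tau_frame] with [y] the ratios of the coordinates of [v], the generators take values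
    proportional to these coordinates. So the value of [x] is a nonzero multiple of [G] at [v],
    where the coefficients of the form [G] are the sums over equal exponents; it vanishes whenever
    the first coordinate of [v] is nonzero. *)
Lemma sympow_value_eq0 (x : S W) :
  (forall (u : {v | zset W v}) w, frame (sval u) w -> sympow_value u w x = 0) -> x = 0.
Proof.
move=> hx; have [c xE] := sympow_expand x tensor_expand; rewrite xE.
apply: sym_combination_eq0 => mu; apply: regfunP => u0 Wu0.
rewrite rv_sum rv_zero; pose u : {v | zset W v} := exist _ u0 Wu0.
pose G : {mpoly C[q.+2]} := \sum_f evat u (c f) *: 'X_[idx_mnm f].
suff G0 : G = 0.
  have := congr1 (fun P : {mpoly C[q.+2]} => P@_mu) G0; rewrite mcoeff0 raddf_sum /= => {2}<-.
  rewrite big_mkcond; apply: eq_bigr => f _; rewrite mcoeffZ mcoeffX (rvE _ Wu0).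
  by case: eqP => _; rewrite ?mulr1 ?mulr0.
have XG : 'X_ord0 * G = 0.
  apply: mpoly_ext => v; rewrite ev0 evM evX.
  have [->|v0] := eqVneq (v ord0 ord0) 0; first by rewrite mul0r.
  pose y : 'rV[C]_q.+1 := \row_i (v ord0 (lift ord0 i) / v ord0 ord0).
  have Z := tau_frameP y Wu0; pose w := tau_frame u0 y.
  pose lam := vol u0 (tau (chart_idx ord0) u0) (delta_mx ord0 a) w / ev F^`M(a) u0 * u0 ord0 b ^+ m.
  have lam0 : lam != 0.
    by rewrite !mulf_neq0 ?invr_eq0 ?expf_neq0 ?Wa ?Wb // vol_tau_neq0.
  have valE i : tensor_value u w (tensor_gen i) = lam / v ord0 ord0 * v ord0 i.
    rewrite (tensor_value_gen i (u := u)) //=; case: (unliftP ord0 i) => [l ->|->].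
      by rewrite vol_tau_lift mxE -/w /lam; move: (vol _ _ _ _) => t; field; rewrite v0 Wa.
    by rewrite divfK.
  have := hx u w Z; rewrite xE.
  have L := @sympow_value_semilinear C q m k F W u w.
  have -> : sympow_value u w (\sum_f c f *: sym_monomial tensor_gen f) =
      \sum_f evat u (c f) * \prod_i tensor_value u w (tensor_gen (f i)).
    elim/big_rec2: _ => [|f r s _ <-]; first exact: (semilin0 L).
    rewrite L sympow_valueE; congr (_ * _ + _).
    by apply: eq_bigr => i _; rewrite ffunE.
  under eq_bigr => f _ do (under eq_bigr do rewrite valE; rewrite big_split /= prodr_const card_ord mulrCA).
  rewrite -mulr_sumr => /eqP; rewrite mulf_eq0 expf_eq0 mulf_eq0 invr_eq0 (negPf lam0) (negPf v0) andbF /=.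
  move=> /eqP h; rewrite /G ev_sum -[X in _ * X](_ : \sum_f evat u (c f) * \prod_i v ord0 (f i) = _).
    by rewrite h mulr0.
  apply: eq_bigr => f _; rewrite evZ /idx_mnm; congr (_ * _).
  rewrite -[RHS]/(evpt v _); elim/big_rec2: _ => [|i r s _ ->]; first by rewrite mpolyX0 rmorph1.
  by rewrite mpolyXD rmorphM /= /evpt evX.
move/eqP: XG; rewrite mulf_eq0 => /orP[/eqP X0|/eqP//].
by have := congr1 (fun P => ev P (const_mx 1)) X0; rewrite evX ev0 mxE => /eqP; rewrite oner_eq0.
Qed.

End Chart.

Lemma germ_zero (C : closedFieldType) N (F : {mpoly C[N]}) (A : presheaf F) (v : 'rV[C]_N)
    (s : local_section A) (W : zopen F) (Ws : zset W `<=` zset (dom s)) :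
  zset W v -> res Ws (local_val s) = 0 -> germ v s = germ v (@LocalSection _ _ _ A (zopenT F) 0).
Proof.
move=> Wv s0; have res0 U Z (ZU : zset Z `<=` zset U) : res ZU (0 : A U) = 0.
  exact: (semilin0 (res_semilinear ZU)).
apply/seteqP; split=> t [W' [W's [W't [W'v st]]]].
  pose Z := zopenI W W'; have ZW : zset Z `<=` zset W by move=> u [].
  have ZW' : zset Z `<=` zset W' by move=> u [].
  have ZT : zset Z `<=` zset (zopenT F) by move=> u /zopen_sub.
  exists Z, ZT, (subset_trans ZW' W't); split=> //=; rewrite res0.
  rewrite -(res_comp W't ZW') -st (res_comp W's ZW' (subset_trans ZW Ws)).
  by rewrite -(res_comp Ws ZW) s0 res0.
pose Z := zopenI W W'; have ZW : zset Z `<=` zset W by move=> u [].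
have ZW' : zset Z `<=` zset W' by move=> u [].
exists Z, (subset_trans ZW Ws), (subset_trans ZW' W't); split=> //=.
by rewrite -(res_comp Ws ZW) s0 res0 -(res_comp W't ZW') -st /= !res0.
Qed.

(** If only the coordinate [a] were nonzero, Euler's formula would make it zero too. This provides
    the chart index [b] other than [a]. *)
Lemma second_coord (C : closedFieldType) n d (F : {mpoly C[n.+1]}) (x : 'rV_n.+1) (a : 'I_n.+1) :
  F \is d.-homog -> ev F x = 0 -> x != 0 -> ev F^`M(a) x != 0 ->
  exists b, x ord0 (lift a b) != 0.
Proof.
move=> hF Fx x0 Fa; apply: contrapT => h.
have xb i : i != a -> x ord0 i = 0.
  case: (unliftP a i) => [b -> _|->]; last by rewrite eqxx.
  by apply/eqP/negPn/negP => xb; apply: h; exists b.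
have := dev_euler x hF; rewrite Fx mulr0 /dev (bigD1 a) //= big1 ?addr0 => [/eqP|i /xb ->]; last first.
  by rewrite mul0r.
rewrite mulf_eq0 (negPf Fa) orbF => /eqP xa; case/eqP: x0; apply/rowP => i; rewrite mxE.
by have [->|/xb] := eqVneq i a.
Qed.

(** * Global sections *)

Section GlobalSections.
Variables (C : closedFieldType) (q m k : nat).
Local Notation N := (q.+4).
Variables (F : {mpoly C[N]}).
Hypothesis char0 : forall k, (k.+1)%:R != 0 :> C.
Hypotheses (hF : F \is m.+3.-homog) (smooth : smooth_hypersurface F) (k_gt0 : (0 < k)%N).
Local Notation V := 'rV[C]_N.
Local Notation X := (hypersurface F).
Local Notation S := (sympow_presheaf (tensor_presheaf (tangent F) (OX F m)) k).
Variable sigma : {v | X v} -> set (local_section S).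
Variable s : {v | X v} -> local_section S.
Hypothesis sP : forall x, zset (dom (s x)) (sval x) /\
  forall y, zset (dom (s x)) (sval y) -> sigma y = germ (sval y) (s x).

Definition section_value (v : V) (w : 'M[C]_(q.+1, N)) : C :=
  if pselect (X v) is left h then
    sympow_value (exist _ v (proj1 (sP (exist _ v h)))) w (local_val (s (exist _ v h)))
  else 0.

(** Local sections with the same germ agree on a neighbourhood, and evaluation commutes with
    restriction. *)
Lemma section_valueE x (y : {v | zset (dom (s x)) v}) w :
  section_value (sval y) w = sympow_value y w (local_val (s x)).
Proof.
case: y => v Uv /=; rewrite /section_value; case: pselect => [h|]; last first.
  by case; exact: zopen_sub Uv.
have [Uv' sv] := sP (exist _ v h); have [_ sx] := sP x.
have : germ v (s x) (s (exist _ v h)).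
  rewrite -(sx (exist _ v h) Uv) (sv (exist _ v h) Uv').
  exists (dom (s (exist _ v h))), (@subset_refl _ _), (@subset_refl _ _); split=> //.
move=> [W [Ws [Wt [Wv e]]]].
have := congr1 (@sympow_value C q m k F W (exist _ v Wv) w) e.
rewrite !sympow_value_res (sympow_value_point (u' := exist _ v Uv)) // => ->.
exact: sympow_value_point.
Qed.

Lemma section_value_eq0 v w : tangent_frame F v w -> section_value v w = 0.
Proof.
apply: (phi_eq0 char0 hF smooth) => {v w}.
- move=> v v0 Fv; have Uv := proj1 (sP (exist _ v (conj v0 Fv))).
  by apply: (local_form_good hF smooth Uv) => y w _; exact: section_valueE.
- move=> v w i [v0 Fv _] wi; have Uv := proj1 (sP (exist _ v (conj v0 Fv))).
  rewrite -[v]/(sval (exist _ v Uv)) section_valueE.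
  by apply: (sympow_value_self (i := i)).
- move=> v w c [v0 Fv _]; have Uv := proj1 (sP (exist _ v (conj v0 Fv))).
  rewrite -[v]/(sval (exist _ v Uv)) !section_valueE.
  exact: (sympow_value_shift (exist _ v Uv)).
Qed.

Lemma section_eq0 : sigma = zero_section S.
Proof.
apply: functional_extensionality_dep => x; have [Ux sx] := sP x; rewrite (sx x Ux) /zero_section.
have [x0 Fx] := svalP x; have [|a Fa] := smooth (v := sval x); first by split.
have [b xb] := second_coord hF Fx x0 Fa.
have ha : exists e, F^`M(a) \is e.-homog by exists m.+2; exact: dhomog_deriv.
pose W := zopenI (chart (dom (s x)) (lift a b)) (zprin F ha).
have Ws : zset W `<=` zset (dom (s x)) by move=> v [/chartP[]].
apply: (germ_zero (W := W) (Ws := Ws)).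
  by split; [apply/chartP|split].
apply: (sympow_value_eq0 hF smooth (a := a) (b' := b)) => [v [_ []]//|v [/chartP[]]//|u w Z].
by rewrite sympow_value_res -section_valueE section_value_eq0.
Qed.

End GlobalSections.

Theorem theorem1p3 (R : realType) (n d k : nat) (F : {mpoly R[i][n.+2]}) :
  (2 <= n)%N -> (3 <= d)%N -> F \is d.-homog -> smooth_hypersurface F ->
  (1 <= k)%N ->
  let E := tensor_presheaf (tangent F) (OX F (d - 3)%N) in
  H0 (sympow_presheaf E k) = [set zero_section (sympow_presheaf E k)].
Proof.
case: n F => [|[|q]] // F _ d3 hF smooth k0 E.
(* The truncated subtraction in the twist is exact as [3 <= d]. *)
have dE : d = (d - 3).+3 by rewrite -addn3 subnK.
have {}hF : F \is (d - 3).+3.-homog by rewrite -dE.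
apply/seteqP; split=> [sigma|sigma ->]; last exact: zero_section_H0.
move=> /choice[s sP]; apply: (section_eq0 _ hF smooth k0 sP) => j.
by rewrite pnatr_eq0.
Qed.
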